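(* Let $(M,g)$ be an $n$-dimensional compact oriented Riemannian spin manifold without boundary, with spinor bundle $S(TM)$ and Dirac operator $D$. Let $\Psi$ be a smooth differential form on $M$, acting on spinors by Clifford multiplication (the resulting endomorphism also being denoted $\Psi$), and let $D_\Psi:=D+\Psi$. Then $$D_\Psi^2=-\left[g^{ij}\left(\nabla_{\partial_i}\nabla_{\partial_j}-\nabla_{\nabla^L_{\partial_i}\partial_j}\right)\right]+\frac14 s+\Psi^2-\frac12\left[\nabla^S_{e_j}(\Psi)\,c(e_j)-c(e_j)\,\nabla^S_{e_j}(\Psi)\right]+\frac14\left[c(e_i)\Psi+\Psi c(e_i)\right]^2,$$ where $\nabla$ is the connection on $S(TM)$ given by $\nabla_X=\nabla^S_X-\frac12\left[c(X)\Psi+\Psi c(X)\right]$ for smooth vector fields $X$.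
   Context: Repeated indices are summed; in particular the last two terms are $\sum_j$ and $\sum_i [c(e_i)\Psi+\Psi c(e_i)]^2$. Here $\partial_i$ is a local coordinate frame of $TM$, $g_{ij}=g(\partial_i,\partial_j)$, $(g^{ij})$ is the inverse matrix of $(g_{ij})$, $e_1,\dots,e_n$ is a local orthonormal frame of $TM$ with dual coframe $e^1,\dots,e^n$, $\nabla^L$ is the Levi-Civita connection, $\nabla^S$ is the spin connection on $S(TM)$, $s$ is the scalar curvature. $c(X)$ is Clifford multiplication by $X$, with $c(e_i)c(e_j)+c(e_j)c(e_i)=-2\delta_{ij}$; a form $e^{i_1}\wedge\dots\wedge e^{i_k}$ ($i_1<\dots<i_k$) acts as $c(e_{i_1})\cdots c(e_{i_k})$. $D=\sum_i c(e_i)\nabla^S_{e_i}$. $\nabla^S_{e_j}(\Psi)$ is the covariant derivative of the endomorphism $\Psi$ with respect to the connection induced by $\nabla^S$ on $\mathrm{End}(S(TM))$. *)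

(* Defs.v *)
From HB Require Import structures.
From mathcomp Require Import all_boot all_order all_algebra.
From mathcomp Require Import all_classical all_reals all_analysis.
From mathcomp Require Import complex ring.

Set Implicit Arguments.
Unset Strict Implicit.
Unset Printing Implicit Defensive.

Import Order.TTheory GRing.Theory Num.Theory.
Import numFieldNormedType.Exports.

Local Open Scope classical_set_scope.
Local Open Scope ring_scope.
Local Open Scope complex_scope.

Section SmoothEuclidean.
Context {R : realType} {n : nat}.

Fixpoint iter_pd (l : seq 'I_n) (f : 'rV[R]_n -> R) : 'rV[R]_n -> R :=
  if l is i :: l' then fun v => 'D_(delta_mx 0 i) (iter_pd l' f) v else f.

(* Meaningful for V open: partial derivatives of every order exist and are
   continuous at each point of V. *)
Definition smooth_on (V : set 'rV[R]_n) (f : 'rV[R]_n -> R) : Prop :=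
  forall (l : seq 'I_n) (v : 'rV[R]_n), V v ->
    {for v, continuous (iter_pd l f)} /\
    forall i : 'I_n, derivable (iter_pd l f) v (delta_mx 0 i).

End SmoothEuclidean.

(* chart_map and chart_inv are total functions; only their values on chart_dom
   and on its image are meaningful. *)
Record chart (R : realType) (n : nat) (M : topologicalType) := Chart {
  chart_dom : set M;
  chart_map : M -> 'rV[R]_n;
  chart_inv : 'rV[R]_n -> M;
  chart_dom_open : open chart_dom;
  chart_img_open : open (chart_map @` chart_dom);
  chart_mapK : forall x, chart_dom x -> chart_inv (chart_map x) = x;
  chart_map_cont : forall x, chart_dom x -> {for x, continuous chart_map};
  chart_inv_cont : forall v, (chart_map @` chart_dom) v ->
    {for v, continuous chart_inv} }.

Definition smooth_transition (R : realType) (n : nat) (M : topologicalType)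
    (c c' : chart R n M) : Prop :=
  forall k : 'I_n,
    smooth_on (chart_map c @` (chart_dom c `&` chart_dom c'))
      (fun v => chart_map c' (chart_inv c v) 0 k).

Record manifold (R : realType) (n : nat) := Manifold {
  carrier :> topologicalType;
  manifold_hausdorff : hausdorff_space carrier;
  manifold_countable : @second_countable carrier;
  atlas : set (chart R n carrier);
  atlas_cover : forall x, exists c, atlas c /\ chart_dom c x;
  atlas_compat : forall c c', atlas c -> atlas c' -> smooth_transition c c';
  atlas_maximal : forall c,
    (forall c', atlas c' -> smooth_transition c c' /\ smooth_transition c' c) ->
    atlas c }.

Section Manifold.
Context {R : realType} {n : nat} {M : manifold R n}.
Local Notation chartM := (chart R n M).

Definition chart_at (x : M) : chartM := projT1 (cid (atlas_cover x)).

Lemma chart_at_atlas (x : M) : atlas (chart_at x).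
Proof. by rewrite /chart_at; case: cid => c []. Qed.

Lemma chart_at_dom (x : M) : chart_dom (chart_at x) x.
Proof. by rewrite /chart_at; case: cid => c []. Qed.

Definition smooth_in (c : chartM) (W : set M) (f : M -> R) : Prop :=
  smooth_on (chart_map c @` (chart_dom c `&` W)) (f \o chart_inv c).

Definition smooth_fun (W : set M) (f : M -> R) : Prop :=
  forall c, atlas c -> smooth_in c W f.

Definition csmooth_in (c : chartM) (W : set M) (f : M -> R[i]) : Prop :=
  smooth_in c W (fun x => complex.Re (f x)) /\
  smooth_in c W (fun x => complex.Im (f x)).

Definition csmooth_fun (W : set M) (f : M -> R[i]) : Prop :=
  forall c, atlas c -> csmooth_in c W f.

Definition pd (c : chartM) (i : 'I_n) (f : M -> R) (x : M) : R :=
  'D_(delta_mx 0 i) (f \o chart_inv c) (chart_map c x).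

(* Row i is the coordinate vector of c with index i, in the coordinates c'. *)
Definition jac (c c' : chartM) (x : M) : 'M[R]_n :=
  \matrix_(i, j) pd c i (fun y => chart_map c' y 0 j) x.

(* A tangent vector field is given by its row of components in every chart of
   the atlas; vfield is the raw data, smooth_vfield says that on W the
   components are smooth and obey the transformation law of TM. *)
Definition vfield : Type := chartM -> M -> 'rV[R]_n.

Definition smooth_vfield (W : set M) (X : vfield) : Prop :=
  (forall c c' x, atlas c -> atlas c' -> W x -> chart_dom c x ->
     chart_dom c' x -> X c' x = X c x *m jac c c' x) /\
  (forall c k, atlas c -> smooth_in c W (fun x => X c x 0 k)).

Definition coord_field (c : chartM) (i : 'I_n) : vfield :=
  fun c' x => row i (jac c c' x).

Definition lie_bracket (X Y : vfield) : vfield := fun c x =>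
  \row_k \sum_i (X c x 0 i * pd c i (fun y => Y c y 0 k) x
                 - Y c x 0 i * pd c i (fun y => X c y 0 k) x).

Definition vderiv (X : vfield) (f : M -> R) (x : M) : R :=
  \sum_k X (chart_at x) x 0 k * pd (chart_at x) k f x.

Definition cderiv (X : vfield) (f : M -> R[i]) (x : M) : R[i] :=
  vderiv X (fun y => complex.Re (f y)) x +i*
  vderiv X (fun y => complex.Im (f y)) x.

(* A complex-valued (in particular, possibly real) form of mixed degree.  form_val c x k V is the
   value of the degree k part at x on the k tangent vectors whose components
   in the chart c are the rows of V. *)
Record diff_form := DiffForm {
  form_val : chartM -> M -> forall k : nat, 'M[R]_(k, n) -> R[i];
  form_multilinear : forall c x k (i : 'I_k) (A B C : 'M[R]_(k, n)) (b d : R),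
    atlas c -> chart_dom c x ->
    row i A = b *: row i B + d *: row i C ->
    row' i B = row' i A -> row' i C = row' i A ->
    form_val c x A = b%:C * form_val c x B + d%:C * form_val c x C;
  form_alternating : forall c x k (i j : 'I_k) (A : 'M[R]_(k, n)),
    atlas c -> chart_dom c x ->
    i != j -> row i A = row j A -> form_val c x A = 0;
  form_compat : forall c c' x k (A : 'M[R]_(k, n)),
    atlas c -> atlas c' -> chart_dom c x -> chart_dom c' x ->
    form_val c' x (A *m jac c c' x) = form_val c x A;
  form_smooth : forall c k (f : 'I_k -> 'I_n), atlas c ->
    csmooth_in c [set: M] (fun x => form_val c x (rowsub f 1%:M)) }.

End Manifold.

Arguments vfield {R n} M.
Arguments diff_form {R n} M.

Record riemannian_metric (R : realType) (n : nat) (M : manifold R n) :=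
  RiemannianMetric {
  metric_val :> chart R n M -> M -> 'M[R]_n;
  metric_sym : forall c x, atlas c -> chart_dom c x ->
    (metric_val c x)^T = metric_val c x;
  metric_pos : forall c x (v : 'rV[R]_n), atlas c -> chart_dom c x ->
    v != 0 -> 0 < (v *m metric_val c x *m v^T) 0 0;
  metric_compat : forall c c' x, atlas c -> atlas c' ->
    chart_dom c x -> chart_dom c' x ->
    metric_val c x = jac c c' x *m metric_val c' x *m (jac c c' x)^T;
  metric_smooth : forall c i j, atlas c ->
    smooth_in c [set: M] (fun x => metric_val c x i j) }.

(* An orientation is a covering subatlas with positive Jacobians. *)
Record orientation (R : realType) (n : nat) (M : manifold R n) := Orientation {
  oatlas : set (chart R n M);
  oatlas_sub : forall c, oatlas c -> atlas c;
  oatlas_cover : forall x, exists c, oatlas c /\ chart_dom c x;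
  oatlas_pos : forall c c' x, oatlas c -> oatlas c' ->
    chart_dom c x -> chart_dom c' x -> 0 < \det (jac c c' x) }.

Section Riemannian.
Context {R : realType} {n : nat} {M : manifold R n}.
Variable g : riemannian_metric M.

Definition ip (X Y : vfield M) (x : M) : R :=
  (X (chart_at x) x *m g (chart_at x) x *m (Y (chart_at x) x)^T) 0 0.

(* The Christoffel symbol with lower indices i, j and upper index k. *)
Definition christoffel (c : chart R n M) (i j k : 'I_n) (x : M) : R :=
  2^-1 * \sum_l invmx (g c x) k l *
    (pd c i (fun y => g c y j l) x + pd c j (fun y => g c y i l) x
     - pd c l (fun y => g c y i j) x).

(* The torsion-free and metric properties, which characterize this connection,
   are levi_civita_torsion_free and christoffel_metric below. *)
Definition levi_civita (X Y : vfield M) : vfield M := fun c x =>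
  \row_k (\sum_i X c x 0 i * pd c i (fun y => Y c y 0 k) x
          + \sum_i \sum_j christoffel c i j k x * X c x 0 i * Y c x 0 j).

Definition riemann (X Y Z : vfield M) : vfield M := fun c x =>
  levi_civita X (levi_civita Y Z) c x - levi_civita Y (levi_civita X Z) c x
  - levi_civita (lie_bracket X Y) Z c x.

Definition ginv (c : chart R n M) (x : M) : 'M[R]_n :=
  invmx (\matrix_(i, j) ip (coord_field c i) (coord_field c j) x).

(* The full contraction of the Ricci tensor Ric(Y, Z) = tr (X |-> R(X, Y) Z);
   the unit sphere of dimension n has scalar curvature n (n - 1). *)
Definition scalar_curvature (x : M) : R :=
  let c := chart_at x in
  let d := coord_field c in
  \sum_i \sum_j \sum_k \sum_l
    ginv c x j k * ginv c x i l * ip (riemann (d i) (d j) (d k)) (d l) x.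

Definition orthonormal_frame (W : set M) (e : 'I_n -> vfield M) : Prop :=
  (forall i, smooth_vfield W (e i)) /\
  (forall x i j, W x -> ip (e i) (e j) x = (i == j)%:R).

Definition frame_mx (e : 'I_n -> vfield M) (c : chart R n M) (x : M) :
  'M[R]_n := \matrix_(i, k) e i c x 0 k.

Definition oriented_frame (o : orientation M) (W : set M)
    (e : 'I_n -> vfield M) : Prop :=
  forall c x, oatlas o c -> chart_dom c x -> W x -> 0 < \det (frame_mx e c x).

Lemma pd_eq_dom (c : chart R n M) (i : 'I_n) (f h : M -> R) (x : M) :
  chart_dom c x -> (forall y, chart_dom c y -> f y = h y) ->
  pd c i f x = pd c i h x.
Proof.
move=> cx fh; apply: near_eq_derive.
have imgx : (chart_map c @` chart_dom c) (chart_map c x) by exists x.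
have := open_nbhs_nbhs (conj (@chart_img_open _ _ _ c) imgx).
apply: filterS => v [y cy <-] /=.
by rewrite chart_mapK// fh.
Qed.

Lemma metric_val_sym (c : chart R n M) (x : M) (i j : 'I_n) :
  atlas c -> chart_dom c x -> g c x i j = g c x j i.
Proof. by move=> ac cx; rewrite -[in LHS](metric_sym g ac cx) mxE. Qed.

Lemma metric_unit (c : chart R n M) (x : M) :
  atlas c -> chart_dom c x -> g c x \in unitmx.
Proof.
move=> ac cx; rewrite -row_free_unit -kermx_eq0; apply/eqP/row_matrixP => i.
rewrite row0; apply/eqP/negPn/negP => v0.
have := metric_pos g ac cx v0; rewrite -row_mul mulmx_ker row0 mul0mx mxE.
by rewrite ltxx.
Qed.

Lemma christoffel_sym (c : chart R n M) (i j k : 'I_n) (x : M) :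
  atlas c -> chart_dom c x -> christoffel c i j k x = christoffel c j i k x.
Proof.
move=> ac cx; congr (_ * _); apply: eq_bigr => l _; congr (_ * _).
rewrite [pd c i _ x + _]addrC; congr (_ - _).
by apply: pd_eq_dom => // y cy; exact: metric_val_sym.
Qed.

Lemma levi_civita_torsion_free (X Y : vfield M) (c : chart R n M) (x : M) :
  atlas c -> chart_dom c x ->
  levi_civita X Y c x - levi_civita Y X c x = lie_bracket X Y c x.
Proof.
move=> ac cx; apply/rowP => k; rewrite !mxE opprD addrACA -sumrB.
rewrite [X in _ + (X - _)](_ : _ = \sum_i \sum_j
    christoffel c i j k x * Y c x 0 i * X c x 0 j) ?subrr ?addr0//.
rewrite exchange_big /=; apply: eq_bigr => i _; apply: eq_bigr => j _.
by rewrite christoffel_sym// mulrAC.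
Qed.

Lemma christoffel_metric (c : chart R n M) (i j k : 'I_n) (x : M) :
  atlas c -> chart_dom c x ->
  pd c i (fun y => g c y j k) x =
  \sum_l (christoffel c i j l x * g c x l k +
          christoffel c i k l x * g c x j l).
Proof.
move=> ac cx.
have lower a b m : \sum_l christoffel c a b l x * g c x l m =
    2^-1 * (pd c a (fun y => g c y b m) x + pd c b (fun y => g c y a m) x
            - pd c m (fun y => g c y a b) x).
  set F := fun l => pd c a (fun y => g c y b l) x
    + pd c b (fun y => g c y a l) x - pd c l (fun y => g c y a b) x.
  have -> : \sum_l christoffel c a b l x * g c x l m =
      2^-1 * ((\row_l F l) *m (invmx (g c x))^T *m g c x) 0 m.
    rewrite mxE mulr_sumr; apply: eq_bigr => l _.
    rewrite -mulrA; congr (_ * (_ * _)); rewrite mxE; apply: eq_bigr => p _.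
    by rewrite !mxE mulrC.
  by rewrite trmx_inv metric_sym// mulmxKV ?metric_unit// mxE.
rewrite big_split /= lower.
under eq_bigr do rewrite metric_val_sym//.
rewrite lower -mulrDr.
have sw a b m : pd c a (fun y => g c y b m) x = pd c a (fun y => g c y m b) x.
  by apply: pd_eq_dom => // y cy; exact: metric_val_sym.
rewrite (sw k i j) (sw j i k) (sw i k j).
set u := pd c i _ x; set v := pd c j _ x; set w := pd c k _ x.
by field.
Qed.

End Riemannian.

(* The complex spinor module: a representation of the Clifford algebra of R^n
   on C^N with N = 2 ^ floor(n / 2), which is irreducible for reasons of
   dimension. *)
Record clifford_module (R : realType) (n : nat) := CliffordModule {
  gamma :> 'I_n -> 'M[R[i]]_(2 ^ n./2)%N;
  gamma_rel : forall i j,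
    gamma i *m gamma j + gamma j *m gamma i = (- (i == j)%:R *+ 2)%:M }.

Definition clifford_vec (R : realType) (n : nat) (rho : clifford_module R n)
    (v : 'rV[R]_n) : 'M[R[i]]_(2 ^ n./2)%N := \sum_i (v 0 i)%:C *: rho i.

(* The group Spin(n), acting on spinors: the products of an even number of unit
   vectors.  The spinor module is faithful on the even Clifford algebra, so
   nothing is lost by realizing Spin(n) as a group of matrices. *)
Definition spin_group (R : realType) (n : nat) (rho : clifford_module R n) :
  set 'M[R[i]]_(2 ^ n./2)%N :=
  [set A | exists vs : seq 'rV[R]_n,
     [/\ ~~ odd (size vs),
         (forall v, v \in vs -> \sum_i v 0 i ^+ 2 = 1) &
         A = \prod_(v <- vs) clifford_vec rho v]].

(* A spin structure as a lift of the transition functions of the bundle of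
   oriented orthonormal frames to Spin(n): spin_frame a is a local section of
   the frame bundle, spin_trans a b are the lifted transition functions, and
   spin_cover says that the double covering Spin(n) -> SO(n), A |-> A v A^-1,
   sends them to the change of frame. *)
Record spin_structure (R : realType) (n : nat) (M : manifold R n)
    (g : riemannian_metric M) (o : orientation M) (rho : clifford_module R n) :=
  SpinStructure {
  spin_idx : Type;
  spin_dom : spin_idx -> set M;
  spin_dom_open : forall a, open (spin_dom a);
  spin_dom_cover : forall x, exists a, spin_dom a x;
  spin_frame : spin_idx -> 'I_n -> vfield M;
  spin_frame_on : forall a, orthonormal_frame g (spin_dom a) (spin_frame a);
  spin_frame_or : forall a, oriented_frame o (spin_dom a) (spin_frame a);
  spin_trans : spin_idx -> spin_idx -> M -> 'M[R[i]]_(2 ^ n./2)%N;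
  spin_trans_spin : forall a b x, spin_dom a x -> spin_dom b x ->
    spin_group rho (spin_trans a b x);
  spin_trans_smooth : forall a b k l,
    csmooth_fun (spin_dom a `&` spin_dom b) (fun x => spin_trans a b x k l);
  spin_cover : forall a b x i, spin_dom a x -> spin_dom b x ->
    spin_trans a b x *m rho i =
    (\sum_j (ip g (spin_frame b i) (spin_frame a j) x)%:C *: rho j)
      *m spin_trans a b x;
  spin_cocycle : forall a b c x,
    spin_dom a x -> spin_dom b x -> spin_dom c x ->
    spin_trans a b x *m spin_trans b c x = spin_trans a c x }.

Section SpinGeometry.
Context {R : realType} {n : nat} {M : manifold R n}.
Context {g : riemannian_metric M} {o : orientation M}.
Context {rho : clifford_module R n}.
Variable P : spin_structure g o rho.

(* A section of the spinor bundle, associated to P, is given by its components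
   in the local trivializations; spinor is the raw data. *)
Definition spinor : Type := spin_idx P -> M -> 'cV[R[i]]_(2 ^ n./2)%N.

Definition smooth_spinor (s : spinor) : Prop :=
  (forall a b x, spin_dom a x -> spin_dom b x ->
     s a x = spin_trans a b x *m s b x) /\
  (forall a k, csmooth_fun (spin_dom a) (fun x => s a x k 0)).

Definition cliff (X : vfield M) (s : spinor) : spinor := fun a x =>
  clifford_vec rho (\row_i ip g X (spin_frame a i) x) *m s a x.

(* On spin_dom a, with e = spin_frame a, the form is the sum over the subsets
   I = {i_1 < ... < i_k} of Psi(e_(i_1), ..., e_(i_k)) times the wedge product
   of the dual covectors with indices i_1, ..., i_k. *)
Definition form_act (Psi : diff_form M) (s : spinor) : spinor := fun a x =>
  (\sum_(I : {set 'I_n})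
     form_val Psi (chart_at x) x
       (rowsub (fun r : 'I_#|I| => enum_val r)
          (frame_mx (spin_frame a) (chart_at x) x))
     *: \prod_(i <- enum I) rho i) *m s a x.

(* In the trivialization by the orthonormal frame e = spin_frame a this is
   X + 1/4 sum_(i, j) g(nabla^L_X e_i, e_j) c(e_i) c(e_j). *)
Definition spin_connection (X : vfield M) (s : spinor) : spinor := fun a x =>
  (\col_k cderiv X (fun y => s a y k 0) x)
  + 4^-1 *: ((\sum_i \sum_j
      (ip g (levi_civita g X (spin_frame a i)) (spin_frame a j) x)%:C
        *: (rho i *m rho j)) *m s a x).

Definition dirac (s : spinor) : spinor := fun a x =>
  \sum_i cliff (spin_frame a i) (spin_connection (spin_frame a i) s) a x.

(* The connection induced on End(S), by the Leibniz rule. *)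
Definition end_connection (X : vfield M) (T : spinor -> spinor) (s : spinor) :
  spinor := fun a x =>
  spin_connection X (T s) a x - T (spin_connection X s) a x.

Definition perturbed_dirac (Psi : diff_form M) (s : spinor) : spinor :=
  fun a x => dirac s a x + form_act Psi s a x.

Definition cliff_anticomm (Psi : diff_form M) (X : vfield M) (s : spinor) :
  spinor := fun a x =>
  cliff X (form_act Psi s) a x + form_act Psi (cliff X s) a x.

Definition perturbed_connection (Psi : diff_form M) (X : vfield M)
    (s : spinor) : spinor := fun a x =>
  spin_connection X s a x - 2^-1 *: cliff_anticomm Psi X s a x.

End SpinGeometry.

(* Main.v *)
(** Near the point x, work in the chart chart_at x and in the trivialization
    a, where the spinor connection is d + A with A the spin image of the
    connection matrix of the orthonormal frame spin_frame a.  There the Dirac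
    operator is the sum over k of gamma^k nabla_k with gamma^k parallel, so that
    D^2 is minus the trace of the Hessian plus half of gamma^k gamma^l F_kl; the
    curvature F is the spin image of the Riemann tensor, and the first Bianchi
    identity collapses gamma^k gamma^l F_kl to s/2.  The Psi terms then match
    after expanding the perturbed Laplacian by the Leibniz rule, because
    c(X) Psi + Psi c(X) only involves parallel Clifford multiplication.  All
    other objects of the statement (the chart c, the frame e) enter through
    tensorial expressions at x. *)
Require Import Defs.
From HB Require Import structures.
From mathcomp Require Import all_boot all_order all_algebra.
From mathcomp Require Import all_classical all_reals all_analysis.
From mathcomp Require Import complex ring lra.

Set Implicit Arguments.
Unset Strict Implicit.
Unset Printing Implicit Defensive.

Import Order.TTheory GRing.Theory Num.Theory.
Import numFieldNormedType.Exports.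

Local Open Scope classical_set_scope.
Local Open Scope ring_scope.
Local Open Scope complex_scope.

(** * Partial derivatives *)

(** The definitions read fields and derivatives in [chart_at y], an arbitrary choice that may jump
    from one point y to the next, whereas second-order operators need germs. So each object is first
    shown to agree near x with an expression in one fixed chart, and that expression is
    differentiated. In a composition of two operators the factors are treated differently: the inner
    one acts on the smooth spinor [s] at all points near x; the outer one is evaluated only at x,
    where the fixed chart is [chart_at x] itself and its derivatives are chart derivatives by
    definition. This spares a proof that [perturbed_dirac Psi s] is again a smooth spinor. The
    curvature identities are matrix algebra in the values and derivatives of frame, metric and
    connection at one point; analysis only supplies their hypotheses. Skewness of the curvature is
    visible in the orthonormal frame, the Bianchi identity in coordinates, so both descriptions are
    kept, linked by [frame_curvE]. *)

Section PartialDerivatives.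
Context {R : realType} {n : nat}.
Implicit Types (f : 'rV[R]_n -> R) (v w h : 'rV[R]_n) (V : set 'rV[R]_n).

Lemma is_derive_line f v h (t : R) : derivable f (v + t *: h) h ->
  is_derive t 1 (fun s => f (v + s *: h)) ('D_h f (v + t *: h)).
Proof.
move=> dfv.
have E : (fun k : R => k^-1 *: (((fun s => f (v + s *: h)) \o shift t) (k *: 1)
    - f (v + t *: h))) =
  (fun k : R => k^-1 *: ((f \o shift (v + t *: h)) (k *: h) - f (v + t *: h))).
  apply/funext => k /=; congr (_ *: (f _ - _)).
  by rewrite [k *: 1]mulr1 scalerDl addrCA.
by apply: DeriveDef; rewrite /derivable /derive E.
Qed.

Lemma is_derive_translate f v h c : derivable f (v + c) h ->
  is_derive v h (fun u => f (u + c)) ('D_h f (v + c)).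
Proof.
move=> dfv.
have E : (fun k : R => k^-1 *: (((fun u => f (u + c)) \o shift v) (k *: h)
    - f (v + c))) =
  (fun k : R => k^-1 *: ((f \o shift (v + c)) (k *: h) - f (v + c))).
  by apply/funext => k /=; rewrite addrA.
by apply: DeriveDef; rewrite /derivable /derive E.
Qed.

(** Bounding |s| by |t|, instead of placing s between 0 and t, hides the sign of t from the
    callers. *)
Lemma mean_value_line f v h (t : R) :
  (forall s, `|s| <= `|t| -> derivable f (v + s *: h) h) ->
  exists2 s, `|s| <= `|t| & f (v + t *: h) - f v = t * 'D_h f (v + s *: h).
Proof.
move=> df.
pose F (s : R) : R := f (v + s *: h); pose dF (s : R) : R := 'D_h f (v + s *: h).
have dFs (s : R) : `|s| <= `|t| -> is_derive (s : R^o) (1 : R^o) F (dF s).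
  by move=> st; apply: is_derive_line; exact: df.
have -> : f v = F 0 by rewrite /F scale0r addr0.
have cF a b : (forall s, s \in `[a, b]%R -> `|s| <= `|t|) ->
    {within `[a, b], continuous F}.
  move=> sub; apply: derivable_within_continuous => s /sub st.
  by have := dFs s st => -[].
have [t0|t0] := leP 0 t.
  have sub s : s \in `[0, t]%R -> `|s| <= `|t|.
    by rewrite in_itv /= => /andP[s0 st]; rewrite !ger0_norm.
  have [s s0 E] := MVT_segment t0 (fun s hs => dFs s (sub s (subset_itv_oo_cc hs)))
    (cF _ _ sub).
  by exists s; [exact: sub|rewrite -[LHS]/(F t - F 0) E subr0 mulrC].
have sub s : s \in `[t, 0]%R -> `|s| <= `|t|.
  rewrite in_itv /= => /andP[st s0]; rewrite (ler0_norm s0) (ltr0_norm t0).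
  by rewrite lerN2.
have [s s0 E] := MVT_segment (ltW t0)
  (fun s hs => dFs s (sub s (subset_itv_oo_cc hs))) (cF _ _ sub).
exists s; first exact: sub.
by rewrite -[LHS]/(F t - F 0) -opprB E sub0r mulrN opprK mulrC.
Qed.

Lemma row_norm_le h (b : R) : 0 <= b -> (forall i, `|h 0 i| <= b) -> `|h| <= b.
Proof.
move=> b0 hb; rewrite /Num.Def.normr /= mx_normrE.
by apply: bigmax_le => // -[i j] _ /=; rewrite ord1.
Qed.

Lemma row_coord_le h i : `|h 0 i| <= `|h|.
Proof.
rewrite [leRHS]/Num.Def.normr /= mx_normrE.
exact: (@le_bigmax _ _ _ 0 (fun ij : 'I_1 * 'I_n => `|h ij.1 ij.2|) (0, i)).
Qed.

Lemma norm_delta (i : 'I_n) : `|delta_mx 0 i : 'rV[R]_n| <= 1.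
Proof.
apply: row_norm_le => // j; rewrite mxE /=.
by case: (j == i); rewrite ?normr1 ?normr0.
Qed.

(** The vertices of a staircase path from 0 to h that switches on one coordinate at a time. *)
Definition row_trunc h (k : nat) : 'rV[R]_n :=
  \row_i (if (i < k)%N then h 0 i else 0).

Lemma row_truncS h (k : 'I_n) :
  row_trunc h k.+1 = row_trunc h k + h 0 k *: delta_mx 0 k.
Proof.
apply/rowP => i; rewrite !mxE /= ltnS leq_eqVlt.
have [->|ik] /= := eqVneq i k; first by rewrite eqxx ltnn add0r mulr1.
by rewrite (negbTE (ik : val i != val k)) /= mulr0 addr0.
Qed.

(** The mean value theorem on each edge of the staircase [row_trunc]. In the sup norm the whole
    staircase, shifted to v, stays within |h| of v, so hypotheses on a ball suffice. *)
Lemma telescope_partials f v h (r : R) :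
  (forall w i, `|v - w| < r -> derivable f w (delta_mx 0 i)) -> `|h| < r ->
  exists2 W : 'I_n -> 'rV[R]_n, forall i, `|v - W i| <= `|h| &
    f (v + h) - f v = \sum_i h 0 i * 'D_(delta_mx 0 i) f (W i).
Proof.
move=> df hr.
have near_v (k : 'I_n) (s : R) : `|s| <= `|h 0 k| ->
    `|v - (v + row_trunc h k + s *: delta_mx 0 k)| <= `|h|.
  move=> sk; rewrite -addrA opprD addrA subrr sub0r normrN.
  apply: row_norm_le => // i; rewrite !mxE /=.
  have [->|ik] := eqVneq i k.
    by rewrite ltnn add0r mulr1 (le_trans sk) // row_coord_le.
  by rewrite mulr0 addr0; case: ifP => _; rewrite ?normr0// row_coord_le.
have step (k : 'I_n) : exists w, `|v - w| <= `|h| /\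
    f (v + row_trunc h k.+1) - f (v + row_trunc h k) =
      h 0 k * 'D_(delta_mx 0 k) f w.
  have [s sk E] := @mean_value_line f (v + row_trunc h k) (delta_mx 0 k) (h 0 k)
     (fun s sk => df _ k (le_lt_trans (near_v k s sk) hr)).
  exists (v + row_trunc h k + s *: delta_mx 0 k); split; first exact: near_v.
  by rewrite row_truncS addrA.
exists (fun k => projT1 (cid (step k))) => [k|]; first by case: cid => w [].
under eq_bigr => k _ do (case: cid => w /= [_ <-]).
rewrite -(big_mkord xpredT
  (fun k => f (v + row_trunc h k.+1) - f (v + row_trunc h k))).
rewrite telescope_sumr//; congr (f (_ + _) - f _).
  by apply/rowP => i; rewrite mxE ltn_ord.
by rewrite (_ : row_trunc h 0 = 0) ?addr0//; apply/rowP => i; rewrite !mxE.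
Qed.

(** The candidate differential is the row of partials at v; by [telescope_partials] the error is a
    sum of increments of the partials, weighted by the coordinates of h and small by continuity. *)
Lemma continuous_partials_differentiable f v :
  (\forall w \near v, forall i, derivable f w (delta_mx 0 i)) ->
  (forall i, {for v, continuous (fun w => 'D_(delta_mx 0 i) f w)}) ->
  differentiable f v.
Proof.
move=> df cdf.
pose a i := 'D_(delta_mx 0 i) f v.
pose L0 (h : 'rV[R]_n) : R := \sum_i h 0 i * a i.
have linL : linear L0.
  move=> b h k; rewrite /L0 scaler_sumr -big_split /=; apply: eq_bigr => i _.
  by rewrite !mxE mulrDl -mulrA.
pose LM := GRing.isLinear.Build _ _ _ _ _ linL.
pose L : {linear 'rV[R]_n -> R} := HB.pack L0 LM.
have cL : continuous L.
  move=> h; rewrite (_ : L = \sum_i (fun h => h 0 i * a i) :> (_ -> _)).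
    apply: (@differentiable_continuous _ _ _ h).
    apply: differentiable_sum => i; apply: differentiableM => //.
    exact: differentiable_coord.
  by apply/funext => k; rewrite fct_sumE.
apply/diffP => /=.
(* The differential is a chosen witness, so exhibiting one continuous linear map with the required
   expansion is enough. *)
apply: (@getPex _ (fun (df : {linear 'rV[R]_n -> R}) => continuous df /\
  forall y, f y = f (lim (nbhs v)) + df (y - lim (nbhs v))
                  +o_(y \near v) (y - lim (nbhs v)))).

exists L; split=> //.
suff oE : f = (fun y => f v + L (y - v)) +o_ (nbhs v) (fun y => y - v).
  by move=> y; rewrite lim_id//; move/funeqP: oE => /(_ y).
apply/eqaddoP => _/posnumP[eps].
(* There are n error terms; dividing by n + 1 keeps [d] positive when n = 0. *)
pose d := eps%:num / n.+1%:R.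
have d0 : 0 < d by rewrite divr_gt0.
have /nbhs_ballP[r1 /= r10 H1] := df.
have : \forall w \near v, forall i, `|a i - 'D_(delta_mx 0 i) f w| < d.
  apply: (@filter_forall _ 'I_n
    (fun i w => `|a i - 'D_(delta_mx 0 i) f w| < d) _ (nbhs_filter v)) => i.
  by have /cvgrPdist_lt/(_ d d0) := cdf i.
move=> /nbhs_ballP[r2 /= r20 H2].
pose r := Num.min r1 r2.
have r0 : 0 < r by rewrite lt_min r10.
apply/nbhs_ballP; exists r => //= y; rewrite -ball_normE /= => vy.
set h := y - v.
have hr : `|h| < r by rewrite /h distrC.
have dfr w i : `|v - w| < r -> derivable f w (delta_mx 0 i).
  move=> vw; apply: H1; rewrite -ball_normE /= (lt_le_trans vw)//.
  by rewrite ge_min lexx.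
have [W Wh E] := telescope_partials dfr hr.
have yE : y = v + h by rewrite /h addrC subrK.
rewrite (_ : (f - _) _ = f (v + h) - (f v + L h)); last first.
  by rewrite -yE.
rewrite opprD addrA E /= /L0 -sumrB (le_trans (ler_norm_sum _ _ _))//.
apply: (@le_trans _ _ (\sum_(i < n) d * `|h|)).
  apply: ler_sum => i _; rewrite -mulrBr normrM mulrC ler_pM//.
    rewrite distrC ltW// H2// -ball_normE /= (le_lt_trans (Wh i))//.
    by rewrite (lt_le_trans hr)// ge_min lexx orbT.
  exact: row_coord_le.
rewrite sumr_const card_ord -mulrnAl ler_wpM2r// -mulr_natr /d mulrAC.
by rewrite ler_pdivrMr// ler_wpM2l// ler_nat.
Qed.

(** The mean value theorem in direction i for the increment of f along j, then in direction j for
    the i-th partial. The left side is symmetric in i and j up to rearrangement, which is what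
    [mixed_partials_sym] exploits. *)
Lemma second_difference f v (i j : 'I_n) (r t : R) :
  (forall w, `|v - w| < r -> derivable f w (delta_mx 0 i)) ->
  (forall w, `|v - w| < r ->
     derivable (fun u => 'D_(delta_mx 0 i) f u) w (delta_mx 0 j)) ->
  2 * `|t| < r ->
  exists2 w, `|v - w| <= 2 * `|t| &
    f (v + t *: delta_mx 0 j + t *: delta_mx 0 i) - f (v + t *: delta_mx 0 i)
      - (f (v + t *: delta_mx 0 j) - f v) =
    t * (t * 'D_(delta_mx 0 j) (fun u => 'D_(delta_mx 0 i) f u) w).
Proof.
move=> df ddf tr.
have near_v (s u : R) : `|s| <= `|t| -> `|u| <= `|t| ->
    `|v - (v + s *: delta_mx 0 i + u *: delta_mx 0 j)| <= 2 * `|t|.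
  move=> st ut; rewrite -addrA opprD addrA subrr sub0r normrN mulr2n mulrDl mul1r.
  rewrite (le_trans (ler_normD _ _))// lerD// normrZ.
    by rewrite (le_trans _ st)// ler_piMr// norm_delta.
  by rewrite (le_trans _ ut)// ler_piMr// norm_delta.
pose F w := f (w + t *: delta_mx 0 j) - f w.
have dF s : `|s| <= `|t| -> is_derive (v + s *: delta_mx 0 i) (delta_mx 0 i) F
   ('D_(delta_mx 0 i) f (v + s *: delta_mx 0 i + t *: delta_mx 0 j)
     - 'D_(delta_mx 0 i) f (v + s *: delta_mx 0 i)).
  move=> st; apply: is_deriveB; last first.
    apply: derivableP; apply: df; apply: le_lt_trans tr.
    by have := near_v s 0 st; rewrite scale0r addr0; apply; rewrite normr0.
  apply: is_derive_translate; apply: df; apply: le_lt_trans tr.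
  exact: near_v.
have [s st] := mean_value_line (fun s st => @ex_derive _ _ _ _ _ _ _ (dF s st)).
have -> := @derive_val _ _ _ _ _ _ _ (dF s st).
have [u ut ->] := @mean_value_line (fun u => 'D_(delta_mx 0 i) f u)
  (v + s *: delta_mx 0 i) (delta_mx 0 j) t
  (fun u ut => ddf _ (le_lt_trans (near_v s u st ut) tr)).
move=> E; exists (v + s *: delta_mx 0 i + u *: delta_mx 0 j); first exact: near_v.
by rewrite -E /F [v + t *: delta_mx 0 j + _]addrAC.
Qed.

(* Both sides are limits of the same second difference quotient. *)
Lemma mixed_partials_sym f v (i j : 'I_n) :
  (\forall w \near v, [/\ derivable f w (delta_mx 0 i),
     derivable f w (delta_mx 0 j),
     derivable (iter_pd [:: i] f) w (delta_mx 0 j) &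
     derivable (iter_pd [:: j] f) w (delta_mx 0 i)]) ->
  {for v, continuous (iter_pd [:: j; i] f)} ->
  {for v, continuous (iter_pd [:: i; j] f)} ->
  iter_pd [:: j; i] f v = iter_pd [:: i; j] f v.
Proof.
move=> /nbhs_ballP[r1 /= r10 H1] cij cji.
apply/eqP; rewrite -subr_eq0 -normr_le0; apply/ler_addgt0Pr => e e0.
rewrite add0r.
have e20 : 0 < e / 2 by rewrite divr_gt0.
have /cvgrPdist_lt/(_ _ e20)/nbhs_ballP[r2 /= r20 H2] := cij.
have /cvgrPdist_lt/(_ _ e20)/nbhs_ballP[r3 /= r30 H3] := cji.
pose r := Num.min r1 (Num.min r2 r3).
have r0 : 0 < r by rewrite !lt_min r10 r20.
(* A single step size is enough: the two intermediate points lie within 2|t| < r of v, where each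
   mixed partial is already e/2-close to its value at v. *)
pose t := r / 4.
have t0 : 0 < t by rewrite divr_gt0.
have tr : 2 * `|t| < r by rewrite gtr0_norm// /t; lra.
have [rr1 rr2 rr3] : [/\ r <= r1, r <= r2 & r <= r3].
  by rewrite /r !ge_min !lexx ?orbT.
have near1 w : `|v - w| < r -> ball v r1 w.
  by move=> vw; rewrite -ball_normE /= (lt_le_trans vw).
have [p pr Ep] := second_difference (r := r) (t := t) (i := i) (j := j)
  (fun w vw => let: And4 h _ _ _ := H1 w (near1 w vw) in h)
  (fun w vw => let: And4 _ _ h _ := H1 w (near1 w vw) in h) tr.
have [q qr Eq] := second_difference (r := r) (t := t) (i := j) (j := i)
  (fun w vw => let: And4 _ h _ _ := H1 w (near1 w vw) in h)
  (fun w vw => let: And4 _ _ _ h := H1 w (near1 w vw) in h) tr.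
have pq : iter_pd [:: j; i] f p = iter_pd [:: i; j] f q.
  apply: (@mulfI _ t); first by rewrite gt_eqF.
  apply: (@mulfI _ t); first by rewrite gt_eqF.
  apply: etrans (esym Ep) _; apply: etrans _ Eq.
  rewrite [v + t *: delta_mx 0 j + _]addrAC.
  have swap (x y z u : R) : x - y - (z - u) = x - z - (y - u) by ring.
  exact: swap.
have bp : ball v r2 p.
  by rewrite -ball_normE; apply: (le_lt_trans pr); exact: lt_le_trans tr rr2.
have bq : ball v r3 q.
  by rewrite -ball_normE; apply: (le_lt_trans qr); exact: lt_le_trans tr rr3.
have ak : `|iter_pd [:: j; i] f v - iter_pd [:: i; j] f q| < e / 2.
  by rewrite -pq; exact: H2 bp.
have bk : `|iter_pd [:: i; j] f v - iter_pd [:: i; j] f q| < e / 2 := H3 q bq.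
have close (a b k : R) : `|a - k| < e / 2 -> `|b - k| < e / 2 -> `|a - b| <= e.
  move=> ak' bk'; rewrite (_ : a - b = (a - k) - (b - k)).
    apply: (le_trans (ler_normB _ _)); apply: ltW; rewrite (splitr e).
    exact: ltrD.
  by rewrite opprB addrA subrK.
exact: close ak bk.
Qed.

Lemma derive_change_of_variables f (Phi : 'rV[R]_n -> 'rV[R]_n) v h :
  (forall k, differentiable (fun w => Phi w 0 k) v) ->
  differentiable f (Phi v) ->
  differentiable (f \o Phi) v /\
  'D_h (f \o Phi) v =
    \sum_k 'D_h (fun w => Phi w 0 k) v * 'D_(delta_mx 0 k) f (Phi v).
Proof.
move=> dPhi df.
have E : Phi = \sum_k (fun w => Phi w 0 k *: delta_mx 0 k).
  by apply/funext => w; rewrite fct_sumE [LHS]row_sum_delta.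
have dP : differentiable Phi v.
  rewrite E; apply: differentiable_sum => k; exact: differentiableZl.
have dfP : differentiable (f \o Phi) v by exact: differentiable_comp.
split => //; rewrite deriveE// diff_comp//=.
have -> : 'd Phi v h = \sum_k 'd (fun w => Phi w 0 k) v h *: delta_mx 0 k.
  rewrite {1}E -deriveE; last by rewrite -E.
  rewrite derive_sum => [|k]; last by apply/diff_derivable/differentiableZl.
  apply: eq_bigr => k _; rewrite deriveE; last exact: differentiableZl.
  by rewrite diffZl.
rewrite linear_sum /=; apply: eq_bigr => k _.
by rewrite linearZ /= (deriveE h (dPhi k)) (deriveE _ df).
Qed.

Lemma smooth_on_iter_pd V f l : smooth_on V f -> smooth_on V (iter_pd l f).
Proof.
move=> sf l' v Vv; have /(_ v Vv) := sf (l' ++ l).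
suff -> : iter_pd (l' ++ l) f = iter_pd l' (iter_pd l f) by [].
by elim: l' => //= i l' ->.
Qed.

Lemma smooth_on_derivable V f v i : smooth_on V f -> V v ->
  derivable f v (delta_mx 0 i).
Proof. by move=> sf Vv; have [_] := sf [::] v Vv; apply. Qed.

Lemma smooth_on_differentiable V f v : open V -> smooth_on V f -> V v ->
  differentiable f v.
Proof.
move=> oV sf Vv; apply: continuous_partials_differentiable => [|i].
  apply: filterS (open_nbhs_nbhs (conj oV Vv)) => w Vw i.
  exact: smooth_on_derivable sf Vw.
by have [] := sf [:: i] v Vv.
Qed.

Lemma smooth_on_mixed V f v i j : open V -> smooth_on V f -> V v ->
  iter_pd [:: j; i] f v = iter_pd [:: i; j] f v.
Proof.
move=> oV sf Vv; apply: mixed_partials_sym.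
- apply: filterS (open_nbhs_nbhs (conj oV Vv)) => w Vw.
  by have [[_ d0] [[_ di] [_ dj]]] := (sf [::] w Vw, (sf [:: i] w Vw, sf [:: j] w Vw)).
- by have [] := sf [:: j; i] v Vv.
- by have [] := sf [:: i; j] v Vv.
Qed.

End PartialDerivatives.

(** * Matrix calculus of a derivation at a point *)

(* Axiomatizes both pd and its complexification at a point, so that the matrix
   Leibniz rules need only be proved once. *)
Record derivation (K : comNzRingType) (T : topologicalType) (x : T) := Derivation {
  diffable : (T -> K) -> Prop;
  deriv_at :> (T -> K) -> K;
  diffable_near : forall f h,
    (\forall y \near x, f y = h y) -> diffable f -> diffable h;
  deriv_near : forall f h, (\forall y \near x, f y = h y) -> deriv_at f = deriv_at h;
  diffable_cst : forall a, diffable (fun=> a);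
  deriv_cst : forall a, deriv_at (fun=> a) = 0;
  diffableD : forall f h, diffable f -> diffable h -> diffable (fun y => f y + h y);
  derivD : forall f h, diffable f -> diffable h ->
    deriv_at (fun y => f y + h y) = deriv_at f + deriv_at h;
  diffableM : forall f h, diffable f -> diffable h -> diffable (fun y => f y * h y);
  derivM : forall f h, diffable f -> diffable h ->
    deriv_at (fun y => f y * h y) = deriv_at f * h x + f x * deriv_at h }.

Section MatrixCalculus.
Context {K : comNzRingType} {T : topologicalType} {x : T} (D : derivation K x).

Lemma diffable_ext f h : f =1 h -> diffable D f -> diffable D h.
Proof. by move=> /funext ->. Qed.

Lemma deriv_sum_seq (I : Type) (r : seq I) (f : I -> T -> K) :
  (forall i, diffable D (f i)) ->
  diffable D (fun y => \sum_(i <- r) f i y) /\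
  D (fun y => \sum_(i <- r) f i y) = \sum_(i <- r) D (f i).
Proof.
move=> df; elim: r => [|i r [IH1 IH2]].
  rewrite (_ : (fun y => _) = fun=> 0); last first.
    by apply/funext => y; rewrite big_nil.
  by rewrite big_nil deriv_cst; split => //; exact: diffable_cst.
rewrite (_ : (fun y => _) = fun y => f i y + \sum_(j <- r) f j y); last first.
  by apply/funext => y; rewrite big_cons.
by rewrite big_cons derivD// IH2; split => //; exact: diffableD.
Qed.

Lemma diffable_sum (I : finType) (f : I -> T -> K) :
  (forall i, diffable D (f i)) -> diffable D (fun y => \sum_i f i y).
Proof. by move=> df; have [] := deriv_sum_seq (index_enum I) df. Qed.

Lemma deriv_sum (I : finType) (f : I -> T -> K) :
  (forall i, diffable D (f i)) -> D (fun y => \sum_i f i y) = \sum_i D (f i).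
Proof. by move=> df; have [] := deriv_sum_seq (index_enum I) df. Qed.

Definition mx_diffable m p (F : T -> 'M[K]_(m, p)) :=
  forall i j, diffable D (fun y => F y i j).

Definition mx_deriv m p (F : T -> 'M[K]_(m, p)) : 'M[K]_(m, p) :=
  \matrix_(i, j) D (fun y => F y i j).

Lemma mx_diffable_near m p (F H : T -> 'M[K]_(m, p)) :
  (\forall y \near x, F y = H y) -> mx_diffable F -> mx_diffable H.
Proof.
move=> FH dF i j; apply: diffable_near (dF i j).
by apply: filterS FH => y ->.
Qed.

Lemma mx_deriv_near m p (F H : T -> 'M[K]_(m, p)) :
  (\forall y \near x, F y = H y) -> mx_deriv F = mx_deriv H.
Proof.
move=> FH; apply/matrixP => i j; rewrite !mxE; apply: deriv_near.
by apply: filterS FH => y ->.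
Qed.

Lemma mx_diffable_cst m p (A : 'M[K]_(m, p)) : mx_diffable (fun=> A).
Proof. by move=> i j; exact: diffable_cst. Qed.

Lemma mx_deriv_cst m p (A : 'M[K]_(m, p)) : mx_deriv (fun=> A) = 0.
Proof. by apply/matrixP => i j; rewrite !mxE deriv_cst. Qed.

Lemma mx_diffableD m p (F H : T -> 'M[K]_(m, p)) : mx_diffable F -> mx_diffable H ->
  mx_diffable (fun y => F y + H y).
Proof.
move=> dF dH i j; apply: (diffable_ext (f := fun y => F y i j + H y i j)).
  by move=> y; rewrite mxE.
exact: diffableD.
Qed.

Lemma mx_derivD m p (F H : T -> 'M[K]_(m, p)) : mx_diffable F -> mx_diffable H ->
  mx_deriv (fun y => F y + H y) = mx_deriv F + mx_deriv H.
Proof.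
move=> dF dH; apply/matrixP => i j; rewrite !mxE -derivD//; congr deriv_at.
by apply/funext => y; rewrite mxE.
Qed.

Lemma mx_diffableM m p q (F : T -> 'M[K]_(m, p)) (H : T -> 'M[K]_(p, q)) :
  mx_diffable F -> mx_diffable H -> mx_diffable (fun y => F y *m H y).
Proof.
move=> dF dH i j; apply: (diffable_ext (f := fun y => \sum_k F y i k * H y k j)).
  by move=> y; rewrite mxE.
by apply: diffable_sum => k; exact: diffableM.
Qed.

Lemma mx_derivM m p q (F : T -> 'M[K]_(m, p)) (H : T -> 'M[K]_(p, q)) :
  mx_diffable F -> mx_diffable H ->
  mx_deriv (fun y => F y *m H y) = mx_deriv F *m H x + F x *m mx_deriv H.
Proof.
move=> dF dH; apply/matrixP => i j; rewrite !mxE -big_split /=.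
transitivity (D (fun y => \sum_k F y i k * H y k j)).
  by congr deriv_at; apply/funext => y; rewrite mxE.
rewrite deriv_sum => [|k]; last exact: diffableM.
by apply: eq_bigr => k _; rewrite derivM// !mxE.
Qed.

Lemma mx_diffableZ m p (f : T -> K) (F : T -> 'M[K]_(m, p)) :
  diffable D f -> mx_diffable F -> mx_diffable (fun y => f y *: F y).
Proof.
move=> df dF i j; apply: (diffable_ext (f := fun y => f y * F y i j)).
  by move=> y; rewrite mxE.
exact: diffableM.
Qed.

Lemma mx_derivZ m p (f : T -> K) (F : T -> 'M[K]_(m, p)) :
  diffable D f -> mx_diffable F ->
  mx_deriv (fun y => f y *: F y) = D f *: F x + f x *: mx_deriv F.
Proof.
move=> df dF; apply/matrixP => i j; rewrite !mxE -derivM//; congr deriv_at.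
by apply/funext => y; rewrite mxE.
Qed.

Lemma mx_diffable_sum (I : finType) m p (F : I -> T -> 'M[K]_(m, p)) :
  (forall i, mx_diffable (F i)) -> mx_diffable (fun y => \sum_i F i y).
Proof.
move=> dF i j; apply: (diffable_ext (f := fun y => \sum_k F k y i j)).
  by move=> y; rewrite summxE.
by apply: diffable_sum => k; exact: dF.
Qed.

Lemma mx_deriv_sum (I : finType) m p (F : I -> T -> 'M[K]_(m, p)) :
  (forall i, mx_diffable (F i)) ->
  mx_deriv (fun y => \sum_i F i y) = \sum_i mx_deriv (F i).
Proof.
move=> dF; apply/matrixP => i j; rewrite !(mxE, summxE).
transitivity (D (fun y => \sum_k F k y i j)).
  by congr deriv_at; apply/funext => y; rewrite summxE.
rewrite deriv_sum => [|k]; last exact: dF.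
by apply: eq_bigr => k _; rewrite mxE.
Qed.

Lemma mx_diffable_tr m p (F : T -> 'M[K]_(m, p)) :
  mx_diffable F -> mx_diffable (fun y => (F y)^T).
Proof.
move=> dF i j; apply: (diffable_ext (f := fun y => F y j i)) => // y.
by rewrite mxE.
Qed.

Lemma mx_deriv_tr m p (F : T -> 'M[K]_(m, p)) :
  mx_deriv (fun y => (F y)^T) = (mx_deriv F)^T.
Proof.
apply/matrixP => i j; rewrite !mxE; congr deriv_at.
by apply/funext => y; rewrite mxE.
Qed.

Lemma mx_diffable_row m p i (F : T -> 'M[K]_(m, p)) :
  mx_diffable F -> mx_diffable (fun y => row i (F y)).
Proof.
move=> dF k j; apply: (diffable_ext (f := fun y => F y i j)) => // y.
by rewrite mxE.
Qed.

Lemma mx_deriv_row m p i (F : T -> 'M[K]_(m, p)) :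
  mx_deriv (fun y => row i (F y)) = row i (mx_deriv F).
Proof.
apply/matrixP => k j; rewrite !mxE; congr deriv_at.
by apply/funext => y; rewrite mxE.
Qed.

End MatrixCalculus.

(** * Real and complex partial derivatives in a chart as derivations *)

Section ChartDerivations.
Context {R : realType} {n : nat} {M : manifold R n}.
Variables (c : chart R n M) (x : M).
Hypothesis cx : chart_dom c x.

Lemma near_chart_inv (S : M -> Prop) : (\forall y \near x, S y) ->
  \forall v \near chart_map c x, S (chart_inv c v).
Proof.
move=> Sx; have imgx : (chart_map c @` chart_dom c) (chart_map c x) by exists x.
have H := @chart_inv_cont _ _ _ c _ imgx.
by apply: H; rewrite chart_mapK.
Qed.

Definition pd_diffable (k : 'I_n) (f : M -> R) :=
  derivable (f \o chart_inv c) (chart_map c x) (delta_mx 0 k).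

Lemma pdM (k : 'I_n) (f h : M -> R) : pd_diffable k f -> pd_diffable k h ->
  pd c k (fun y => f y * h y) x = pd c k f x * h x + f x * pd c k h x.
Proof.
move=> df dh; rewrite /pd (deriveM df dh) /= !chart_mapK//.
by rewrite addrC; congr (_ + _); rewrite [LHS]mulrC.
Qed.

Lemma pd_near (k : 'I_n) (f h : M -> R) : (\forall y \near x, f y = h y) ->
  pd c k f x = pd c k h x.
Proof. by move=> fh; apply: near_eq_derive; exact: (near_chart_inv fh). Qed.

Lemma pd_diffable_near (k : 'I_n) (f h : M -> R) : (\forall y \near x, f y = h y) ->
  pd_diffable k f -> pd_diffable k h.
Proof. by move=> fh; apply: near_eq_derivable; exact: (near_chart_inv fh). Qed.

Definition pd_at (k : 'I_n) : derivation R x :=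
  @Derivation _ _ x (pd_diffable k) (fun f => pd c k f x)
    (@pd_diffable_near k) (@pd_near k)
    (fun a => derivable_cst a _ _) (fun a => derive_cst a _ _)
    (fun f h df dh => derivableD df dh) (fun f h df dh => deriveD df dh)
    (fun f h df dh => derivableM df dh) (@pdM k).

Lemma ReM (a b : R[i]) : complex.Re (a * b) =
  complex.Re a * complex.Re b - complex.Im a * complex.Im b.
Proof. by case: a b => ? ? []. Qed.

Lemma ImM (a b : R[i]) : complex.Im (a * b) =
  complex.Re a * complex.Im b + complex.Im a * complex.Re b.
Proof. by case: a b => ? ? []. Qed.

Definition cpd_diffable (k : 'I_n) (f : M -> R[i]) :=
  diffable (pd_at k) (fun y => complex.Re (f y)) /\
  diffable (pd_at k) (fun y => complex.Im (f y)).

Definition cpd (k : 'I_n) (f : M -> R[i]) : R[i] :=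
  pd c k (fun y => complex.Re (f y)) x +i* pd c k (fun y => complex.Im (f y)) x.

Lemma cpd_near (k : 'I_n) (f h : M -> R[i]) : (\forall y \near x, f y = h y) ->
  cpd k f = cpd k h.
Proof.
move=> fh; congr (_ +i* _); apply: pd_near; apply: filterS fh => y ->; by [].
Qed.

Lemma cpd_diffable_near (k : 'I_n) (f h : M -> R[i]) :
  (\forall y \near x, f y = h y) -> cpd_diffable k f -> cpd_diffable k h.
Proof.
move=> fh [dr di]; split; [apply: diffable_near dr|apply: diffable_near di];
  by apply: filterS fh => y ->.
Qed.

Lemma cpd_diffable_cst k a : cpd_diffable k (fun=> a).
Proof. by split; exact: diffable_cst. Qed.

Lemma cpd_cst k a : cpd k (fun=> a) = 0.
Proof.
have H b : pd c k (fun=> b) x = 0 by exact: (deriv_cst (pd_at k)).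
by rewrite /cpd !H.
Qed.

Lemma cpd_diffableD k f h : cpd_diffable k f -> cpd_diffable k h ->
  cpd_diffable k (fun y => f y + h y).
Proof.
move=> [fr fi] [hr hi]; split.
  by apply: diffable_ext (diffableD fr hr) => y; rewrite raddfD.
by apply: diffable_ext (diffableD fi hi) => y; rewrite raddfD.
Qed.

Lemma cpdD k f h : cpd_diffable k f -> cpd_diffable k h ->
  cpd k (fun y => f y + h y) = cpd k f + cpd k h.
Proof.
move=> [fr fi] [hr hi]; apply/eqP; rewrite eq_complex !raddfD /=.
apply/andP; split; apply/eqP.
  apply: etrans (derivD fr hr); apply: (congr1 (fun u => pd c k u x)).
  by apply/funext => y; rewrite raddfD.
apply: etrans (derivD fi hi); apply: (congr1 (fun u => pd c k u x)).
by apply/funext => y; rewrite raddfD.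
Qed.

Lemma diffableB (D : derivation R x) f h : diffable D f -> diffable D h ->
  diffable D (fun y => f y - h y).
Proof.
move=> df dh; apply: (diffable_ext (f := fun y => f y + (-1) * h y)).
  by move=> y; rewrite mulN1r.
by apply: diffableD => //; apply: diffableM => //; exact: diffable_cst.
Qed.

Lemma derivB (D : derivation R x) f h : diffable D f -> diffable D h ->
  D (fun y => f y - h y) = D f - D h.
Proof.
move=> df dh; transitivity (D (fun y => f y + (-1) * h y)).
  by congr deriv_at; apply/funext => y; rewrite mulN1r.
have d1 := diffable_cst D (-1).
by rewrite derivD ?derivM// ?deriv_cst ?mul0r ?add0r ?mulN1r//; exact: diffableM.
Qed.

Lemma cpd_diffableM k f h : cpd_diffable k f -> cpd_diffable k h ->
  cpd_diffable k (fun y => f y * h y).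
Proof.
move=> [fr fi] [hr hi]; split.
  apply: diffable_ext (diffableB (diffableM fr hr) (diffableM fi hi)) => y.
  by rewrite ReM.
apply: diffable_ext (diffableD (diffableM fr hi) (diffableM fi hr)) => y.
by rewrite ImM.
Qed.

Lemma cpdM k f h : cpd_diffable k f -> cpd_diffable k h ->
  cpd k (fun y => f y * h y) = cpd k f * h x + f x * cpd k h.
Proof.
move=> [fr fi] [hr hi]; apply/eqP; rewrite eq_complex !raddfD /=.
have -> : (fun y => complex.Re (f y * h y)) = (fun y =>
    complex.Re (f y) * complex.Re (h y) - complex.Im (f y) * complex.Im (h y)).
  by apply/funext => y; rewrite ReM.
have -> : (fun y => complex.Im (f y * h y)) = (fun y =>
    complex.Re (f y) * complex.Im (h y) + complex.Im (f y) * complex.Re (h y)).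
  by apply/funext => y; rewrite ImM.
have := derivB (diffableM fr hr) (diffableM fi hi).
have := derivD (diffableM fr hi) (diffableM fi hr).
rewrite (derivM fr hr) (derivM fi hi) (derivM fr hi) (derivM fi hr) => /= -> ->.
rewrite !ReM !ImM /cpd /=; apply/andP; split; apply/eqP; ring.
Qed.

Definition cpd_at (k : 'I_n) : derivation R[i] x :=
  @Derivation _ _ x (cpd_diffable k) (cpd k)
    (@cpd_diffable_near k) (@cpd_near k) (@cpd_diffable_cst k) (@cpd_cst k)
    (@cpd_diffableD k) (@cpdD k) (@cpd_diffableM k) (@cpdM k).

Lemma cpd_diffable_real k (f : M -> R) :
  diffable (pd_at k) f -> diffable (cpd_at k) (fun y => (f y)%:C).
Proof. by move=> df; split; [exact: df|exact: (diffable_cst (pd_at k) 0)]. Qed.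

Lemma cpd_real k (f : M -> R) : cpd_at k (fun y => (f y)%:C) = (pd c k f x)%:C.
Proof.
apply/eqP; rewrite eq_complex /= eqxx; apply/eqP.
exact: (deriv_cst (pd_at k)).
Qed.

Lemma mx_diffable_real k m p (F : M -> 'M[R]_(m, p)) :
  mx_diffable (pd_at k) F ->
  mx_diffable (cpd_at k) (fun y => map_mx (real_complex R) (F y)).
Proof.
move=> dF i j.
apply: (diffable_ext (f := fun y => (F y i j)%:C)) => [y|]; first by rewrite mxE.
exact: cpd_diffable_real.
Qed.

Lemma mx_deriv_real k m p (F : M -> 'M[R]_(m, p)) :
  mx_deriv (cpd_at k) (fun y => map_mx (real_complex R) (F y)) =
  map_mx (real_complex R) (mx_deriv (pd_at k) F).
Proof.
apply/matrixP => i j; rewrite !mxE -[RHS]cpd_real; congr deriv_at.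
by apply/funext => y; rewrite mxE.
Qed.

End ChartDerivations.

(** * Changes of charts *)

Section ChartChange.
Context {R : realType} {n : nat} {M : manifold R n}.
Implicit Types (c : chart R n M) (x y : M) (W : set M) (f : M -> R).

Lemma open_chart_img c W : open W -> open (chart_map c @` (chart_dom c `&` W)).
Proof.
move=> oW; rewrite openE => _ [y [cy Wy] <-]; rewrite /interior.
have imgy : (chart_map c @` chart_dom c) (chart_map c y) by exists y.
have N1 := open_nbhs_nbhs (conj (@chart_img_open _ _ _ c) imgy).
have N2 := near_chart_inv cy (open_nbhs_nbhs (conj oW Wy)).
apply: filterS (filterI N1 N2) => v [[z cz <-]] /=.
by rewrite chart_mapK// => Wz; exists z.
Qed.

Section SmoothAt.
Variables (c : chart R n M) (W : set M) (f : M -> R) (x : M).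
Hypotheses (oW : open W) (sf : smooth_in c W f) (cx : chart_dom c x) (Wx : W x).

Let img : (chart_map c @` (chart_dom c `&` W)) (chart_map c x).
Proof. by exists x. Qed.

Lemma smooth_in_differentiable : differentiable (f \o chart_inv c) (chart_map c x).
Proof. exact: smooth_on_differentiable (@open_chart_img c _ oW) sf img. Qed.

Lemma smooth_in_diffable k : diffable (pd_at cx k) f.
Proof. exact: smooth_on_derivable sf img. Qed.

(** [pd] returns to the manifold after each derivative, and agrees with the iterated Euclidean
    partial only where [chart_inv c] is a true inverse. Agreement near the point is what second
    derivatives require. *)
Lemma pd_chart_inv j : \forall v \near chart_map c x,
  iter_pd [:: j] (f \o chart_inv c) v = (pd c j f \o chart_inv c) v.
Proof.
apply: filterS (open_nbhs_nbhs (conj (@open_chart_img c _ oW) img)) => v.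
by case=> y [cy _] <-; rewrite /= /pd chart_mapK.
Qed.

Lemma smooth_in_pd_diffable j k : diffable (pd_at cx k) (pd c j f).
Proof.
have := smooth_on_derivable (i := k) (smooth_on_iter_pd [:: j] sf) img.
by apply: near_eq_derivable; exact: pd_chart_inv.
Qed.

Lemma smooth_in_pdC j k : pd c k (pd c j f) x = pd c j (pd c k f) x.
Proof.
have E i l : (\forall v \near chart_map c x,
    iter_pd [:: i] (f \o chart_inv c) v = (pd c i f \o chart_inv c) v) ->
  pd c l (pd c i f) x = iter_pd [:: l; i] (f \o chart_inv c) (chart_map c x).
  by move=> H; exact: esym (near_eq_derive _ H).
rewrite !E; try exact: pd_chart_inv.
exact: smooth_on_mixed (@open_chart_img c _ oW) sf img.
Qed.

End SmoothAt.

Section Transition.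
Variables (c c' : chart R n M).
Hypotheses (ac : atlas c) (ac' : atlas c').

Lemma smooth_in_coord k : smooth_in c (chart_dom c') (fun y => chart_map c' y 0 k).
Proof. exact: atlas_compat. Qed.

(** The representative h has to match f only near the point. [jac_diffable_r] depends on this: there
    h is an iterated Euclidean partial and f an entry of [jac]. *)
Lemma pd_chain_near (h : 'rV[R]_n -> R) f x k : chart_dom c x -> chart_dom c' x ->
  differentiable h (chart_map c' x) ->
  (\forall v \near chart_map c' x, h v = f (chart_inv c' v)) ->
  pd_diffable c x k f /\
  pd c k f x = \sum_l jac c c' x k l * 'D_(delta_mx 0 l) h (chart_map c' x).
Proof.
move=> cx c'x dh hf.
pose Phi v := chart_map c' (chart_inv c v).
have PhiE : Phi (chart_map c x) = chart_map c' x by rewrite /Phi chart_mapK.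
have dPhi l : differentiable (fun v => Phi v 0 l) (chart_map c x).
  exact: (smooth_in_differentiable (@chart_dom_open _ _ _ c') (smooth_in_coord l)).
have near_f : \forall v \near chart_map c x, (h \o Phi) v = (f \o chart_inv c) v.
  have N1 := near_chart_inv cx (open_nbhs_nbhs (conj (@chart_dom_open _ _ _ c') c'x)).
  have N2 := near_chart_inv cx (chart_map_cont c'x hf).
  apply: filterS (filterI N1 N2) => v [/= c'v hv].
  by rewrite /= hv chart_mapK.
rewrite -PhiE in dh.
have [dhP E] := derive_change_of_variables (delta_mx 0 k) dPhi dh.
split.
  apply: near_eq_derivable near_f _; exact: diff_derivable.
rewrite /pd -(near_eq_derive _ near_f) E; apply: eq_bigr => l _.
by rewrite PhiE mxE.
Qed.

Lemma pd_chain f x k : chart_dom c x -> chart_dom c' x ->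
  differentiable (f \o chart_inv c') (chart_map c' x) ->
  pd_diffable c x k f /\
  pd c k f x = \sum_l jac c c' x k l * pd c' l f x.
Proof.
move=> cx c'x df; apply: (pd_chain_near k cx c'x df).
by near=> v.
Unshelve. all: by end_near.
Qed.

End Transition.

Lemma jac_refl c x : chart_dom c x -> jac c c x = 1%:M.
Proof.
move=> cx; apply/matrixP => i j; rewrite !mxE.
have E : \forall v \near chart_map c x,
   (fun v : 'rV[R]_n => v 0 j) v = ((fun y => chart_map c y 0 j) \o chart_inv c) v.
  have imgx : (chart_map c @` chart_dom c) (chart_map c x) by exists x.
  apply: filterS (open_nbhs_nbhs (conj (@chart_img_open _ _ _ c) imgx)) => v.
  by case=> y cy <- /=; rewrite chart_mapK.
rewrite /pd -(near_eq_derive _ E).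
have := @derive_mx _ _ _ _ (@id 'rV[R]_n) (chart_map c x) (delta_mx 0 i)
  (@derivable_id _ _ _ _).
by rewrite derive_id => /matrixP/(_ 0 j); rewrite !mxE /= eq_sym => <-.
Qed.

Lemma jac_trans c c' c'' x : atlas c -> atlas c' -> atlas c'' ->
  chart_dom c x -> chart_dom c' x -> chart_dom c'' x ->
  jac c c'' x = jac c c' x *m jac c' c'' x.
Proof.
move=> ac ac' ac'' cx c'x c''x; apply/matrixP => i j; rewrite mxE.
have dj : differentiable ((fun y => chart_map c'' y 0 j) \o chart_inv c')
    (chart_map c' x).
  have oc := @chart_dom_open _ _ _ c''.
  exact: (smooth_in_differentiable oc (smooth_in_coord ac' ac'' j)).
have [_ ->] := pd_chain ac ac' i cx c'x dj; rewrite mxE.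
by apply: eq_bigr => l _; rewrite !mxE.
Qed.

Lemma jacK c c' x : atlas c -> atlas c' -> chart_dom c x -> chart_dom c' x ->
  jac c c' x *m jac c' c x = 1%:M.
Proof. by move=> *; rewrite -jac_trans// jac_refl. Qed.

Lemma jac_diffable c c' x k : atlas c -> atlas c' -> forall cx : chart_dom c x,
  chart_dom c' x -> mx_diffable (pd_at cx k) (jac c c').
Proof.
move=> ac ac' cx c'x i j.
have S := smooth_in_coord ac ac' j.
have H := @smooth_in_pd_diffable _ _ _ _ (@chart_dom_open _ _ _ c') S cx c'x i k.
by apply: diffable_ext H => y; rewrite mxE.
Qed.

(** This Jacobian is smooth in the coordinates of c' by compatibility of the atlas, but is
    differentiated in those of c. Coordinate fields of c', read in c, are its rows. *)
Lemma jac_diffable_r c c' x k : atlas c -> atlas c' -> forall cx : chart_dom c x,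
  chart_dom c' x -> mx_diffable (pd_at cx k) (jac c' c).
Proof.
move=> ac ac' cx c'x i j; have S := smooth_in_coord ac' ac j.
have oc := @chart_dom_open _ _ _ c.
have img : (chart_map c' @` (chart_dom c' `&` chart_dom c)) (chart_map c' x).
  by exists x.
have dh := smooth_on_differentiable (@open_chart_img c' _ oc)
  (smooth_on_iter_pd [:: i] S) img.
have near_h : \forall v \near chart_map c' x,
    iter_pd [:: i] ((fun y => chart_map c y 0 j) \o chart_inv c') v =
    (fun y => jac c' c y i j) (chart_inv c' v).
  have N := @pd_chart_inv c' _ (fun y => chart_map c y 0 j) x oc c'x cx i.
  by apply: filterS N => v /= ->; rewrite mxE.
exact: (proj1 (@pd_chain_near c c' ac ac' _ (fun y => jac c' c y i j) x k
  cx c'x dh near_h)).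
Qed.

(** Symmetry of the second derivatives of the transition map; it makes the transformed connection
    torsion-free in [chris_change]. *)
Lemma jac_derivC c c' x k i j : atlas c -> atlas c' -> chart_dom c x ->
  chart_dom c' x ->
  pd c k (fun y => jac c c' y i j) x = pd c i (fun y => jac c c' y k j) x.
Proof.
move=> ac ac' cx c'x; have S := smooth_in_coord ac ac' j.
have := @smooth_in_pdC _ _ _ _ (@chart_dom_open _ _ _ c') S cx c'x i k.
have E a b : pd c a (fun y => jac c c' y b j) x =
    pd c a (pd c b (fun y => chart_map c' y 0 j)) x.
  by apply: (congr1 (fun u => pd c a u x)); apply/funext => y; rewrite mxE.
by rewrite !E.
Qed.

End ChartChange.

Lemma sum_rowE (R : pzRingType) (m p : nat) (u : 'rV[R]_m) (A : 'M[R]_(m, p))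
    (F : 'I_p -> R) :
  \sum_k (u *m A) 0 k * F k = \sum_i u 0 i * \sum_k A i k * F k.
Proof.
transitivity (\sum_k \sum_i u 0 i * (A i k * F k)).
  apply: eq_bigr => k _; rewrite mxE mulr_suml.
  by apply: eq_bigr => i _; rewrite mulrA.
by rewrite exchange_big; apply: eq_bigr => i _; rewrite mulr_sumr.
Qed.

Lemma sum_rowZ (R : pzRingType) (m p q r : nat) (u : 'rV[R]_m) (A : 'M[R]_(m, p))
    (F : 'I_p -> 'M[R]_(q, r)) :
  \sum_k (u *m A) 0 k *: F k = \sum_i u 0 i *: \sum_k A i k *: F k.
Proof.
transitivity (\sum_k \sum_i u 0 i *: (A i k *: F k)).
  apply: eq_bigr => k _; rewrite mxE scaler_suml.
  by apply: eq_bigr => i _; rewrite scalerA.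
by rewrite exchange_big; apply: eq_bigr => i _; rewrite scaler_sumr.
Qed.

(* The standard uniqueness argument: the difference of two torsion-free metric
   connections, with its upper index lowered, is symmetric in its first two
   and antisymmetric in its last two indices. *)
Lemma christoffel_unique (R : numFieldType) (n : nat) (G : 'M[R]_n)
    (A B : 'I_n -> 'M[R]_n) :
  G \in unitmx -> G^T = G ->
  (forall i j k, A i j k = A j i k) -> (forall i j k, B i j k = B j i k) ->
  (forall k, A k *m G + G *m (A k)^T = B k *m G + G *m (B k)^T) ->
  forall k, A k = B k.
Proof.
move=> uG GT Asym Bsym AB.
pose T k := (A k - B k) *m G.
have T_sym i j k : T i j k = T j i k.
  by rewrite !mxE; apply: eq_bigr => l _; rewrite !mxE Asym Bsym.
have T_skew i j k : T i j k = - T i k j.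
  suff /matrixP/(_ j k) : T i = - (T i)^T by rewrite !mxE.
  apply/eqP; rewrite -subr_eq0 opprK; apply/eqP.
  rewrite /T trmx_mul GT linearB /= mulmxBl mulmxBr addrACA AB.
  by rewrite -opprD subrr.
move=> k; apply/eqP; rewrite -subr_eq0.
suff T0 : T k = 0 by rewrite -[_ - _](mulmxK uG) [_ *m G]T0 mul0mx.
apply/matrixP => i j; rewrite [RHS]mxE.
(* Three uses of each symmetry, alternately, lead back to the starting indices with an odd number of
   signs. *)
have : T k i j = - T k i j.
  apply: etrans (T_sym k i j) _; rewrite [LHS]T_skew [T i j k]T_sym.
  rewrite [T j i k]T_skew opprK [T j k i]T_sym; exact: T_skew.
by move/eqP; rewrite -subr_eq0 opprK -mulr2n mulrn_eq0 /= => /eqP.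
Qed.

(** * Christoffel symbols and the Levi-Civita connection under changes of charts *)

Section ConnectionChange.
Context {R : realType} {n : nat} {M : manifold R n}.
Variable g : riemannian_metric M.
Implicit Types (c : chart R n M) (x y : M) (W : set M) (X Y : vfield M).

(** Vectors are rows, so this matrix acts on the right: nabla_k Y = d_k Y + Y *m [chris c k]. The
    sign of every commutator of connection matrices below follows from this convention. *)
Definition chris c k x : 'M[R]_n := \matrix_(j, l) christoffel g c k j l x.

Lemma chris_sym c k l m x : atlas c -> chart_dom c x ->
  chris c k x l m = chris c l x k m.
Proof. by move=> ac cx; rewrite !mxE christoffel_sym. Qed.

Lemma chris_metric c k x (ac : atlas c) (cx : chart_dom c x) :
  mx_deriv (pd_at cx k) (g c) = chris c k x *m g c x + g c x *m (chris c k x)^T.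
Proof.
apply/matrixP => i j; rewrite mxE [LHS]/= (christoffel_metric g _ _ _ ac cx).
rewrite !mxE big_split /=.
by congr (_ + _); apply: eq_bigr => l _; rewrite !mxE// mulrC.
Qed.

Lemma metric_diffable c k x (ac : atlas c) (cx : chart_dom c x) :
  mx_diffable (pd_at cx k) (g c).
Proof.
move=> i j; have sg := metric_smooth g i j ac.
exact: (smooth_in_diffable sg cx Logic.I).
Qed.

Lemma near_dom2 c c' x : chart_dom c x -> chart_dom c' x ->
  \forall y \near x, chart_dom c y /\ chart_dom c' y.
Proof.
by move=> cx c'x; apply: filterI; apply: open_nbhs_nbhs; split => //;
  exact: chart_dom_open.
Qed.

Lemma mx_deriv_chain m p (F : M -> 'M[R]_(m, p)) c c' x k
    (ac : atlas c) (ac' : atlas c') (cx : chart_dom c x) (c'x : chart_dom c' x) :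
  (forall i j, differentiable ((fun y => F y i j) \o chart_inv c') (chart_map c' x)) ->
  mx_diffable (pd_at cx k) F /\
  mx_deriv (pd_at cx k) F = \sum_a jac c c' x k a *: mx_deriv (pd_at c'x a) F.
Proof.
move=> dF; split=> [i j|]; first by have [] := pd_chain ac ac' k cx c'x (dF i j).
apply/matrixP => i j; rewrite mxE summxE.
have [_ /= ->] := pd_chain ac ac' k cx c'x (dF i j).
by apply: eq_bigr => a _; rewrite !mxE.
Qed.

(** The transformation law comes from uniqueness, with no derivative of the inverse metric. The
    right side times the inverse Jacobian is symmetric in its lower indices by [jac_derivC] and
    [chris_sym], and compatible with the metric by differentiating g = J g' J^T;
    [christoffel_unique] then identifies it. *)
Lemma chris_change c c' i x (ac : atlas c) (ac' : atlas c')
    (cx : chart_dom c x) (c'x : chart_dom c' x) :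
  chris c i x *m jac c c' x = mx_deriv (pd_at cx i) (jac c c') +
    jac c c' x *m \sum_a jac c c' x i a *: chris c' a x.
Proof.
set J := jac c c' x.
pose Q k := mx_deriv (pd_at cx k) (jac c c') + J *m \sum_a J k a *: chris c' a x.
pose K := jac c' c x.
have JK : J *m K = 1%:M by exact: jacK.
have KJ : K *m J = 1%:M by exact: jacK.
suff -> : chris c i x = Q i *m K by rewrite -mulmxA KJ mulmx1.
have GE : g c x = J *m g c' x *m J^T by rewrite (metric_compat g ac ac').
apply: (@christoffel_unique _ _ (g c x) (fun k => chris c k x) (fun k => Q k *m K)).
- exact: metric_unit.
- exact: (Defs.metric_sym g ac cx).
- by move=> k l m; exact: chris_sym.
- move=> k l m; rewrite !mxE; apply: eq_bigr => p _; congr (_ * _).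
  rewrite /Q !mxE; congr (_ + _); first exact: jac_derivC.
  under eq_bigr => b _ do rewrite summxE mulr_sumr.
  under [RHS]eq_bigr => b _ do rewrite summxE mulr_sumr.
  rewrite [RHS]exchange_big; apply: eq_bigr => a _; apply: eq_bigr => b _ /=.
  have Z u (A : 'M[R]_n) q r : (u *: A) q r = u * A q r by rewrite mxE.
  by rewrite !Z (chris_sym _ _ _ ac' c'x); ring.
move=> k; rewrite -(chris_metric k ac cx).
have dJ := @jac_diffable _ _ _ _ _ _ k ac ac' cx c'x.
have [dG' dG'E] : mx_diffable (pd_at cx k) (g c') /\
    mx_deriv (pd_at cx k) (g c') = \sum_a J k a *: mx_deriv (pd_at c'x a) (g c').
  apply: mx_deriv_chain => // p q.
  exact: (smooth_in_differentiable openT (metric_smooth g p q ac') c'x Logic.I).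
have -> : mx_deriv (pd_at cx k) (g c) =
    mx_deriv (pd_at cx k) (fun y => jac c c' y *m g c' y *m (jac c c' y)^T).
  apply: mx_deriv_near; apply: filterS (near_dom2 cx c'x) => y [cy c'y].
  by rewrite (metric_compat g ac ac').
rewrite mx_derivM; [|exact: mx_diffableM|exact: mx_diffable_tr].
rewrite mx_derivM// mx_deriv_tr -/J dG'E.
have -> : \sum_a J k a *: mx_deriv (pd_at c'x a) (g c') =
    (\sum_a J k a *: chris c' a x) *m g c' x
    + g c' x *m (\sum_a J k a *: chris c' a x)^T.
  rewrite mulmx_suml linear_sum mulmx_sumr -big_split /=; apply: eq_bigr => a _.
  by rewrite chris_metric// scalerDr -scalemxAl linearZ /= -scalemxAr.
rewrite /Q GE; set S := \sum_a _; set dJk := mx_deriv _ _; set g' := g c' x.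
rewrite trmx_mul [(dJk + _)^T]linearD /= trmx_mul.
have KJT : J^T *m K^T = 1%:M by rewrite -trmx_mul KJ trmx1.
rewrite -!mulmxA [K *m (J *m _)]mulmxA KJ mul1mx [J^T *m (K^T *m _)]mulmxA KJT mul1mx.
rewrite !(mulmxDl, mulmxDr) !mulmxA -!addrA; congr (_ + (_ + _)).
exact: addrC.
Qed.

Lemma levi_civitaE X Y c x (cx : chart_dom c x) : levi_civita g X Y c x =
  \sum_i X c x 0 i *: (mx_deriv (pd_at cx i) (Y c) + Y c x *m chris c i x).
Proof.
apply/rowP => k; rewrite mxE summxE -big_split /=; apply: eq_bigr => i _.
rewrite !mxE mulrDr mulr_sumr; congr (_ + _); apply: eq_bigr => j _.
by rewrite !mxE; ring.
Qed.

(** The derivative of the Jacobian that appears in differentiating Y is the inhomogeneous term of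
    [chris_change]. Y must transform as a vector near x, X only at x. *)
Lemma levi_civita_change X Y c c' W x (ac : atlas c) (ac' : atlas c')
    (cx : chart_dom c x) (c'x : chart_dom c' x) : open W -> W x ->
  smooth_vfield W Y -> X c' x = X c x *m jac c c' x ->
  levi_civita g X Y c' x = levi_civita g X Y c x *m jac c c' x.
Proof.
move=> oW Wx [Yt Ys] Xt.
set J := jac c c' x in Xt *.
rewrite (levi_civitaE X Y c'x) (levi_civitaE X Y cx) Xt sum_rowZ mulmx_suml.
apply: eq_bigr => i _; rewrite -scalemxAl; congr (_ *: _).
have dY : mx_diffable (pd_at cx i) (Y c).
  by move=> p q; rewrite ord1; exact: (smooth_in_diffable (Ys c q ac) cx Wx).
have [_ dY'] : mx_diffable (pd_at cx i) (Y c') /\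
    mx_deriv (pd_at cx i) (Y c') = \sum_a J i a *: mx_deriv (pd_at c'x a) (Y c').
  apply: mx_deriv_chain => // p q; rewrite ord1.
  exact: (smooth_in_differentiable oW (Ys c' q ac') c'x Wx).
under eq_bigr do rewrite scalerDr.
rewrite big_split /= -dY'.
rewrite (@mx_deriv_near _ _ _ _ _ _ (Y c') (fun y => Y c y *m jac c c' y)).
  rewrite mx_derivM//; last exact: jac_diffable.
  rewrite mulmxDl -!mulmxA chris_change// mulmxDr -addrA; congr (_ + (_ + _)).
  rewrite !mulmx_sumr; apply: eq_bigr => a _.
  by rewrite (Yt c c' x)// -!scalemxAr mulmxA.
apply: filterS (filterI (near_dom2 cx c'x) (open_nbhs_nbhs (conj oW Wx))) => y.
by move=> [[cy c'y] Wy]; exact: Yt.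
Qed.

(** The transformation law at one point, towards the one chart that [ip] and [vderiv] read. Raw
    fields such as [levi_civita g X Y] can satisfy it without being known to be smooth. *)
Definition tensorial_at c X x := X (chart_at x) x = X c x *m jac c (chart_at x) x.

Lemma ipE c X Y x : atlas c -> chart_dom c x -> tensorial_at c X x ->
  tensorial_at c Y x -> ip g X Y x = (X c x *m g c x *m (Y c x)^T) 0 0.
Proof.
move=> ac cx Xt Yt; rewrite /ip Xt Yt.
rewrite (metric_compat g ac (chart_at_atlas x) cx (chart_at_dom x)).
by rewrite trmx_mul !mulmxA.
Qed.

Lemma vderivE c X f x : atlas c -> chart_dom c x -> tensorial_at c X x ->
  differentiable (f \o chart_inv (chart_at x)) (chart_map (chart_at x) x) ->
  vderiv X f x = \sum_k X c x 0 k * pd c k f x.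
Proof.
move=> ac cx Xt df; rewrite /vderiv Xt sum_rowE; apply: eq_bigr => i _.
have [_ ->] := pd_chain ac (chart_at_atlas x) i cx (chart_at_dom x) df.
by [].
Qed.

Lemma smooth_tensorial c W X x : atlas c -> chart_dom c x -> W x ->
  smooth_vfield W X -> tensorial_at c X x.
Proof.
by move=> ac cx Wx [Xt _]; apply: Xt => //; [exact: chart_at_atlas|exact: chart_at_dom].
Qed.

Lemma coord_tensorial c c' k x : atlas c -> chart_dom c x -> atlas c' ->
  chart_dom c' x -> tensorial_at c (coord_field c' k) x.
Proof.
move=> ac cx ac' c'x; rewrite /tensorial_at /coord_field -row_mul -jac_trans//.
  exact: chart_at_atlas.
exact: chart_at_dom.
Qed.

End ConnectionChange.

(** * Clifford algebra and curvature *)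

Section CliffordAlgebra.
Context {K : numFieldType} {n N : nat}.
Variable rho : 'I_n -> 'M[K]_N.
Hypothesis rho_rel : forall i j,
  rho i *m rho j + rho j *m rho i = (- (i == j)%:R *+ 2)%:M.

(** The Feynman slash: Clifford multiplication by the vector whose components in the orthonormal
    frame are v. *)
Definition slash (v : 'rV[K]_n) : 'M[K]_N := \sum_b v 0 b *: rho b.

(* The image of an antisymmetric matrix under so(n) -> spin(n). *)
Definition spin_mx (w : 'M[K]_n) : 'M[K]_N :=
  4^-1 *: \sum_i \sum_j w i j *: (rho i *m rho j).

Lemma slash_sum (I : finType) (v : I -> 'rV[K]_n) :
  slash (\sum_i v i) = \sum_i slash (v i).
Proof.
rewrite exchange_big; apply: eq_bigr => b _ /=.
by rewrite summxE scaler_suml.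
Qed.

Lemma slashD u v : slash (u + v) = slash u + slash v.
Proof. by rewrite -big_split; apply: eq_bigr => b _; rewrite mxE scalerDl. Qed.

Lemma slashZ a v : slash (a *: v) = a *: slash v.
Proof. by rewrite scaler_sumr; apply: eq_bigr => b _; rewrite mxE scalerA. Qed.

Lemma slashN v : slash (- v) = - slash v.
Proof. by rewrite -scaleN1r slashZ scaleN1r. Qed.

Lemma slash_delta b : slash (delta_mx 0 b) = rho b.
Proof.
rewrite /slash (bigD1 b)//= mxE !eqxx scale1r big1 ?addr0// => j jb.
by rewrite mxE (negbTE jb) scale0r.
Qed.

Lemma slash_mul v m (A : 'M[K]_(m, n)) (u : 'rV[K]_m) : v = u *m A ->
  slash v = \sum_k u 0 k *: slash (row k A).
Proof.
move=> ->; rewrite mulmx_sum_row slash_sum.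
by apply: eq_bigr => k _; rewrite slashZ.
Qed.

Lemma rho_swap i j : rho i *m rho j = (- (i == j)%:R *+ 2)%:M - rho j *m rho i.
Proof. by rewrite -rho_rel addrK. Qed.

Lemma slash_anticomm u v :
  slash u *m slash v + slash v *m slash u = (- (u *m v^T) 0 0 *+ 2)%:M.
Proof.
rewrite /slash !mulmx_suml.
under eq_bigr do rewrite mulmx_sumr.
under [X in _ + X]eq_bigr do rewrite mulmx_sumr.
rewrite [X in _ + X]exchange_big -big_split /=.
rewrite mxE -sumrN -sumrMnl rmorph_sum /=; apply: eq_bigr => i _.
rewrite -big_split /= (bigD1 i)//= big1 => [|j ji].
  rewrite -!scalemxAl -!scalemxAr !scalerA [v 0 i * _]mulrC -scalerDr rho_rel.
  by rewrite eqxx scale_scalar_mx !mxE addr0 !mulrnAr mulrN mulr1.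
rewrite -!scalemxAl -!scalemxAr !scalerA [v 0 j * _]mulrC -scalerDr rho_rel.
by rewrite eq_sym (negbTE ji) oppr0 mul0rn scale_scalar_mx mulr0 raddf0.
Qed.

Lemma rho_comm2 i j b :
  rho i *m rho j *m rho b - rho b *m (rho i *m rho j) =
  ((i == b)%:R *: rho j - (j == b)%:R *: rho i) *+ 2.
Proof.
rewrite -mulmxA [rho j *m rho b]rho_swap mulmxBr.
rewrite [rho b *m (rho i *m _)]mulmxA.
rewrite [rho b *m rho i]rho_swap mulmxBl !mul_mx_scalar !mul_scalar_mx.
rewrite !mulmxA opprB addrA subrK [b == i]eq_sym !mulNrn !scaleNr opprK addrC.
by rewrite -!scalerMnl mulrnBl.
Qed.

Lemma spin_mxD u w : spin_mx (u + w) = spin_mx u + spin_mx w.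
Proof.
rewrite -scalerDr -big_split; congr (_ *: _); apply: eq_bigr => i _.
by rewrite -big_split; apply: eq_bigr => j _; rewrite mxE scalerDl.
Qed.

Lemma spin_mxN w : spin_mx (- w) = - spin_mx w.
Proof.
rewrite -scalerN -sumrN; congr (_ *: _); apply: eq_bigr => i _.
by rewrite -sumrN; apply: eq_bigr => j _; rewrite mxE scaleNr.
Qed.

Lemma spin_mxZ a w : spin_mx (a *: w) = a *: spin_mx w.
Proof.
rewrite /spin_mx [RHS]scalerA mulrC -[RHS]scalerA; congr (_ *: _).
rewrite scaler_sumr; apply: eq_bigr => i _; rewrite scaler_sumr; apply: eq_bigr => j _.
by rewrite mxE scalerA.
Qed.

Lemma spin_mx_sum (I : finType) (w : I -> 'M[K]_n) :
  spin_mx (\sum_i w i) = \sum_i spin_mx (w i).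
Proof.
apply: (big_morph spin_mx spin_mxD).
by rewrite -[0](scale0r 0) spin_mxZ scale0r.
Qed.

(** The differential of the covering Spin(n) -> SO(n): the commutator with [spin_mx w] acts on
    vectors as w. Each of the two factors rho i, rho j contributes twice row b of w, whence the 4^-1
    in [spin_mx]. *)
Lemma spin_mx_comm_rho (w : 'M[K]_n) b : w^T = - w ->
  spin_mx w *m rho b - rho b *m spin_mx w = slash (row b w).
Proof.
move=> wT; rewrite -scalemxAl -scalemxAr -scalerBr !mulmx_suml mulmx_sumr -sumrB.
have wN i j : w i j = - w j i by have /matrixP/(_ j i) := wT; rewrite !mxE.
transitivity (4^-1 *: \sum_i \sum_j
   (((i == b)%:R * w i j) *: rho j - ((j == b)%:R * w i j) *: rho i) *+ 2).
  congr (_ *: _); apply: eq_bigr => i _.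
  rewrite mulmx_suml mulmx_sumr -sumrB; apply: eq_bigr => j _.
  rewrite -scalemxAl -scalemxAr -scalerBr rho_comm2 -scalerMnr scalerBr !scalerA.
  by rewrite ![w i j * _]mulrC.
have -> : \sum_i \sum_j
    (((i == b)%:R * w i j) *: rho j - ((j == b)%:R * w i j) *: rho i) *+ 2 =
  slash (row b w) *+ 4.
  rewrite (eq_bigr (fun i => (\sum_j ((i == b)%:R * w i j) *: rho j) *+ 2 +
     (\sum_j ((j == b)%:R * w j i) *: rho i) *+ 2)) => [|i _]; last first.
    rewrite -!sumrMnl -big_split /=; apply: eq_bigr => j _.
    by rewrite mulrnBl (wN j i) mulrN scaleNr mulNrn.
  rewrite big_split /= (bigD1 b)//= [X in _ + X + _]big1 => [|i ib]; last first.
    by rewrite big1 ?mul0rn// => j _; rewrite (negbTE ib) mul0r scale0r.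
  rewrite addr0 (_ : \sum_j ((b == b)%:R * w b j) *: rho j = slash (row b w)).
    rewrite (_ : \sum_i _ = slash (row b w) *+ 2) -?mulrnDr//.
    rewrite -sumrMnl; apply: eq_bigr => i _; congr (_ *+ _).
    rewrite (bigD1 b)//= eqxx mul1r mxE big1 ?addr0// => j jb.
    by rewrite (negbTE jb) mul0r scale0r.
  by apply: eq_bigr => j _; rewrite eqxx mul1r mxE.
by rewrite -[slash _ *+ 4]scaler_nat scalerA mulVf ?scale1r// pnatr_eq0.
Qed.

Lemma spin_mx_comm_slash (w : 'M[K]_n) v : w^T = - w ->
  spin_mx w *m slash v - slash v *m spin_mx w = slash (v *m w).
Proof.
move=> wT; rewrite (slash_mul (erefl (v *m w))).
rewrite mulmx_suml mulmx_sumr -sumrB; apply: eq_bigr => b _.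
by rewrite -scalemxAl -scalemxAr -scalerBr spin_mx_comm_rho.
Qed.

Lemma spin_mx_slash (w : 'M[K]_n) :
  spin_mx w = 4^-1 *: \sum_i rho i *m slash (row i w).
Proof.
congr (_ *: _); apply: eq_bigr => i _; rewrite mulmx_sumr.
by apply: eq_bigr => j _; rewrite mxE -scalemxAr.
Qed.

(** The commutator with [spin_mx u] is a derivation, so it is evaluated on the two vector factors of
    each term of [spin_mx w]. The minus sign arises because w acts on rows from the right, which
    reverses the order of composition. *)
Lemma spin_mx_comm (u w : 'M[K]_n) : u^T = - u ->
  spin_mx u *m spin_mx w - spin_mx w *m spin_mx u =
  - spin_mx (u *m w - w *m u).
Proof.
move=> uT.
move: (spin_mx u) (fun i => spin_mx_comm_rho i uT)
  (fun v => spin_mx_comm_slash v uT) => S Srho Sslash.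
rewrite (spin_mx_slash w) -scalemxAr -scalemxAl -scalerBr mulmx_sumr mulmx_suml.
rewrite -sumrB.
rewrite (eq_bigr (fun i => slash (row i u) *m slash (row i w) +
    rho i *m slash (row i (w *m u)))) => [|i _]; last first.
  rewrite row_mul -Srho -Sslash.
  by rewrite mulmxBl mulmxBr !mulmxA addrA subrK.
rewrite big_split /= scalerDr -(spin_mx_slash (w *m u)).
rewrite (_ : \sum_i slash (row i u) *m slash (row i w) =
    - \sum_i rho i *m slash (row i (u *m w))).
  by rewrite scalerN -(spin_mx_slash (u *m w)) spin_mxD spin_mxN opprD opprK.
rewrite -sumrN.
have uN i j : u i j = - u j i by have /matrixP/(_ j i) := uT; rewrite !mxE.
rewrite (eq_bigr (fun i => \sum_j u i j *: (rho j *m slash (row i w)))) => [|i _].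
  rewrite exchange_big; apply: eq_bigr => i _ /=.
  rewrite row_mul (slash_mul (erefl (row i u *m w))) mulmx_sumr -sumrN.
  by apply: eq_bigr => j _; rewrite mxE (uN j) scaleNr -scalemxAr.
rewrite mulmx_suml; apply: eq_bigr => j _; rewrite mxE.
by rewrite -scalemxAl.
Qed.

(** * The first Bianchi identity in the Clifford algebra *)

Section Bianchi.
Variable Rm : 'I_n -> 'I_n -> 'I_n -> 'I_n -> K.
Hypothesis Rm_skew1 : forall p q i j, Rm p q i j = - Rm q p i j.
Hypothesis Rm_skew2 : forall p q i j, Rm p q i j = - Rm p q j i.
Hypothesis Rm_bianchi : forall p q i j, Rm p q i j + Rm q i p j + Rm i p q j = 0.

(** The classical argument: the Bianchi identities for the four cyclic shifts of p, q, i, j, added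
    with signs +, +, -, -, leave twice the difference of the two sides. *)
Lemma curvature_pair_sym p q i j : Rm p q i j = Rm i j p q.
Proof.
have := (Rm_bianchi p q i j, (Rm_bianchi q i j p,
  (Rm_bianchi i j p q, Rm_bianchi j p q i))).
rewrite (Rm_skew2 q i j p) (Rm_skew2 i j q p) (Rm_skew2 j p q i).
rewrite (Rm_skew2 p q j i) (Rm_skew1 p i j q) (Rm_skew2 i p j q) opprK.
rewrite (Rm_skew1 q j p i) (Rm_skew2 j q p i) opprK.
set a := Rm p q i j; set b := Rm q i p j; set c := Rm i p q j.
set d := Rm i j p q; set e := Rm j q i p; set f := Rm j p i q.
move=> [b1 [b2 [b3 b4]]]; apply/eqP; rewrite -subr_eq0.
have : 2 * (a - d) = (a + b + c) + (- b - d + e) - (d + f + c) - (- f - a + e).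
  by ring.
rewrite b1 b2 b3 b4 !subr0 addr0 => /eqP.
by rewrite mulf_eq0 pnatr_eq0.
Qed.

Let cube j := \sum_p \sum_q \sum_i Rm p q i j *: (rho p *m rho q *m rho i).
(** Minus the Ricci tensor when [Rm] is a curvature in an orthonormal frame: [scalar_curvature]
    pairs the first index with the last one. *)
Let ric q j := \sum_p Rm p q p j.

(* The Bianchi identity kills the sum of the cube over the cyclic rotations of
   the indices p, q, i, and moving rho p to the other side turns each rotation
   back into the cube up to a Ricci contraction. *)
Lemma clifford_bianchi_cube j : cube j = (\sum_q ric q j *: rho q) *+ 2.
Proof.
have skew0 p i : Rm p p i j = 0.
  apply/eqP; have /eqP := Rm_skew1 p p i j.
  by rewrite -subr_eq0 opprK -mulr2n mulrn_eq0.
have rot1 : \sum_p \sum_q \sum_i Rm p q i j *: (rho q *m rho i *m rho p) =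
    \sum_p \sum_q \sum_i Rm i p q j *: (rho p *m rho q *m rho i).
  rewrite exchange_big; apply: eq_bigr => q _ /=.
  by rewrite exchange_big.
have rot2 : \sum_p \sum_q \sum_i Rm p q i j *: (rho i *m rho p *m rho q) =
    \sum_p \sum_q \sum_i Rm q i p j *: (rho p *m rho q *m rho i).
  rewrite [RHS]exchange_big; apply: eq_bigr => p _ /=.
  by rewrite exchange_big.
have cyc : cube j + \sum_p \sum_q \sum_i Rm p q i j *: (rho i *m rho p *m rho q)
   + \sum_p \sum_q \sum_i Rm p q i j *: (rho q *m rho i *m rho p) = 0.
  rewrite rot1 rot2 -!big_split big1//= => p _.
  rewrite -!big_split big1//= => q _; rewrite -!big_split big1//= => i _.
  by rewrite -!scalerDl Rm_bianchi scale0r.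
pose L (X : 'I_n -> 'I_n -> 'I_n -> 'M[K]_N) :=
  \sum_p \sum_q \sum_i Rm p q i j *: X p q i.
have LX X Y : (forall p q i, X p q i = Y p q i) -> L X = L Y.
  move=> XY; apply: eq_bigr => p _; apply: eq_bigr => q _.
  by apply: eq_bigr => i _; rewrite XY.
have LD X Y : L (fun p q i => X p q i + Y p q i) = L X + L Y.
  rewrite -big_split; apply: eq_bigr => p _; rewrite -big_split.
  apply: eq_bigr => q _; rewrite -big_split.
  by apply: eq_bigr => i _; rewrite scalerDr.
have LN X : L (fun p q i => - X p q i) = - L X.
  rewrite -sumrN; apply: eq_bigr => p _; rewrite -sumrN.
  apply: eq_bigr => q _; rewrite -sumrN.
  by apply: eq_bigr => i _; rewrite scalerN.
have ric1 : L (fun p q i => (i == p)%:R *: rho q) =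
    \sum_q ric q j *: rho q.
  rewrite /L exchange_big; apply: eq_bigr => q _ /=; rewrite scaler_suml.
  apply: eq_bigr => p _; rewrite (bigD1 p)//= eqxx scale1r big1 ?addr0// => i ip.
  by rewrite (negbTE ip) scale0r scaler0.
have ric2 : L (fun p q i => (q == i)%:R *: rho p) =
    - \sum_q ric q j *: rho q.
  rewrite /L -sumrN; apply: eq_bigr => p _; rewrite scaler_suml -sumrN.
  apply: eq_bigr => q _; rewrite (bigD1 q)//= eqxx scale1r big1 ?addr0.
    by rewrite Rm_skew1 scaleNr.
  by move=> i iq; rewrite eq_sym (negbTE iq) scale0r scaler0.
have ric3 : L (fun p q i => (q == p)%:R *: rho i) = 0.
  rewrite /L big1// => p _; rewrite (bigD1 p)//= [X in _ + X]big1 ?addr0.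
    by rewrite big1// => i _; rewrite skew0 scale0r.
  by move=> q qp; rewrite big1// => i _; rewrite (negbTE qp) scale0r scaler0.
have e1 : L (fun p q i => rho q *m rho i *m rho p) =
    cube j - (\sum_q ric q j *: rho q) *+ 2.
  rewrite (LX _ (fun p q i => rho p *m rho q *m rho i
      + (((q == p)%:R *: rho i - (i == p)%:R *: rho q)
         + ((q == p)%:R *: rho i - (i == p)%:R *: rho q)))).
    by rewrite !LD !LN ric3 ric1 sub0r mulr2n opprD.
  by move=> p q i; rewrite -mulr2n -rho_comm2 mulmxA addrC subrK.
have e2 : L (fun p q i => rho i *m rho p *m rho q) =
    cube j - (\sum_q ric q j *: rho q) *+ 4.
  rewrite (LX _ (fun p q i => rho p *m rho q *m rho i
      - (((p == i)%:R *: rho q - (q == i)%:R *: rho p)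
         + ((p == i)%:R *: rho q - (q == i)%:R *: rho p)))).
    rewrite !(LD, LN) (LX (fun p q i => (p == i)%:R *: rho q) _
      (fun p q i => congr1 (fun b : bool => b%:R *: rho q) (eq_sym p i))).
    by rewrite ric1 ric2 opprK -!mulr2n -mulrnA.
  move=> p q i; rewrite -mulr2n -rho_comm2.
  by rewrite opprB addrC subrK mulmxA.
move: cyc; rewrite [X in _ + X + _]e2 [X in _ + X]e1 => cyc.
(* With B the Ricci sum, the cyclic identity reads cube + (cube - 4 B) + (cube - 2 B) = 0. The
   rotations differ because the contraction of p with q vanishes by skewness, while those of i with
   p and of i with q add up. *)
have c3 : cube j *+ 3 = (\sum_q ric q j *: rho q) *+ 6.
  apply/eqP; rewrite -subr_eq0; apply/eqP; apply: etrans cyc.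
  set A := cube j; set B := \sum_q _.
  by rewrite [A + (A - _)]addrA -mulr2n addrACA -mulrSr -opprD -mulrnDr.
apply: (@scalerI _ _ 3); first by rewrite pnatr_eq0.
by rewrite !scaler_nat c3 -mulrnA.
Qed.

(** Collapsing the cube leaves the Ricci contraction against rho q rho j. By [curvature_pair_sym]
    that contraction is symmetric, so only the anticommutator of rho q and rho j, hence the trace,
    survives. *)
Lemma clifford_bianchi :
  \sum_p \sum_q \sum_i \sum_j
     Rm p q i j *: (rho p *m rho q *m (rho i *m rho j)) =
  (2 * \sum_p \sum_q Rm p q q p)%:M.
Proof.
transitivity (\sum_j cube j *m rho j).
  under [RHS]eq_bigr => j _ do rewrite /cube mulmx_suml.
  rewrite [RHS]exchange_big; apply: eq_bigr => p _ /=.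
  under [RHS]eq_bigr => j _ do rewrite mulmx_suml.
  rewrite [RHS]exchange_big; apply: eq_bigr => q _ /=.
  under [RHS]eq_bigr => j _ do rewrite mulmx_suml.
  rewrite [RHS]exchange_big; apply: eq_bigr => i _ /=.
  by apply: eq_bigr => j _; rewrite -scalemxAl mulmxA.
have ric_sym q j : ric q j = ric j q.
  by apply: eq_bigr => p _; rewrite curvature_pair_sym.
have tr_ric : \sum_p \sum_q Rm p q q p = - \sum_q ric q q.
  rewrite exchange_big -sumrN; apply: eq_bigr => q _ /=; rewrite -sumrN.
  by apply: eq_bigr => p _; rewrite Rm_skew2.
have ric_sum : \sum_q \sum_j ric q j *: (rho q *m rho j) =
    (\sum_p \sum_q Rm p q q p)%:M.
  apply: (@scalerI _ _ 2); first by rewrite pnatr_eq0.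
  rewrite scaler_nat {1}mulr2n [X in _ + X]exchange_big -big_split /=.
  rewrite tr_ric scale_scalar_mx mulrN mulr_sumr -sumrN rmorph_sum.
  apply: eq_bigr => q _ /=; rewrite -big_split /= (bigD1 q)//= big1 => [|j jq].
    rewrite addr0 -scalerDr rho_rel eqxx scale_scalar_mx mulrnAr mulrN1.
    by rewrite mulr_natl mulNrn.
  rewrite (ric_sym j) -scalerDr rho_rel eq_sym (negbTE jq).
  by rewrite oppr0 mul0rn raddf0 scaler0.
under eq_bigr do rewrite clifford_bianchi_cube mulr2n mulmxDl -mulr2n mulmx_suml.
rewrite sumrMnl -[RHS]scale_scalar_mx -ric_sum scaler_nat; congr (_ *+ 2).
rewrite exchange_big; apply: eq_bigr => q _; apply: eq_bigr => j _.
by rewrite -scalemxAl.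
Qed.

End Bianchi.

(** * Curvature algebra in the 2-jet of an orthonormal frame at one point *)

Section FrameCurvature.
Variables (E G : 'M[K]_n) (Gam w : 'I_n -> 'M[K]_n).
Variables (dE : 'I_n -> 'M[K]_n) (ddE dGam dw : 'I_n -> 'I_n -> 'M[K]_n).
Hypothesis frameE : E *m (G *m E^T) = 1%:M.
Hypothesis Gam_sym : forall k l m, Gam k l m = Gam l k m.
Hypothesis dGam_sym : forall k l m p, dGam k l m p = dGam k m l p.
Hypothesis ddE_sym : forall k l, ddE k l = ddE l k.
Hypothesis w_skew : forall k, (w k)^T = - w k.
Hypothesis dw_skew : forall k l, (dw k l)^T = - dw k l.
Hypothesis dE_eq : forall k, dE k + E *m Gam k = w k *m E.
Hypothesis ddE_eq : forall k l,
  ddE k l + dE k *m Gam l + E *m dGam k l = dw k l *m E + w l *m dE k.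

(** [dGam k l] stands for the k-th partial of [Gam l], and likewise for [dw] and [ddE]. The
    commutator is subtracted because nabla_k nabla_l Y contains Y *m Gam l *m Gam k in the row
    convention. *)
Definition coord_curv k l : 'M[K]_n :=
  dGam k l - dGam l k - (Gam k *m Gam l - Gam l *m Gam k).

Definition frame_curv k l : 'M[K]_n :=
  dw k l - dw l k - (w k *m w l - w l *m w k).

(** Clifford multiplication by dx^l, while [gamma_dn l] is that by the coordinate vector of index l,
    whose frame components are the scalar products in row l of G *m E^T. *)
Definition gamma_up l := slash (row l E^T).
Definition gamma_dn l := slash (row l (G *m E^T)).
(** By [frameE] this is the inverse of G, written as a polynomial in the frame. *)
Definition inv_metric := E^T *m E.

Lemma inv_metric_sym k l : inv_metric k l = inv_metric l k.
Proof.
have /matrixP/(_ k l) : inv_metric^T = inv_metric by rewrite trmx_mul trmxK.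
by rewrite mxE.
Qed.

(** Eliminating [dE] from the differentiated structure equation [ddE_eq] and antisymmetrizing in k
    and l removes [ddE]; the mixed terms w E Gam cancel, leaving the two curvatures. *)
Lemma frame_curvE k l : frame_curv k l = E *m coord_curv k l *m (G *m E^T).
Proof.
suff EE : frame_curv k l *m E = E *m coord_curv k l.
  by rewrite -EE -mulmxA frameE mulmx1.
have dEk m : dE m = w m *m E - E *m Gam m by rewrite -dE_eq addrK.
have dwE a b : dw a b *m E = ddE a b + (w a *m E *m Gam b - E *m Gam a *m Gam b)
   + E *m dGam a b - (w b *m w a *m E - w b *m E *m Gam a).
  have := ddE_eq a b; rewrite (dEk a) mulmxBl mulmxBr !mulmxA => ->.
  by rewrite addrK.
rewrite /frame_curv /coord_curv !(mulmxBl, mulmxBr) !dwE (ddE_sym l k) !mulmxA.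
move: (ddE k l) (w k *m E *m Gam l) (w l *m E *m Gam k) (E *m Gam k *m Gam l).
move: (E *m Gam l *m Gam k) (w k *m w l *m E) (w l *m w k *m E).
move: (E *m dGam k l) (E *m dGam l k) => *.
by apply/matrixP => i j; rewrite !mxE; ring.
Qed.

Lemma frame_curv_skew k l i j : frame_curv k l i j = - frame_curv k l j i.
Proof.
suff : (frame_curv k l)^T = - frame_curv k l.
  by move=> /matrixP/(_ j i); rewrite !mxE.
rewrite /frame_curv !linearB /= !trmx_mul !dw_skew !w_skew !mulNmx !mulmxN !opprK.
move: (dw k l) (dw l k) (w k *m w l) (w l *m w k) => *.
by apply/matrixP => p q; rewrite !mxE; ring.
Qed.

(** Torsion-freeness, expressed by the symmetry of [Gam] and [dGam] in the lower indices, pairs off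
    all terms of the cyclic sum. *)
Lemma coord_curv_bianchi k l m p :
  coord_curv k l m p + coord_curv l m k p + coord_curv m k l p = 0.
Proof.
have GG a b c : (Gam a *m Gam b) c p = (Gam c *m Gam b) a p.
  by rewrite !mxE; apply: eq_bigr => q _; rewrite Gam_sym.
have mxB (U V : 'M[K]_n) a b : (U - V) a b = U a b - V a b by rewrite !mxE.
rewrite /coord_curv !mxB.
rewrite (dGam_sym k l) (dGam_sym l m) (dGam_sym m k).
rewrite (GG k l) (GG l m) (GG m k).
by ring.
Qed.

Definition curv_comp p q i j : K :=
  \sum_k \sum_l E p k * E q l * frame_curv k l i j.

(** The coordinate identity is carried to the frame by applying E in the three slots of the cyclic
    sum. The fourth slot stays a frame index throughout, as in [T]. *)
Lemma curv_comp_bianchi p q i j :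
  curv_comp p q i j + curv_comp q i p j + curv_comp i p q j = 0.
Proof.
pose T k l m := \sum_s coord_curv k l m s * (G *m E^T) s j.
have TE a b c : curv_comp a b c j =
    \sum_k \sum_l \sum_m E a k * E b l * E c m * T k l m.
  apply: eq_bigr => k _; apply: eq_bigr => l _.
  rewrite frame_curvE -mulmxA mxE mulr_sumr; apply: eq_bigr => m _.
  by rewrite -!mulrA; congr (_ * (_ * (_ * _))); rewrite mxE.
have T0 k l m : T k l m + T l m k + T m k l = 0.
  rewrite -!big_split big1//= => s _.
  by rewrite -!mulrDl coord_curv_bianchi mul0r.
have -> : curv_comp q i p j =
    \sum_k \sum_l \sum_m E p k * E q l * E i m * T l m k.
  rewrite TE.
  under eq_bigr => l _ do rewrite exchange_big.
  rewrite exchange_big; apply: eq_bigr => k _ /=; apply: eq_bigr => l _.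
  by apply: eq_bigr => m _; congr (_ * _); ring.
have -> : curv_comp i p q j =
    \sum_k \sum_l \sum_m E p k * E q l * E i m * T m k l.
  rewrite TE exchange_big; apply: eq_bigr => k _ /=.
  rewrite exchange_big; apply: eq_bigr => l _ /=.
  by apply: eq_bigr => m _; congr (_ * _); ring.
rewrite TE -!big_split big1//= => k _; rewrite -!big_split big1//= => l _.
by rewrite -!big_split big1//= => m _; rewrite -!mulrDr T0 mulr0.
Qed.

(** Summing over a repeated frame index produces E^T *m E, the inverse metric. The right side is the
    contraction that defines [scalar_curvature], so this fixes the sign and normalization of s. *)
Lemma curv_comp_trace : \sum_p \sum_q curv_comp p q q p =
  \sum_i \sum_j \sum_k \sum_l
    inv_metric j k * inv_metric i l * (coord_curv i j *m G) k l.
Proof.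
transitivity (\sum_k \sum_l (E^T *m frame_curv k l *m E) l k).
  under eq_bigr => p _ do rewrite exchange_big.
  rewrite exchange_big; apply: eq_bigr => k _ /=.
  under eq_bigr => p _ do rewrite exchange_big.
  rewrite exchange_big; apply: eq_bigr => l _ /=.
  rewrite [RHS]mxE; apply: eq_bigr => p _.
  rewrite [(E^T *m _) l p]mxE mulr_suml.
  by apply: eq_bigr => q _; rewrite [E^T l q]mxE; ring.
apply: eq_bigr => i _; apply: eq_bigr => j _.
rewrite frame_curvE !mulmxA -mulmxA -(mulmxA _ G) -/inv_metric -mulmxA.
rewrite [coord_curv i j *m _]mulmxA [LHS]mxE; apply: eq_bigr => k _.
rewrite [_ k i]mxE mulr_sumr; apply: eq_bigr => l _.
by rewrite (inv_metric_sym l i); ring.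
Qed.

(** The E factors turn the coordinate contraction into the frame contraction of [clifford_bianchi];
    its 2 times the 4^-1 of [spin_mx] is the constant 2^-1. *)
Lemma gamma_curvature :
  \sum_k \sum_l gamma_up k *m gamma_up l *m spin_mx (frame_curv k l) =
  (2^-1 * \sum_p \sum_q curv_comp p q q p)%:M.
Proof.
have skew1 p q i j : curv_comp p q i j = - curv_comp q p i j.
  rewrite /curv_comp exchange_big -sumrN; apply: eq_bigr => k _ /=.
  rewrite -sumrN; apply: eq_bigr => l _; rewrite -mulrN [E p _ * _]mulrC.
  congr (_ * _); rewrite /frame_curv !mxE; ring.
have skew2 p q i j : curv_comp p q i j = - curv_comp p q j i.
  rewrite -sumrN; apply: eq_bigr => k _; rewrite -sumrN; apply: eq_bigr => l _.
  by rewrite -mulrN -frame_curv_skew.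
have := clifford_bianchi skew1 skew2 curv_comp_bianchi.
move=> /(congr1 (fun A => 4^-1 *: A)).
rewrite scale_scalar_mx mulrA (_ : 4^-1 * 2 = 2^-1 :> K); last by field.
move=> <-; rewrite pair_big /=.
transitivity (\sum_(kl : 'I_n * 'I_n) \sum_(pq : 'I_n * 'I_n)
    (E pq.1 kl.1 * E pq.2 kl.2) *:
       (rho pq.1 *m rho pq.2 *m spin_mx (frame_curv kl.1 kl.2))).
  apply: eq_bigr => -[k l] _ /=.
  rewrite /gamma_up /slash mulmx_suml mulmx_suml.
  rewrite -(pair_big xpredT xpredT (fun p q => (E p k * E q l) *:
    (rho p *m rho q *m spin_mx (frame_curv k l)))) /=.
  apply: eq_bigr => p _; rewrite mulmx_sumr mulmx_suml; apply: eq_bigr => q _.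
  rewrite [row k _ 0 p]mxE [row l _ 0 q]mxE ![E^T _ _]mxE.
  move: (spin_mx _) => S.
  by rewrite -!scalemxAl -!scalemxAr -!scalemxAl scalerA.
rewrite exchange_big [in RHS]pair_big /= scaler_sumr.
apply: eq_bigr => -[p q] _ /=.
transitivity (rho p *m rho q *m spin_mx
    (\sum_(kl : 'I_n * 'I_n) (E p kl.1 * E q kl.2) *: frame_curv kl.1 kl.2)).
  rewrite spin_mx_sum mulmx_sumr; apply: eq_bigr => -[k l] _ /=.
  by rewrite spin_mxZ; move: (spin_mx _) => S; rewrite -scalemxAr.
rewrite -scalemxAr mulmx_sumr; congr (_ *: _); apply: eq_bigr => i _.
rewrite mulmx_sumr; apply: eq_bigr => j _; rewrite -scalemxAr; congr (_ *: _).
rewrite summxE /curv_comp pair_big; apply: eq_bigr => -[k l] _ /=.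
by rewrite mxE.
Qed.

(** The sign in [spin_mx_comm] and the subtracted commutator in [frame_curv] compensate: the
    curvature of d + A has the usual plus sign. *)
Lemma spin_curvature k l :
  spin_mx (dw k l) - spin_mx (dw l k) +
    (spin_mx (w k) *m spin_mx (w l) - spin_mx (w l) *m spin_mx (w k)) =
  spin_mx (frame_curv k l).
Proof. by rewrite spin_mx_comm// /frame_curv !(spin_mxD, spin_mxN). Qed.

(** Clifford multiplication is parallel, so this is c(nabla_k dx^l). The commutator with
    [spin_mx (w k)] applies w to the frame components, and [dE_eq] trades w for the Christoffel
    symbols. *)
Lemma gamma_up_parallel k l :
  slash (row l (dE k)^T) + (spin_mx (w k) *m gamma_up l - gamma_up l *m spin_mx (w k)) =
  - \sum_m Gam k m l *: gamma_up m.
Proof.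
rewrite /gamma_up spin_mx_comm_slash// -slashD -row_mul -linearD /=.
have -> : (dE k)^T + E^T *m w k = - ((Gam k)^T *m E^T).
  rewrite -[w k]trmxK w_skew -trmx_mul mulNmx -dE_eq -linearD /=.
  by rewrite opprD addrA subrr sub0r linearN /= trmx_mul.
rewrite linearN slashN /= row_mul (slash_mul erefl); congr (- _).
by apply: eq_bigr => m _; rewrite !mxE.
Qed.

(** [dK] stands for the derivative of G *m E^T; the hypothesis is the derivative of [frameE], and it
    determines [dK] since E is invertible. *)
Lemma gamma_dn_parallel (dK : 'M[K]_n) k l :
  dE k *m (G *m E^T) + E *m dK = 0 ->
  slash (row l dK) + (spin_mx (w k) *m gamma_dn l - gamma_dn l *m spin_mx (w k)) =
  \sum_m Gam k l m *: gamma_dn m.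
Proof.
move=> dKE.
rewrite /gamma_dn spin_mx_comm_slash// -slashD -row_mul -linearD /=.
have -> : dK + G *m E^T *m w k = Gam k *m (G *m E^T).
  move: (G *m E^T) frameE dKE => F EF dF; have FE := mulmx1C EF.
  rewrite -[dK]mul1mx -FE -mulmxA (_ : E *m dK = - (dE k *m F)); last first.
    by apply/eqP; rewrite -subr_eq0 opprK addrC dF.
  rewrite -[w k]mulmx1 -EF [w k *m _]mulmxA -dE_eq mulmxDl mulmxDr mulmxN.
  by rewrite addrA addNr add0r !mulmxA FE mul1mx.
by rewrite row_mul (slash_mul erefl); apply: eq_bigr => m _; rewrite mxE.
Qed.

Lemma gamma_up_dn k : gamma_up k = \sum_l inv_metric k l *: gamma_dn l.
Proof.
rewrite /gamma_up (slash_mul (A := G *m E^T) (u := row k inv_metric)).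
  by apply: eq_bigr => l _; rewrite mxE.
by rewrite -row_mul /inv_metric -mulmxA frameE mulmx1.
Qed.

Lemma gamma_up_anticomm k l :
  gamma_up k *m gamma_up l + gamma_up l *m gamma_up k = (- inv_metric k l *+ 2)%:M.
Proof.
rewrite slash_anticomm; congr (- _ *+ 2)%:M.
by rewrite !mxE; apply: eq_bigr => i _; rewrite !mxE.
Qed.

(** Z is the Hessian of s. Adding the sum to itself with k and l exchanged gives the anticommutator
    of the gammas on Z, which is the trace, and a remainder containing only Z k l - Z l k, which is
    curvature. Halving turns the 2^-1 of [gamma_curvature] into 4^-1. *)
Lemma lichnerowicz (s : 'cV[K]_N) (Z : 'I_n -> 'I_n -> 'cV[K]_N) :
  (forall k l, Z k l - Z l k = spin_mx (frame_curv k l) *m s) ->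
  \sum_k \sum_l gamma_up k *m gamma_up l *m Z k l =
  - (\sum_k \sum_l inv_metric k l *: Z k l)
  + (4^-1 * \sum_p \sum_q curv_comp p q q p) *: s.
Proof.
move=> ZZ; apply: (@scalerI _ _ 2); first by rewrite pnatr_eq0.
rewrite scaler_nat mulr2n [X in _ + X]exchange_big /=.
rewrite (_ : \sum_k \sum_l _ + _ = \sum_k \sum_l
    ((- inv_metric k l *+ 2) *: Z k l
     - gamma_up l *m gamma_up k *m (spin_mx (frame_curv k l) *m s))); last first.
  rewrite -big_split; apply: eq_bigr => k _ /=.
  rewrite -big_split; apply: eq_bigr => l _ /=.
  rewrite -ZZ mulmxBr -mul_scalar_mx -gamma_up_anticomm mulmxDl opprB addrA.
  by rewrite addrAC addrK.
rewrite scalerDr scalerA mulrA.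
rewrite (_ : 2 * 4^-1 = 2^-1 :> K); last by field.
rewrite -(mul_scalar_mx _ s) -gamma_curvature.
have sumB (X Y : 'I_n -> 'I_n -> 'cV[K]_N) : \sum_k \sum_l (X k l - Y k l) =
    \sum_k \sum_l X k l - \sum_k \sum_l Y k l.
  by rewrite -sumrB; apply: eq_bigr => k _; rewrite sumrB.
rewrite sumB; congr (_ + _).
  rewrite scalerN scaler_sumr -sumrN; apply: eq_bigr => k _.
  rewrite scaler_sumr -sumrN; apply: eq_bigr => l _.
  by rewrite scalerA -scaleNr mulNrn mulr_natl.
rewrite exchange_big -sumrN mulmx_suml; apply: eq_bigr => k _ /=.
rewrite -sumrN mulmx_suml; apply: eq_bigr => l _.
rewrite -!mulmxA -mulmxN -mulmxN -mulNmx -spin_mxN; congr (_ *m (_ *m (_ *m _))).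
congr spin_mx; apply/matrixP => i j; rewrite !mxE; ring.
Qed.

(** [N1], [N2], [NPsi] stand for the first and second derivatives of s and the first derivative of
    Psi; [NB k l] is then the derivative of [B l] along k, and primes denote the perturbed
    connection. The coefficient 2^-1 in [N1'] is what produces the first-order terms gamma Psi N1 +
    Psi gamma N1 of the square from the Laplacian. The price is the term in B B and a symmetric
    derivative of Psi, which the last two summands correct. *)
Lemma weitzenbock (s : 'cV[K]_N) (N1 : 'I_n -> 'cV[K]_N)
    (N2 : 'I_n -> 'I_n -> 'cV[K]_N) (Psi : 'M[K]_N) (NPsi : 'I_n -> 'M[K]_N) :
  (forall k l, N2 k l - N2 l k = spin_mx (frame_curv k l) *m s) ->
  let B k := gamma_dn k *m Psi + Psi *m gamma_dn k in
  let NB k l := \sum_m Gam k l m *: B m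
    + (gamma_dn l *m NPsi k + NPsi k *m gamma_dn l) in
  let N1' k := N1 k - 2^-1 *: (B k *m s) in
  let N2' k l := N2 k l - 2^-1 *: (NB k l *m s + B l *m N1 k)
    - 2^-1 *: (B k *m N1' l) in
  \sum_k gamma_up k *m
     (\sum_l ((- \sum_m Gam k m l *: gamma_up m) *m N1 l + gamma_up l *m N2 k l)
      + (NPsi k *m s + Psi *m N1 k))
   + Psi *m (\sum_l gamma_up l *m N1 l + Psi *m s) =
  - (\sum_k \sum_l inv_metric k l *: (N2' k l - \sum_m Gam k l m *: N1' m))
  + (4^-1 * \sum_p \sum_q curv_comp p q q p) *: s
  + Psi *m (Psi *m s)
  - 2^-1 *: (\sum_k (NPsi k *m gamma_up k - gamma_up k *m NPsi k) *m s)
  + 4^-1 *: (\sum_k \sum_l inv_metric k l *: (B k *m (B l *m s))).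
Proof.
move=> N2N2 B NB N1' N2'.
pose Z k l := N2 k l - \sum_m Gam k l m *: N1 m.
pose P1 := \sum_k gamma_up k *m (NPsi k *m s).
pose P2 := \sum_k gamma_up k *m (Psi *m N1 k).
pose P3 := \sum_k Psi *m (gamma_up k *m N1 k).
pose Q := \sum_k NPsi k *m (gamma_up k *m s).
pose X := \sum_k \sum_l inv_metric k l *: (B k *m (B l *m s)).
pose C k l := gamma_dn l *m NPsi k + NPsi k *m gamma_dn l.
have sum2D (U V : 'I_n -> 'I_n -> 'cV[K]_N) :
    \sum_k \sum_l inv_metric k l *: (U k l + V k l) =
    \sum_k \sum_l inv_metric k l *: U k l + \sum_k \sum_l inv_metric k l *: V k l.
  rewrite -big_split; apply: eq_bigr => k _; rewrite -big_split.
  by apply: eq_bigr => l _; rewrite scalerDr.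
have sum2Z a (U : 'I_n -> 'I_n -> 'cV[K]_N) :
    \sum_k \sum_l inv_metric k l *: (a *: U k l) =
    a *: \sum_k \sum_l inv_metric k l *: U k l.
  rewrite scaler_sumr; apply: eq_bigr => k _; rewrite scaler_sumr.
  by apply: eq_bigr => l _; rewrite !scalerA mulrC.
have raise k (A : 'M[K]_N) (v : 'cV[K]_N) :
    \sum_l inv_metric k l *: ((gamma_dn l *m A + A *m gamma_dn l) *m v) =
    gamma_up k *m (A *m v) + A *m (gamma_up k *m v).
  rewrite gamma_up_dn !mulmx_suml mulmx_sumr -big_split; apply: eq_bigr => l _ /=.
  by rewrite mulmxDl scalerDr -!scalemxAl -scalemxAr !mulmxA.
(* The Christoffel terms are symmetric in k and l, so they drop out. *)
have Zskew k l : Z k l - Z l k = spin_mx (frame_curv k l) *m s.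
  rewrite -N2N2 /Z (eq_bigr (fun m => Gam l k m *: N1 m)) => [|m _].
    by rewrite opprB addrA subrK.
  by rewrite Gam_sym.
(* The Christoffel symbols from differentiating [gamma_up] are exactly those that complete [N2] to
   the Hessian [Z]. *)
have lhsE : \sum_k gamma_up k *m
     (\sum_l ((- \sum_m Gam k m l *: gamma_up m) *m N1 l + gamma_up l *m N2 k l)
      + (NPsi k *m s + Psi *m N1 k)) =
    \sum_k \sum_l gamma_up k *m gamma_up l *m Z k l + P1 + P2.
  rewrite -addrA -!big_split; apply: eq_bigr => k _ /=.
  rewrite !mulmxDr; congr (_ + _); rewrite big_split /=.
  rewrite (eq_bigr (fun l => - \sum_m Gam k m l *: (gamma_up m *m N1 l))); last first.
    move=> l _; rewrite mulNmx mulmx_suml; congr (- _).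
    by apply: eq_bigr => m _; rewrite scalemxAl.
  rewrite sumrN exchange_big /= addrC -sumrB mulmx_sumr; apply: eq_bigr => l _.
  rewrite -mulmxA; congr (_ *m _); rewrite mulmxBr; congr (_ - _).
  by rewrite mulmx_sumr; apply: eq_bigr => m _; rewrite scalemxAr.
(* The Christoffel part of [NB] cancels against the B part of [N1']: the perturbed Hessian is
   tensorial too. *)
have NZ k l : N2' k l - \sum_m Gam k l m *: N1' m =
    Z k l + (- 2^-1) *: (C k l *m s + (B l *m N1 k + B k *m N1 l))
          + 4^-1 *: (B k *m (B l *m s)).
  rewrite /N2' /N1' /NB -/(C k l) mulmxDl mulmxBr.
  rewrite (eq_bigr (fun m => Gam k l m *: N1 m
     - 2^-1 *: ((Gam k l m *: B m) *m s))) => [|m _]; last first.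
    by rewrite scalerBr -scalemxAl !scalerA mulrC.
  rewrite sumrB -scaler_sumr -mulmx_suml -/(Z k l) -scalemxAr.
  rewrite /Z.
  move: (N2 k l) (_ *m s) (C k l *m s) (B l *m N1 k) (B k *m N1 l) (B k *m (B l *m s)).
  move: (\sum_m _ *: N1 m) => *.
  by apply/matrixP => i j; rewrite !mxE; field.
have -> : \sum_k \sum_l inv_metric k l *: (N2' k l - \sum_m Gam k l m *: N1' m) =
    \sum_k \sum_l inv_metric k l *: Z k l
    + (- 2^-1) *: (P1 + Q + (P2 + P3 + (P2 + P3))) + 4^-1 *: X.
  under eq_bigr => k _ do under eq_bigr => l _ do rewrite NZ.
  rewrite !sum2D !sum2Z !sum2D; congr (_ + _ *: (_ + (_ + _)) + _).
  - by rewrite -big_split; apply: eq_bigr => k _; rewrite raise.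
  - by rewrite -big_split; apply: eq_bigr => k _; rewrite raise.
  - rewrite exchange_big -big_split; apply: eq_bigr => k _ /=; rewrite -raise.
    by apply: eq_bigr => l _; rewrite inv_metric_sym.
have -> : \sum_k (NPsi k *m gamma_up k - gamma_up k *m NPsi k) *m s = Q - P1.
  by rewrite -sumrB; apply: eq_bigr => k _; rewrite mulmxBl !mulmxA.
rewrite lhsE (lichnerowicz Zskew) mulmxDr mulmx_sumr -/P3 -/X.
clear lhsE; move: (\sum_k \sum_l _) P1 P2 P3 (Psi *m _) Q X => U a1 a2 a3 a4 q x.
by apply/matrixP => i j; rewrite !mxE; field.
Qed.

End FrameCurvature.
End CliffordAlgebra.

(** * The connection matrix of an orthonormal frame *)

Section FrameConnection.
Context {R : realType} {n : nat} {M : manifold R n}.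
Variables (g : riemannian_metric M) (U : set M) (e : 'I_n -> vfield M).
Hypotheses (oU : open U) (he : orthonormal_frame g U e).
Variables (c : chart R n M) (ac : atlas c).
Implicit Types (x y : M) (k l : 'I_n).

(** Unlike [mx_deriv], whose derivation carries a proof that x lies in the chart, this is a total
    function of the point and can be differentiated again. *)
Definition pd_mx m p k (F : M -> 'M[R]_(m, p)) x : 'M[R]_(m, p) :=
  \matrix_(i, j) pd c k (fun y => F y i j) x.

Let E := frame_mx e c.
Let G := g c.
Let Gam := chris g c.

(** Entry (i, j) is g(nabla_k e_i, e_j): the last factor takes scalar products with the frame. *)
Definition conn_mx k x : 'M[R]_n := (pd_mx k E x + E x *m Gam k x) *m (G x *m (E x)^T).

Lemma frame_tensorial x i : chart_dom c x -> U x -> tensorial_at c (e i) x.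
Proof. by move=> cx Ux; apply: smooth_tensorial ac cx Ux (he.1 i). Qed.

Lemma frame_row x i : row i (E x) = e i c x.
Proof. by apply/rowP => j; rewrite !mxE. Qed.

Lemma ip_frame X x i : chart_dom c x -> U x -> tensorial_at c X x ->
  ip g X (e i) x = (X c x *m (G x *m (E x)^T)) 0 i.
Proof.
move=> cx Ux Xt; rewrite (ipE g ac cx Xt (frame_tensorial i cx Ux)) -frame_row.
rewrite -!mulmxA mxE [RHS]mxE; apply: eq_bigr => k _; congr (_ * _).
by rewrite !mxE; apply: eq_bigr => l _; rewrite !mxE.
Qed.

Lemma frame_orthonormal x : chart_dom c x -> U x ->
  E x *m (G x *m (E x)^T) = 1%:M.
Proof.
move=> cx Ux; apply/matrixP => i j.
have := he.2 x i j Ux; rewrite (ip_frame j cx Ux (frame_tensorial i cx Ux)).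
by rewrite -frame_row -row_mul !mxE.
Qed.

Lemma frame_orthonormalC x : chart_dom c x -> U x ->
  G x *m (E x)^T *m E x = 1%:M.
Proof. by move=> cx Ux; apply: mulmx1C; exact: frame_orthonormal. Qed.

(** It yields differentiability of the inverse metric, and so of the Christoffel symbols, from that
    of the frame. *)
Lemma invmx_metric x : chart_dom c x -> U x -> invmx (G x) = (E x)^T *m E x.
Proof.
move=> cx Ux; rewrite -[invmx _]mulmx1 -(frame_orthonormalC cx Ux) -!mulmxA.
by rewrite mulKmx// metric_unit.
Qed.

Lemma conn_mx_eq x k : chart_dom c x -> U x ->
  pd_mx k E x + E x *m Gam k x = conn_mx k x *m E x.
Proof. by move=> cx Ux; rewrite -mulmxA frame_orthonormalC// mulmx1. Qed.

Section AtPoint.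
Variables (x : M) (cx : chart_dom c x) (Ux : U x).

Lemma near_frame : \forall y \near x, chart_dom c y /\ U y.
Proof.
by apply: filterI; apply: open_nbhs_nbhs; split => //; exact: chart_dom_open.
Qed.

Lemma pd_mxE m p k (F : M -> 'M[R]_(m, p)) : pd_mx k F x = mx_deriv (pd_at cx k) F.
Proof. by []. Qed.

Lemma frame_smooth i j : smooth_in c U (fun y => E y i j).
Proof.
have [_ S] := he.1 i; have := S c j ac.
by congr (smooth_in _ _ _); apply/funext => y; rewrite mxE.
Qed.

Lemma frame_diffable k : mx_diffable (pd_at cx k) E.
Proof. by move=> i j; exact: smooth_in_diffable (frame_smooth i j) cx Ux k. Qed.

Lemma pd_frame_diffable k l : mx_diffable (pd_at cx k) (pd_mx l E).
Proof.
move=> i j.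
have H := @smooth_in_pd_diffable _ _ _ _ _ _ _ oU (frame_smooth i j) cx Ux l k.
by apply: diffable_ext H => y; rewrite mxE.
Qed.

Lemma pd_frameC k l : pd_mx k (pd_mx l E) x = pd_mx l (pd_mx k E) x.
Proof.
apply/matrixP => i j; rewrite [LHS]mxE [RHS]mxE.
have pd2 a b : pd c a (fun y => pd_mx b E y i j) x =
    pd c a (pd c b (fun y => E y i j)) x.
  apply: (congr1 (fun f => pd c a f x)); apply/funext => y; exact: mxE.
rewrite !pd2.
exact: (@smooth_in_pdC _ _ _ _ _ _ _ oU (frame_smooth i j) cx Ux l k).
Qed.

Lemma chris_diffable k l : mx_diffable (pd_at cx k) (Gam l).
Proof.
move=> i j.
apply: (diffable_ext (f := fun y => 2^-1 * \sum_p invmx (g c y) j p *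
    (pd c l (fun y => g c y i p) y + pd c i (fun y => g c y l p) y
     - pd c p (fun y => g c y l i) y))) => [y|]; first by rewrite mxE.
have dG a b m : diffable (pd_at cx k) (pd c m (fun y => g c y a b)).
  exact: (@smooth_in_pd_diffable _ _ _ _ _ _ _ openT (metric_smooth g a b ac) cx
    Logic.I m k).
apply: diffableM; first exact: diffable_cst.
apply: diffable_sum => p; apply: diffableM.
  apply: (mx_diffable_near (F := fun y => (E y)^T *m E y)).
    by apply: filterS near_frame => y [cy Uy]; rewrite invmx_metric.
  apply: mx_diffableM; last exact: frame_diffable.
  by apply: mx_diffable_tr; exact: frame_diffable.
by apply: diffableB; [apply: diffableD|]; exact: dG.
Qed.

Lemma dual_frame_diffable k : mx_diffable (pd_at cx k) (fun y => G y *m (E y)^T).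
Proof.
apply: mx_diffableM; first exact: metric_diffable.
by apply: mx_diffable_tr; exact: frame_diffable.
Qed.

Lemma conn_mx_diffable k l : mx_diffable (pd_at cx k) (conn_mx l).
Proof.
apply: mx_diffableM; last exact: dual_frame_diffable.
apply: mx_diffableD; first exact: pd_frame_diffable.
by apply: mx_diffableM; [exact: frame_diffable|exact: chris_diffable].
Qed.

(** Differentiating the orthonormality of the frame and replacing the derivative of the metric by
    [chris_metric] leaves the sum of the connection matrix and its transpose. *)
Lemma conn_mx_skew k : (conn_mx k x)^T = - conn_mx k x.
Proof.
apply/eqP; rewrite -subr_eq0 opprK; apply/eqP.
have dE : mx_diffable (pd_at cx k) E by exact: frame_diffable.
have dG : mx_diffable (pd_at cx k) G by exact: metric_diffable.
have : mx_deriv (pd_at cx k) (fun y => E y *m (G y *m (E y)^T)) = 0.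
  rewrite -(mx_deriv_cst (pd_at cx k) (1%:M : 'M[R]_n)); apply: mx_deriv_near.
  by apply: filterS near_frame => y [cy Uy]; exact: frame_orthonormal.
have dK : mx_diffable (pd_at cx k) (fun y => G y *m (E y)^T).
  exact: dual_frame_diffable.
rewrite (mx_derivM dE dK) (mx_derivM dG (mx_diffable_tr dE)) mx_deriv_tr.
rewrite chris_metric// /conn_mx -/Gam -/G (pd_mxE k E).
set dEk := mx_deriv _ _; set Gx := G x; set Ex := E x; set A := Gam k x => <-.
rewrite !(trmx_mul, linearD) /= trmxK trmx_mul (Defs.metric_sym g ac cx) -/G -/Gx.
rewrite !(mulmxDl, mulmxDr) !mulmxA addrC -!addrA; congr (_ + (_ + _)).
exact: addrC.
Qed.

Lemma d_conn_mx_eq k l :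
  pd_mx k (pd_mx l E) x + pd_mx k E x *m Gam l x + E x *m pd_mx k (Gam l) x =
  pd_mx k (conn_mx l) x *m E x + conn_mx l x *m pd_mx k E x.
Proof.
rewrite !(pd_mxE k).
have dE : mx_diffable (pd_at cx k) E by exact: frame_diffable.
have dw : mx_diffable (pd_at cx k) (conn_mx l) by exact: conn_mx_diffable.
have dd : mx_diffable (pd_at cx k) (pd_mx l E) by exact: pd_frame_diffable.
have dC : mx_diffable (pd_at cx k) (Gam l) by exact: chris_diffable.
rewrite -addrA -(mx_derivM dE dC) -(mx_derivM dw dE).
rewrite -(mx_derivD dd (mx_diffableM dE dC)).
by apply: mx_deriv_near; apply: filterS near_frame => y [cy Uy]; exact: conn_mx_eq.
Qed.

Lemma d_dual_frame k : pd_mx k E x *m (G x *m (E x)^T) +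
  E x *m pd_mx k (fun y => G y *m (E y)^T) x = 0.
Proof.
have dE : mx_diffable (pd_at cx k) E by exact: frame_diffable.
have dK : mx_diffable (pd_at cx k) (fun y => G y *m (E y)^T).
  exact: dual_frame_diffable.
rewrite !(pd_mxE k) -(mx_derivM dE dK).
rewrite -(mx_deriv_cst (pd_at cx k) (1%:M : 'M[R]_n)); apply: mx_deriv_near.
by apply: filterS near_frame => y [cy Uy]; exact: frame_orthonormal.
Qed.

(** [ip] reads its arguments in [chart_at x], so the covariant derivative must first be known to
    transform as a vector, by [levi_civita_change]. *)
Lemma ip_levi_civita_frame X i j : tensorial_at c X x ->
  ip g (levi_civita g X (e i)) (e j) x = \sum_k X c x 0 k * conn_mx k x i j.
Proof.
move=> Xt.
have LCt : tensorial_at c (levi_civita g X (e i)) x.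
  exact: (levi_civita_change g ac (chart_at_atlas x) cx (chart_at_dom x) oU Ux
    (he.1 i) Xt).
rewrite (ip_frame j cx Ux LCt) (levi_civitaE g X (e i) cx) mulmx_suml summxE.
apply: eq_bigr => k _; rewrite -scalemxAl mxE; congr (_ * _).
have -> : mx_deriv (pd_at cx k) (e i c) + e i c x *m chris g c k x =
   row i (pd_mx k E x + E x *m Gam k x).
  rewrite linearD /= row_mul frame_row; congr (_ + _).
  apply/matrixP => p q; rewrite ord1 !mxE; congr deriv_at.
  by apply/funext => y; rewrite mxE.
by rewrite -row_mul mxE.
Qed.

End AtPoint.

Lemma d_conn_mx_skew k l x : chart_dom c x -> U x ->
  (pd_mx k (conn_mx l) x)^T = - pd_mx k (conn_mx l) x.
Proof.
move=> cx Ux; rewrite !(pd_mxE cx).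
have dw : mx_diffable (pd_at cx k) (conn_mx l) by exact: conn_mx_diffable.
apply/eqP; rewrite -subr_eq0 opprK; apply/eqP.
rewrite -mx_deriv_tr -(mx_derivD (mx_diffable_tr dw) dw).
rewrite -(mx_deriv_cst (pd_at cx k) (0 : 'M[R]_n)); apply: mx_deriv_near.
apply: filterS (near_frame cx Ux) => y [cy Uy].
by rewrite (conn_mx_skew cy Uy) addNr.
Qed.

End FrameConnection.

(** * Spinors and forms in a frame *)

Section SpinorsInFrame.
Context {R : realType} {n : nat} {M : manifold R n}.
Context {g : riemannian_metric M} {o : orientation M}.
Context {rho : clifford_module R n}.
Variables (P : spin_structure g o rho) (a : spin_idx P).
Variables (c : chart R n M) (ac : atlas c).
Local Notation N := (2 ^ n./2)%N.
Local Notation toC := (map_mx (real_complex R)).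
Local Notation U := (spin_dom a).
Local Notation e := (spin_frame a).
Local Notation E := (frame_mx e c).
Implicit Types (x y : M) (X : vfield M) (t : spinor P).

Definition cpd_mx m p k (F : M -> 'M[R[i]]_(m, p)) x : 'M[R[i]]_(m, p) :=
  \matrix_(i, j) cpd c x k (fun y => F y i j).

Definition spin_conn k x : 'M[R[i]]_N := spin_mx rho (toC (conn_mx g e c k x)).

Definition nabla k (f : M -> 'cV[R[i]]_N) x : 'cV[R[i]]_N :=
  cpd_mx k f x + spin_conn k x *m f x.

Definition gam_up l x : 'M[R[i]]_N := gamma_up rho (toC (E x)) l.

Definition gam_dn l x : 'M[R[i]]_N := gamma_dn rho (toC (E x)) (toC (g c x)) l.

(* cderiv is defined in the chart chart_at x.  Its value is the same in the
   chart c if t is smooth, or for any t if c is chart_at x. *)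
Definition cderiv_chart t x := forall X k, tensorial_at c X x ->
  cderiv X (fun y => t a y k 0) x =
  \sum_i (X c x 0 i)%:C * cpd c x i (fun y => t a y k 0).

Lemma sum_complex (I : finType) (F H : I -> R) :
  \sum_i (F i +i* H i) = (\sum_i F i) +i* (\sum_i H i).
Proof.
by apply/eqP; rewrite eq_complex !raddf_sum /= !eqxx.
Qed.

Lemma cderivE X (f : M -> R[i]) x :
  vderiv X (fun y => complex.Re (f y)) x =
    \sum_k X c x 0 k * pd c k (fun y => complex.Re (f y)) x ->
  vderiv X (fun y => complex.Im (f y)) x =
    \sum_k X c x 0 k * pd c k (fun y => complex.Im (f y)) x ->
  cderiv X f x = \sum_k (X c x 0 k)%:C * cpd c x k f.
Proof.
move=> rE iE; rewrite /cderiv rE iE -sum_complex; apply: eq_bigr => k _.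
by apply/eqP; rewrite eq_complex /= !mul0r subr0 addr0 !eqxx.
Qed.

Lemma cderiv_chart_smooth t x : smooth_spinor t -> chart_dom c x -> U x ->
  cderiv_chart t x.
Proof.
move=> [_ st] cx Ux X k Xt.
have [sr si] := st a k (chart_at x) (chart_at_atlas x).
have oU := @spin_dom_open _ _ _ _ _ _ P a.
apply: cderivE; apply: vderivE => //.
  exact: smooth_in_differentiable oU sr (chart_at_dom x) Ux.
exact: smooth_in_differentiable oU si (chart_at_dom x) Ux.
Qed.

(** An unfolding of [vderiv], available for sections not known to be smooth, such as
    [perturbed_dirac Psi s]. *)
Lemma cderiv_chart_at t x : c = chart_at x -> cderiv_chart t x.
Proof. by move=> cE X k _; apply: cderivE; rewrite /vderiv -cE. Qed.

Section AtPoint.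
Variables (x : M) (cx : chart_dom c x) (Ux : U x).
Let oU := @spin_dom_open _ _ _ _ _ _ P a.
Let he := @spin_frame_on _ _ _ _ _ _ P a.

Lemma cliffE X t : tensorial_at c X x ->
  cliff X t a x = (\sum_k (X c x 0 k)%:C *: gam_dn k x) *m t a x.
Proof.
move=> Xt; rewrite /cliff; congr (_ *m _).
transitivity (slash rho (toC (X c x *m (g c x *m (E x)^T)))).
  apply: eq_bigr => b _; rewrite !mxE; congr (_%:C *: _).
  by rewrite (ip_frame he ac b cx Ux Xt) mxE.
rewrite map_mxM (slash_mul rho erefl); apply: eq_bigr => k _.
by rewrite /gam_dn /gamma_dn [toC _ 0 k]mxE map_mxM map_trmx.
Qed.

Lemma cliff_frame b t : cliff (e b) t a x = rho b *m t a x.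
Proof.
congr (_ *m _); rewrite -(slash_delta rho b); apply: eq_bigr => i _.
by rewrite !mxE (he.2 x b i Ux) /= eq_sym rmorph_nat.
Qed.

Lemma spin_connectionE X t : tensorial_at c X x -> cderiv_chart t x ->
  spin_connection X t a x = \sum_k (X c x 0 k)%:C *: nabla k (t a) x.
Proof.
move=> Xt dt; rewrite /spin_connection.
under [RHS]eq_bigr do rewrite scalerDr.
rewrite big_split /=; congr (_ + _).
  apply/matrixP => i j; rewrite ord1 mxE dt// summxE.
  by apply: eq_bigr => k _; rewrite !mxE.
rewrite scalemxAl (_ : _ *: _ = \sum_k (X c x 0 k)%:C *: spin_conn k x).
  by rewrite mulmx_suml; apply: eq_bigr => k _; rewrite scalemxAl.
transitivity (spin_mx rho (\sum_k (X c x 0 k)%:C *: toC (conn_mx g e c k x))).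
  congr (_ *: _); apply: eq_bigr => i _; apply: eq_bigr => j _; congr (_ *: _).
  rewrite (ip_levi_civita_frame oU he ac cx Ux i j Xt) rmorph_sum summxE.
  by apply: eq_bigr => k _; rewrite rmorphM !mxE.
by rewrite spin_mx_sum; apply: eq_bigr => k _; rewrite spin_mxZ.
Qed.

Lemma diracE t : cderiv_chart t x ->
  Defs.dirac t a x = \sum_k gam_up k x *m nabla k (t a) x.
Proof.
move=> dt; rewrite /Defs.dirac.
transitivity (\sum_i \sum_k (E x i k)%:C *: (rho i *m nabla k (t a) x)).
  apply: eq_bigr => i _; rewrite cliff_frame.
  rewrite (spin_connectionE (frame_tensorial he ac i cx Ux) dt) mulmx_sumr.
  by apply: eq_bigr => k _; rewrite -scalemxAr [E x i k]mxE.
rewrite exchange_big; apply: eq_bigr => k _.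
rewrite /gam_up /gamma_up /slash mulmx_suml; apply: eq_bigr => i _.
by rewrite -scalemxAl [row k _ 0 i]mxE [_^T k i]mxE [toC _ i k]mxE.
Qed.

End AtPoint.
End SpinorsInFrame.

(** * Differentiability of the components of a form *)

Section FormRows.
Context {R : realType} {n : nat} {M : manifold R n}.
Variables (Psi : diff_form M) (c : chart R n M) (ac : atlas c).

Definition set_row p (i : 'I_p) (A : 'M[R]_(p, n)) (v : 'rV[R]_n) : 'M[R]_(p, n) :=
  \matrix_(r, j) if r == i then v 0 j else A r j.

Lemma row_set_row p (i : 'I_p) A v : row i (set_row i A v) = v.
Proof. by apply/rowP => j; rewrite !mxE eqxx. Qed.

Lemma row'_set_row p (i : 'I_p) A v w :
  row' i (set_row i A v) = row' i (set_row i A w).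
Proof.
by apply/matrixP => r j; rewrite !mxE eq_sym (negbTE (neq_lift i r)).
Qed.

Lemma form_set_row y p (i : 'I_p) (A : 'M[R]_(p, n)) v : chart_dom c y ->
  form_val Psi c y (set_row i A v) =
  \sum_j (v 0 j)%:C * form_val Psi c y (set_row i A (delta_mx 0 j)).
Proof.
move=> cy; pose L (w : 'rV[R]_n) := form_val Psi c y (set_row i A w).
have L_lin b d u w : L (b *: u + d *: w) = b%:C * L u + d%:C * L w.
  apply: (@form_multilinear _ _ _ Psi c y p i) => //; rewrite ?row_set_row//.
    exact: row'_set_row.
  exact: row'_set_row.
have LD u w : L (u + w) = L u + L w.
  by rewrite -[u]scale1r -[w]scale1r L_lin !scale1r !mul1r.
have L0 : L 0 = 0 by rewrite -[0](addr0 0) -[X in L (X + _)](scale0r 0)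
  -[X in L (_ + X)](scale0r 0) L_lin !mul0r addr0.
have LZ b u : L (b *: u) = b%:C * L u.
  by rewrite -[b *: u]addr0 -[X in _ + X](scale0r 0) L_lin mul0r addr0.
rewrite -/(L v) {1}(row_sum_delta v) (big_morph L LD L0).
by apply: eq_bigr => j _; rewrite LZ.
Qed.

(* By induction on the number m of rows that are not constant basis vectors. *)
Lemma form_val_diffable x (cx : chart_dom c x) k p (A : M -> 'M[R]_(p, n)) :
  mx_diffable (pd_at cx k) A ->
  diffable (cpd_at cx k) (fun y => form_val Psi c y (A y)).
Proof.
suff H m : forall A : M -> 'M[R]_(p, n), mx_diffable (pd_at cx k) A ->
    (forall r : 'I_p, (m <= r)%N -> exists j, forall y, row r (A y) = delta_mx 0 j) ->
    diffable (cpd_at cx k) (fun y => form_val Psi c y (A y)).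
  by move=> dA; apply: (H p) => // r; rewrite leqNgt ltn_ord.
elim: m => [|m IH] {}A dA rA.
  (* Once every row is a constant basis vector, the value is a component function, which
     [form_smooth] controls. *)
  have [h hE] : exists h : 'I_p -> 'I_n, forall r y, row r (A y) = delta_mx 0 (h r).
    exists (fun r => projT1 (cid (rA r (leq0n _)))) => r y.
    by case: cid => j /= ->.
  apply: (diffable_ext (f := fun y => form_val Psi c y (rowsub h 1%:M))) => [y|].
    congr form_val; apply/row_matrixP => r.
    by rewrite hE; apply/rowP => j; rewrite !mxE eqxx eq_sym.
  have [sr si] := form_smooth Psi h ac.
  by split; [exact: smooth_in_diffable sr cx Logic.I k|
             exact: smooth_in_diffable si cx Logic.I k].
have [mp|pm] := ltnP m p; last first.
  by apply: IH => // r mr; have := leq_ltn_trans mr (ltn_ord r); rewrite ltnNge pm.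
pose i := Ordinal mp.
(* Expanding row m by linearity puts a constant basis vector in its place, at the cost of a
   differentiable coefficient. *)
apply: (diffable_near (f := fun y => \sum_j (A y i j)%:C *
    form_val Psi c y (set_row i (A y) (delta_mx 0 j)))).
  apply: filterS (open_nbhs_nbhs (conj (@chart_dom_open _ _ _ c) cx)) => y cy.
  transitivity (form_val Psi c y (set_row i (A y) (row i (A y)))).
    by rewrite form_set_row//; apply: eq_bigr => j _; rewrite mxE.
  congr form_val; apply/matrixP => r j; rewrite !mxE.
  by case: eqP => // ->.
apply: diffable_sum => j; apply: diffableM.
  by apply: cpd_diffable_real; exact: dA.
apply: IH => [r l|r mr].
  apply: (diffable_ext (f := fun y =>
    if r == i then (delta_mx 0 j : 'rV[R]_n) 0 l else A y r l)).
    by move=> y; rewrite [RHS]mxE.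
  by case: (r == i); [exact: diffable_cst|exact: dA].
have [->|ri] := eqVneq r i; first by exists j => y; rewrite row_set_row.
have mr' : (m < r)%N by rewrite ltn_neqAle mr andbT eq_sym.
have [l lE] := rA r mr'; exists l => y; rewrite -(lE y).
by apply/rowP => q; rewrite !mxE (negbTE ri).
Qed.

End FormRows.

Section FormMatrix.
Context {R : realType} {n : nat} {M : manifold R n}.
Context {g : riemannian_metric M} {o : orientation M}.
Context {rho : clifford_module R n}.
Variables (P : spin_structure g o rho) (a : spin_idx P) (Psi : diff_form M).

Definition form_mx (x : M) : 'M[R[i]]_(2 ^ n./2)%N :=
  \sum_(I : {set 'I_n})
     form_val Psi (chart_at x) x
       (rowsub (fun r : 'I_#|I| => enum_val r)
          (frame_mx (spin_frame a) (chart_at x) x))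
     *: \prod_(i <- enum I) rho i.

(** The chart in [form_mx] varies with the point. Near x, [form_compat] replaces it by c, since the
    rows of the frame change by the same Jacobian. *)
Lemma form_mx_diffable c (ac : atlas c) x (cx : chart_dom c x) k : spin_dom a x ->
  mx_diffable (cpd_at cx k) form_mx.
Proof.
move=> Ux; have he := @spin_frame_on _ _ _ _ _ _ P a.
have oU := @spin_dom_open _ _ _ _ _ _ P a.
apply: (mx_diffable_near (F := fun y => \sum_(I : {set 'I_n})
    form_val Psi c y (rowsub (fun r : 'I_#|I| => enum_val r)
      (frame_mx (spin_frame a) c y)) *: \prod_(i <- enum I) rho i)).
  apply: filterS (near_frame oU cx Ux) => y [cy Uy].
  apply: eq_bigr => I _; congr (_ *: _).
  rewrite -(form_compat Psi _ ac (chart_at_atlas y) cy (chart_at_dom y)).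
  congr form_val; rewrite mul_rowsub_mx; congr (mxsub _ _ _).
  apply/row_matrixP => i; rewrite row_mul !frame_row.
  by rewrite [RHS](frame_tensorial he ac i cy Uy).
apply: mx_diffable_sum => I; apply: mx_diffableZ; last exact: mx_diffable_cst.
apply: form_val_diffable => // r j.
apply: (diffable_ext (f := fun y => frame_mx (spin_frame a) c y (enum_val r) j)).
  by move=> y; rewrite !mxE.
exact: (frame_diffable he ac cx Ux).
Qed.

End FormMatrix.

(** * Scalar curvature *)

Section ScalarCurvature.
Context {R : realType} {n : nat} {M : manifold R n}.
Variables (g : riemannian_metric M) (c : chart R n M) (ac : atlas c).
Implicit Types (x y : M).
Local Notation Gam := (chris g c).

Lemma coord_field_self k y : chart_dom c y -> coord_field c k c y = delta_mx 0 k.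
Proof. by move=> cy; rewrite /coord_field jac_refl// row1. Qed.

Lemma sum_delta_row m p (k : 'I_n) (F : 'I_n -> 'M[R]_(m, p)) :
  \sum_i (delta_mx 0 k : 'rV[R]_n) 0 i *: F i = F k.
Proof.
rewrite (bigD1 k)//= mxE !eqxx scale1r big1 ?addr0// => i ik.
by rewrite mxE (negbTE ik) scale0r.
Qed.

Lemma coord_field_deriv x (cx : chart_dom c x) i k :
  mx_deriv (pd_at cx i) (coord_field c k c) = 0.
Proof.
rewrite -(mx_deriv_cst (pd_at cx i) (delta_mx 0 k : 'rV[R]_n)).
apply: mx_deriv_near.
apply: filterS (open_nbhs_nbhs (conj (@chart_dom_open _ _ _ c) cx)) => y cy.
exact: coord_field_self.
Qed.

Lemma levi_civita_coord y j k : chart_dom c y ->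
  levi_civita g (coord_field c j) (coord_field c k) c y = row k (Gam j y).
Proof.
move=> cy; rewrite (levi_civitaE g _ _ cy) !coord_field_self// sum_delta_row.
by rewrite coord_field_deriv add0r -rowE.
Qed.

Lemma levi_civita_coord2 x i j k : chart_dom c x ->
  levi_civita g (coord_field c i)
    (levi_civita g (coord_field c j) (coord_field c k)) c x =
  row k (pd_mx c i (Gam j) x + Gam j x *m Gam i x).
Proof.
move=> cx; rewrite (levi_civitaE g _ _ cx) coord_field_self// sum_delta_row.
rewrite levi_civita_coord// linearD /= row_mul; congr (_ + _).
rewrite (@mx_deriv_near _ _ _ (pd_at cx i) _ _ _ (fun y => row k (Gam j y))).
  apply/rowP => p; rewrite [LHS]mxE [RHS]mxE [RHS]mxE.
  by congr deriv_at; apply/funext => y; exact: mxE.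
apply: filterS (open_nbhs_nbhs (conj (@chart_dom_open _ _ _ c) cx)) => y cy.
exact: levi_civita_coord.
Qed.

Lemma lie_bracket_coord x i j : chart_dom c x ->
  lie_bracket (coord_field c i) (coord_field c j) c x = 0.
Proof.
move=> cx; apply/rowP => k; rewrite !mxE big1// => p _.
have D0 q l : pd c p (fun y => coord_field c q c y 0 l) x = 0.
  by have /matrixP/(_ 0 l) := coord_field_deriv cx p q; rewrite [LHS]mxE [RHS]mxE.
by rewrite !D0 !mulr0 subrr.
Qed.

Lemma riemann_coord x i j k : chart_dom c x ->
  riemann g (coord_field c i) (coord_field c j) (coord_field c k) c x =
  row k (coord_curv (fun l => Gam l x) (fun l m => pd_mx c l (Gam m) x) i j).
Proof.
move=> cx; rewrite /riemann !levi_civita_coord2//.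
rewrite [levi_civita _ (lie_bracket _ _) _ _ _](levi_civitaE g _ _ cx).
rewrite lie_bracket_coord// big1 => [|p _]; last by rewrite mxE scale0r.
rewrite subr0 -linearB /=; congr row.
rewrite /coord_curv; move: (pd_mx _ _ _ _) (pd_mx _ _ _ _) (_ *m _) (_ *m _) => *.
by apply/matrixP => p q; rewrite !mxE; ring.
Qed.

Lemma ginv_self x : c = chart_at x -> ginv g c x = invmx (g c x).
Proof.
move=> cE; have cx : chart_dom c x by rewrite cE; exact: chart_at_dom.
rewrite /ginv; congr invmx; apply/matrixP => i j; rewrite mxE /ip -cE.
by rewrite !coord_field_self// -rowE trmx_delta -colE !mxE.
Qed.

Lemma scalar_curvatureE x : c = chart_at x -> scalar_curvature g x =
  \sum_i \sum_j \sum_k \sum_l invmx (g c x) j k * invmx (g c x) i l *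
   (coord_curv (fun p => Gam p x) (fun p q => pd_mx c p (Gam q) x) i j *m g c x) k l.
Proof.
move=> cE; have cx : chart_dom c x by rewrite cE; exact: chart_at_dom.
rewrite /scalar_curvature -cE.
apply: eq_bigr => i _; apply: eq_bigr => j _.
apply: eq_bigr => k _; apply: eq_bigr => l _.
rewrite ginv_self//; congr (_ * _).
rewrite /ip -cE riemann_coord// coord_field_self//.
by rewrite -row_mul trmx_delta -colE mxE [LHS]mxE.
Qed.

End ScalarCurvature.

(** * The Weitzenboeck formula *)

Section SpinorCalculus.
Context {R : realType} {n : nat} {M : manifold R n}.
Context {g : riemannian_metric M} {o : orientation M}.
Context {rho : clifford_module R n}.
Variables (P : spin_structure g o rho) (a : spin_idx P).
Variables (c : chart R n M) (ac : atlas c).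
Variables (x : M) (cx : chart_dom c x) (Ux : spin_dom a x).
Local Notation N := (2 ^ n./2)%N.
Local Notation toC := (map_mx (real_complex R)).
Local Notation e := (spin_frame a).
Local Notation E := (frame_mx e c).
Local Notation Gam := (chris g c).
Local Notation w := (conn_mx g e c).
Let oU := @spin_dom_open _ _ _ _ _ _ P a.
Let he := @spin_frame_on _ _ _ _ _ _ P a.

(** Complexified values and derivatives at x; the lemmas up to [dd_frameC_eq] verify for them the
    hypotheses of the section [FrameCurvature]. *)
Let E0 := toC (E x).
Let G0 := toC (g c x).
Let Gam0 k := toC (Gam k x).
Let w0 k := toC (w k x).
Let dE0 k := toC (pd_mx c k E x).
Let ddE0 k l := toC (pd_mx c k (pd_mx c l E) x).
Let dGam0 k l := toC (pd_mx c k (Gam l) x).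
Let dw0 k l := toC (pd_mx c k (w l) x).

Lemma frameC_orthonormal : E0 *m (G0 *m E0^T) = 1%:M.
Proof.
by rewrite map_trmx -!map_mxM (frame_orthonormal he ac cx Ux) map_mx1.
Qed.

Lemma chrisC_sym k l m : Gam0 k l m = Gam0 l k m.
Proof. by rewrite [LHS]mxE [RHS]mxE (chris_sym g k l m ac cx). Qed.

Lemma d_chrisC_sym k l m p : dGam0 k l m p = dGam0 k m l p.
Proof.
rewrite [LHS]mxE [RHS]mxE; congr (_%:C); rewrite [LHS]mxE [RHS]mxE.
apply: (pd_near cx).
apply: filterS (open_nbhs_nbhs (conj (@chart_dom_open _ _ _ c) cx)) => y cy.
exact: chris_sym.
Qed.

Lemma dd_frameC_sym k l : ddE0 k l = ddE0 l k.
Proof. exact: (congr1 (fun A => toC A) (pd_frameC oU he ac cx Ux k l)). Qed.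

Lemma connC_skew k : (w0 k)^T = - w0 k.
Proof. by rewrite map_trmx (conn_mx_skew oU he ac cx Ux) map_mxN. Qed.

Lemma d_connC_skew k l : (dw0 k l)^T = - dw0 k l.
Proof. by rewrite map_trmx (d_conn_mx_skew oU he ac k l cx Ux) map_mxN. Qed.

Lemma d_frameC_eq k : dE0 k + E0 *m Gam0 k = w0 k *m E0.
Proof. by rewrite -!map_mxM -map_mxD (conn_mx_eq he ac k cx Ux). Qed.

Lemma dd_frameC_eq k l : ddE0 k l + dE0 k *m Gam0 l + E0 *m dGam0 k l =
  dw0 k l *m E0 + w0 l *m dE0 k.
Proof. by rewrite -!map_mxM -!map_mxD (d_conn_mx_eq oU he ac cx Ux). Qed.

Lemma cpd_mxE m p k (F : M -> 'M[R[i]]_(m, p)) :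
  cpd_mx c k F x = mx_deriv (cpd_at cx k) F.
Proof. by []. Qed.

Lemma cpd_mx_real m p k (F : M -> 'M[R]_(m, p)) :
  cpd_mx c k (fun y => toC (F y)) x = toC (pd_mx c k F x).
Proof. exact: (mx_deriv_real cx k F). Qed.

Lemma slash_diffable k (V : M -> 'rV[R[i]]_n) : mx_diffable (cpd_at cx k) V ->
  mx_diffable (cpd_at cx k) (fun y => slash rho (V y)).
Proof.
move=> dV; apply: mx_diffable_sum => b; apply: mx_diffableZ => //.
exact: mx_diffable_cst.
Qed.

Lemma slash_deriv k (V : M -> 'rV[R[i]]_n) : mx_diffable (cpd_at cx k) V ->
  cpd_mx c k (fun y => slash rho (V y)) x = slash rho (cpd_mx c k V x).
Proof.
move=> dV; rewrite !cpd_mxE mx_deriv_sum => [|b]; last first.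
  by apply: mx_diffableZ; [exact: dV|exact: mx_diffable_cst].
apply: eq_bigr => b _.
rewrite (mx_derivZ (dV 0 b) (mx_diffable_cst _ (rho b))) mx_deriv_cst scaler0 addr0.
by rewrite [mx_deriv _ V 0 b]mxE.
Qed.

Lemma spin_mx_diffable k (V : M -> 'M[R[i]]_n) : mx_diffable (cpd_at cx k) V ->
  mx_diffable (cpd_at cx k) (fun y => spin_mx rho (V y)).
Proof.
move=> dV; apply: mx_diffableZ; first exact: diffable_cst.
apply: mx_diffable_sum => i; apply: mx_diffable_sum => j.
by apply: mx_diffableZ; [exact: dV|exact: mx_diffable_cst].
Qed.

Lemma spin_mx_deriv k (V : M -> 'M[R[i]]_n) : mx_diffable (cpd_at cx k) V ->
  cpd_mx c k (fun y => spin_mx rho (V y)) x = spin_mx rho (cpd_mx c k V x).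
Proof.
move=> dV; rewrite !cpd_mxE.
have dij i j : mx_diffable (cpd_at cx k) (fun y => V y i j *: (rho i *m rho j)).
  by apply: mx_diffableZ; [exact: dV|exact: mx_diffable_cst].
have di i : mx_diffable (cpd_at cx k) (fun y => \sum_j V y i j *: (rho i *m rho j)).
  exact: mx_diffable_sum.
rewrite (mx_derivZ (diffable_cst _ _) (mx_diffable_sum di)) deriv_cst scale0r add0r.
congr (_ *: _); rewrite (mx_deriv_sum di); apply: eq_bigr => i _.
rewrite (mx_deriv_sum (dij i)); apply: eq_bigr => j _.
rewrite (mx_derivZ (dV i j) (mx_diffable_cst _ _)) mx_deriv_cst scaler0 addr0.
by rewrite [mx_deriv _ V i j]mxE.
Qed.

Lemma spin_conn_diffable k l : mx_diffable (cpd_at cx k) (spin_conn a c l).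
Proof.
apply: spin_mx_diffable; apply: mx_diffable_real.
exact: (conn_mx_diffable oU he ac cx Ux).
Qed.

Lemma spin_conn_deriv k l : cpd_mx c k (spin_conn a c l) x = spin_mx rho (dw0 k l).
Proof.
have dw : mx_diffable (cpd_at cx k) (fun y => toC (w l y)).
  by apply: mx_diffable_real; exact: (conn_mx_diffable oU he ac cx Ux).
by rewrite (spin_mx_deriv dw) cpd_mx_real.
Qed.

Definition nabla_end k (F : M -> 'M[R[i]]_N) : 'M[R[i]]_N :=
  cpd_mx c k F x + (spin_conn a c k x *m F x - F x *m spin_conn a c k x).

Lemma nablaM k F (t : M -> 'cV[R[i]]_N) : mx_diffable (cpd_at cx k) F ->
  mx_diffable (cpd_at cx k) t ->
  nabla a c k (fun y => F y *m t y) x =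
  nabla_end k F *m t x + F x *m nabla a c k t x.
Proof.
move=> dF dt; rewrite /nabla /nabla_end cpd_mxE (mx_derivM dF dt).
rewrite mulmxDl mulmxBl mulmxDr !mulmxA -!cpd_mxE.
move: (_ *m t x) (F x *m cpd_mx c k t x) (spin_conn a c k x *m F x *m t x)
  (F x *m spin_conn a c k x *m t x) => A1 A2 A3 A4.
by apply/matrixP => i j; rewrite !mxE; ring.
Qed.

Lemma nabla_endD k A B : mx_diffable (cpd_at cx k) A ->
  mx_diffable (cpd_at cx k) B ->
  nabla_end k (fun y => A y + B y) = nabla_end k A + nabla_end k B.
Proof.
have alg (S dA dB A' B' : 'M[R[i]]_N) :
    dA + dB + (S *m (A' + B') - (A' + B') *m S) =
    dA + (S *m A' - A' *m S) + (dB + (S *m B' - B' *m S)).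
  rewrite mulmxDl mulmxDr; move: (S *m A') (S *m B') (A' *m S) (B' *m S) => *.
  by apply/matrixP => i j; rewrite !mxE; ring.
by move=> dA dB; rewrite /nabla_end cpd_mxE (mx_derivD dA dB); exact: alg.
Qed.

Lemma nabla_endM k A B : mx_diffable (cpd_at cx k) A ->
  mx_diffable (cpd_at cx k) B ->
  nabla_end k (fun y => A y *m B y) = nabla_end k A *m B x + A x *m nabla_end k B.
Proof.
have alg (S dA dB A' B' : 'M[R[i]]_N) :
    dA *m B' + A' *m dB + (S *m (A' *m B') - A' *m B' *m S) =
    (dA + (S *m A' - A' *m S)) *m B' + A' *m (dB + (S *m B' - B' *m S)).
  rewrite !(mulmxDl, mulmxDr, mulmxBl, mulmxBr, mulNmx, mulmxN) !mulmxA.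
  move: (dA *m B') (A' *m dB) (S *m A' *m B') (A' *m B' *m S) (A' *m S *m B') => *.
  by apply/matrixP => i j; rewrite !mxE; ring.
by move=> dA dB; rewrite /nabla_end cpd_mxE (mx_derivM dA dB); exact: alg.
Qed.

Lemma nablaD k (s t : M -> 'cV[R[i]]_N) : mx_diffable (cpd_at cx k) s ->
  mx_diffable (cpd_at cx k) t ->
  nabla a c k (fun y => s y + t y) x = nabla a c k s x + nabla a c k t x.
Proof.
by move=> ds dt; rewrite /nabla cpd_mxE (mx_derivD ds dt) mulmxDr addrACA.
Qed.

Lemma nabla_sum k (I : finType) (s : I -> M -> 'cV[R[i]]_N) :
  (forall i, mx_diffable (cpd_at cx k) (s i)) ->
  nabla a c k (fun y => \sum_i s i y) x = \sum_i nabla a c k (s i) x.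
Proof.
move=> ds; rewrite /nabla cpd_mxE (mx_deriv_sum ds) mulmx_sumr -big_split.
by [].
Qed.

Lemma nablaZ k f (s : M -> 'cV[R[i]]_N) : diffable (cpd_at cx k) f ->
  mx_diffable (cpd_at cx k) s ->
  nabla a c k (fun y => f y *: s y) x = cpd_at cx k f *: s x + f x *: nabla a c k s x.
Proof.
move=> df ds; rewrite /nabla cpd_mxE (mx_derivZ df ds) -scalemxAr scalerDr addrA.
by [].
Qed.

Lemma nabla_near k (s t : M -> 'cV[R[i]]_N) : (\forall y \near x, s y = t y) ->
  nabla a c k s x = nabla a c k t x.
Proof.
move=> st; rewrite /nabla !cpd_mxE (mx_deriv_near _ st).
by rewrite (nbhs_singleton st).
Qed.

Lemma frameC_diffable k : mx_diffable (cpd_at cx k) (fun y => toC (E y)).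
Proof. by apply: mx_diffable_real; exact: (frame_diffable he ac cx Ux). Qed.

Lemma dual_frameC_diffable k :
  mx_diffable (cpd_at cx k) (fun y => toC (g c y) *m (toC (E y))^T).
Proof.
have -> : (fun y => toC (g c y) *m (toC (E y))^T) =
    fun y => toC (g c y *m (E y)^T).
  by apply/funext => y; rewrite map_mxM map_trmx.
by apply: mx_diffable_real; exact: (dual_frame_diffable he ac cx Ux).
Qed.

Lemma gam_up_diffable k l : mx_diffable (cpd_at cx k) (gam_up a c l).
Proof.
by apply: slash_diffable; apply/mx_diffable_row/mx_diffable_tr; exact: frameC_diffable.
Qed.

Lemma nabla_gam_up k l : nabla_end k (gam_up a c l) =
  - \sum_m Gam0 k m l *: gam_up a c m x.
Proof.
rewrite -(gamma_up_parallel (gamma_rel rho) connC_skew d_frameC_eq).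
congr (_ + _); rewrite slash_deriv; last first.
  by apply/mx_diffable_row/mx_diffable_tr; exact: frameC_diffable.
by rewrite cpd_mxE mx_deriv_row mx_deriv_tr -cpd_mxE cpd_mx_real.
Qed.

Lemma gam_dn_diffable k l : mx_diffable (cpd_at cx k) (gam_dn a c l).
Proof.
by apply: slash_diffable; apply/mx_diffable_row; exact: dual_frameC_diffable.
Qed.

Lemma nabla_gam_dn k l : nabla_end k (gam_dn a c l) =
  \sum_m Gam0 k l m *: gam_dn a c m x.
Proof.
pose dK := toC (pd_mx c k (fun y => g c y *m (E y)^T) x).
have dKE : dE0 k *m (G0 *m E0^T) + E0 *m dK = 0.
  rewrite map_trmx -!map_mxM -map_mxD (d_dual_frame oU he ac cx Ux).
  exact: map_mx0.
rewrite -(gamma_dn_parallel (gamma_rel rho) frameC_orthonormal connC_skew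
  d_frameC_eq l dKE).
congr (_ + _); rewrite slash_deriv; last first.
  by apply/mx_diffable_row; exact: dual_frameC_diffable.
rewrite cpd_mxE mx_deriv_row -cpd_mxE /dK -cpd_mx_real; congr (slash _ (row _ _)).
apply: (congr1 (fun F => cpd_mx c k F x)); apply/funext => y.
by rewrite map_mxM map_trmx.
Qed.

(** The second derivatives cancel by assumption and the first derivatives by the Leibniz rule; the
    remaining terms of order zero are those of [spin_curvature]. *)
Lemma nabla_comm k l (s : M -> 'cV[R[i]]_N) :
  mx_diffable (cpd_at cx k) s -> mx_diffable (cpd_at cx l) s ->
  mx_diffable (cpd_at cx k) (cpd_mx c l s) ->
  mx_diffable (cpd_at cx l) (cpd_mx c k s) ->
  cpd_mx c k (cpd_mx c l s) x = cpd_mx c l (cpd_mx c k s) x ->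
  nabla a c k (nabla a c l s) x - nabla a c l (nabla a c k s) x =
  spin_mx rho (frame_curv w0 dw0 k l) *m s x.
Proof.
have alg (dAkl dAlk Ak Al : 'M[R[i]]_N) (ukl uk ul u : 'cV[R[i]]_N) :
    ukl + (dAkl *m u + Al *m uk) + Ak *m (ul + Al *m u)
    - (ukl + (dAlk *m u + Ak *m ul) + Al *m (uk + Ak *m u)) =
    (dAkl - dAlk + (Ak *m Al - Al *m Ak)) *m u.
  rewrite !(mulmxDl, mulmxDr, mulNmx) !mulmxA.
  move: (dAkl *m u) (dAlk *m u) (Ak *m Al *m u) (Al *m Ak *m u) => *.
  by apply/matrixP => i j; rewrite !mxE; ring.
move=> dks dls dkls dlks sC.
have step p q : mx_diffable (cpd_at cx p) s -> mx_diffable (cpd_at cx p) (cpd_mx c q s) ->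
    nabla a c p (nabla a c q s) x = cpd_mx c p (cpd_mx c q s) x
      + (spin_mx rho (dw0 p q) *m s x + spin_mx rho (w0 q) *m cpd_mx c p s x)
      + spin_mx rho (w0 p) *m (cpd_mx c q s x + spin_mx rho (w0 q) *m s x).
  move=> ds dds; congr (_ + _).
  have dA := spin_conn_diffable p q.
  rewrite cpd_mxE (mx_derivD dds (mx_diffableM dA ds)) (mx_derivM dA ds).
  by rewrite -!cpd_mxE spin_conn_deriv.
rewrite (step k l dks dkls) (step l k dls dlks) sC.
rewrite -(spin_curvature (gamma_rel rho) dw0 connC_skew).
exact: alg.
Qed.

End SpinorCalculus.

Lemma contract_bilinear (K : fieldType) (n p : nat) (Q A B : 'M[K]_n)
    (Z : 'I_n -> 'I_n -> 'cV[K]_p) :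
  \sum_i \sum_j Q i j *: \sum_k \sum_l (A i k * B j l) *: Z k l =
  \sum_k \sum_l (A^T *m Q *m B) k l *: Z k l.
Proof.
transitivity (\sum_i \sum_j \sum_(kl : 'I_n * 'I_n)
    (Q i j * (A i kl.1 * B j kl.2)) *: Z kl.1 kl.2).
  apply: eq_bigr => i _; apply: eq_bigr => j _.
  rewrite pair_big scaler_sumr /=; apply: eq_bigr => -[k l] _ /=.
  by rewrite scalerA.
under eq_bigr do rewrite exchange_big.
rewrite exchange_big [RHS]pair_big /=; apply: eq_bigr => -[k l] _ /=.
rewrite exchange_big mxE scaler_suml; apply: eq_bigr => j _ /=.
rewrite mxE mulr_suml scaler_suml; apply: eq_bigr => i _.
by rewrite mxE; congr (_ *: _); ring.
Qed.

Lemma contract_frame (K : fieldType) (n p : nat) (A : 'M[K]_n)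
    (Z : 'I_n -> 'I_n -> 'cV[K]_p) :
  \sum_i \sum_k \sum_l (A i k * A i l) *: Z k l =
  \sum_k \sum_l (A^T *m A) k l *: Z k l.
Proof.
rewrite exchange_big; apply: eq_bigr => k _ /=.
rewrite exchange_big; apply: eq_bigr => l _ /=.
rewrite mxE scaler_suml; apply: eq_bigr => i _.
by rewrite mxE.
Qed.

Lemma commutator_expand (K : fieldType) (n p : nat) (u : 'I_n -> K)
    (X Y : 'I_n -> 'M[K]_p) (t : 'cV[K]_p) :
  \sum_k u k *: (X k *m ((\sum_l u l *: Y l) *m t))
    - (\sum_l u l *: Y l) *m \sum_k u k *: (X k *m t) =
  \sum_k \sum_l (u k * u l) *: ((X k *m Y l - Y l *m X k) *m t).
Proof.
rewrite mulmx_sumr -sumrB; apply: eq_bigr => k _.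
rewrite !mulmx_suml mulmx_sumr scaler_sumr -sumrB; apply: eq_bigr => l _.
by rewrite -!scalemxAl -!scalemxAr !scalerA [u l * _]mulrC -scalerBr mulmxBl !mulmxA.
Qed.

Lemma square_expand (K : fieldType) (n p : nat) (u : 'I_n -> K)
    (B : 'I_n -> 'M[K]_p) (t : 'I_n -> 'cV[K]_p) :
  \sum_k u k *: (B k *m \sum_l u l *: t l) =
  \sum_k \sum_l (u k * u l) *: (B k *m t l).
Proof.
apply: eq_bigr => k _; rewrite mulmx_sumr scaler_sumr; apply: eq_bigr => l _.
by rewrite -scalemxAr scalerA.
Qed.

(** * The operators of the statement in [chart_at x] *)

Section Weitzenbock.
Context {R : realType} {n : nat} {M : manifold R n}.
Context {g : riemannian_metric M} {o : orientation M}.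
Context {rho : clifford_module R n}.
Variables (P : spin_structure g o rho) (Psi : diff_form M).
Variables (a : spin_idx P) (x : M) (Ux : spin_dom a x).
Variables (s : spinor P) (hs : smooth_spinor s).
Local Notation N := (2 ^ n./2)%N.
Local Notation toC := (map_mx (real_complex R)).
Local Notation e := (spin_frame a).
Local Notation c := (chart_at x).
Local Notation E := (frame_mx e c).
Local Notation Gam := (chris g c).
Local Notation w := (conn_mx g e c).
Let oU := @spin_dom_open _ _ _ _ _ _ P a.
Let he := @spin_frame_on _ _ _ _ _ _ P a.
Let ac := chart_at_atlas x.
Let cx := chart_at_dom x.

Local Notation F := (form_mx a Psi).
Local Notation sig := (s a).
Local Notation nab := (nabla a c).

Definition form_anticomm l y : 'M[R[i]]_N :=
  gam_dn a c l y *m F y + F y *m gam_dn a c l y.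

Definition nabla_pert l (f : M -> 'cV[R[i]]_N) y : 'cV[R[i]]_N :=
  nab l f y - 2^-1 *: (form_anticomm l y *m f y).

Lemma tensorial_at_self X : tensorial_at c X x.
Proof. by rewrite /tensorial_at jac_refl ?mulmx1//; exact: chart_at_dom. Qed.

Lemma form_actE (t : spinor P) y : form_act Psi t a y = F y *m t a y.
Proof. by []. Qed.

Lemma perturbed_diracE (t : spinor P) y : chart_dom c y -> spin_dom a y ->
  cderiv_chart a c t y -> perturbed_dirac Psi t a y =
  \sum_k gam_up a c k y *m nab k (t a) y + F y *m t a y.
Proof. by move=> cy Uy dt; congr (_ + _); exact: (diracE ac cy Uy). Qed.

Lemma cliff_anticommE X (t : spinor P) y : chart_dom c y -> spin_dom a y ->
  tensorial_at c X y -> cliff_anticomm Psi X t a y =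
  \sum_k (X c y 0 k)%:C *: (form_anticomm k y *m t a y).
Proof.
move=> cy Uy Xt; rewrite /cliff_anticomm (cliffE ac cy Uy _ Xt).
rewrite !form_actE (cliffE ac cy Uy _ Xt) !mulmxA -mulmxDl.
rewrite mulmx_suml mulmx_sumr -big_split mulmx_suml; apply: eq_bigr => k _ /=.
by rewrite -scalemxAl -scalemxAr -scalerDr -scalemxAl.
Qed.

Lemma perturbed_connectionE X (t : spinor P) y : chart_dom c y -> spin_dom a y ->
  tensorial_at c X y -> cderiv_chart a c t y ->
  perturbed_connection Psi X t a y =
  \sum_k (X c y 0 k)%:C *: nabla_pert k (t a) y.
Proof.
move=> cy Uy Xt dt; rewrite /perturbed_connection (cliff_anticommE _ cy Uy Xt).
rewrite (spin_connectionE ac cy Uy Xt dt) scaler_sumr -sumrB.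
by apply: eq_bigr => k _; rewrite scalerBr !scalerA mulrC.
Qed.

Lemma smooth_spinor_diffable k : mx_diffable (cpd_at cx k) sig.
Proof.
move=> i j; rewrite ord1; have [sr si] := hs.2 a i _ ac.
by split; [exact: smooth_in_diffable sr cx Ux k|exact: smooth_in_diffable si cx Ux k].
Qed.

Lemma cpd_spinor_diffable k l : mx_diffable (cpd_at cx k) (cpd_mx c l sig).
Proof.
move=> i j; rewrite ord1; have [sr si] := hs.2 a i _ ac.
apply: (diffable_ext (f := fun y => cpd c y l (fun z => sig z i 0))).
  by move=> y; rewrite mxE.
split; first exact: (@smooth_in_pd_diffable _ _ _ _ _ _ _ oU sr cx Ux l k).
exact: (@smooth_in_pd_diffable _ _ _ _ _ _ _ oU si cx Ux l k).
Qed.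

Lemma cpd_spinorC k l : cpd_mx c k (cpd_mx c l sig) x = cpd_mx c l (cpd_mx c k sig) x.
Proof.
have cpd2 p q i : cpd c x p (fun y => cpd_mx c q sig y i 0) =
    cpd c x p (fun y => cpd c y q (fun z => sig z i 0)).
  by apply: (congr1 (cpd c x p)); apply/funext => y; exact: mxE.
apply/matrixP => i j; rewrite ord1 [LHS]mxE [RHS]mxE !cpd2.
have [sr si] := hs.2 a i _ ac.
exact: (congr2 (fun u v => u +i* v)
  (@smooth_in_pdC _ _ _ _ _ _ _ oU sr cx Ux l k)
  (@smooth_in_pdC _ _ _ _ _ _ _ oU si cx Ux l k)).
Qed.

Lemma form_diffable k : mx_diffable (cpd_at cx k) F.
Proof. exact: form_mx_diffable. Qed.

Lemma nabla_spinor_diffable k l : mx_diffable (cpd_at cx k) (nab l sig).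
Proof.
apply: mx_diffableD; first exact: cpd_spinor_diffable.
apply: mx_diffableM; last exact: smooth_spinor_diffable.
exact: spin_conn_diffable.
Qed.

Lemma form_anticomm_diffable k l : mx_diffable (cpd_at cx k) (form_anticomm l).
Proof.
have dg : mx_diffable (cpd_at cx k) (gam_dn a c l) by exact: gam_dn_diffable.
have dF := form_diffable k.
by apply: mx_diffableD; apply: mx_diffableM.
Qed.

Local Notation nend := (nabla_end a c x).

Lemma nabla_form_anticomm k l : nend k (form_anticomm l) =
  \sum_m toC (Gam k x) l m *: form_anticomm m x
  + (gam_dn a c l x *m nend k F + nend k F *m gam_dn a c l x).
Proof.
have dg : mx_diffable (cpd_at cx k) (gam_dn a c l) by exact: gam_dn_diffable.
have dF := form_diffable k.
rewrite (nabla_endD a (mx_diffableM dg dF) (mx_diffableM dF dg)).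
rewrite (nabla_endM a dg dF) (nabla_endM a dF dg) (nabla_gam_dn ac cx Ux).
rewrite [nend k F *m _ + _]addrC addrACA; congr (_ + _).
rewrite mulmx_suml mulmx_sumr -big_split; apply: eq_bigr => m _ /=.
by rewrite -scalemxAl -scalemxAr -scalerDr.
Qed.

Lemma pert_diffable k l :
  mx_diffable (cpd_at cx k) (fun y => (- 2^-1) *: (form_anticomm l y *m sig y)).
Proof.
apply: mx_diffableZ; first exact: diffable_cst.
by apply: mx_diffableM; [exact: form_anticomm_diffable|exact: smooth_spinor_diffable].
Qed.

Lemma nabla_pertE l f :
  nabla_pert l f = fun y => nab l f y + (- 2^-1) *: (form_anticomm l y *m f y).
Proof. by apply/funext => y; rewrite /nabla_pert scaleNr. Qed.

Lemma nabla_pert_diffable k l : mx_diffable (cpd_at cx k) (nabla_pert l sig).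
Proof.
rewrite nabla_pertE; apply: mx_diffableD; last exact: pert_diffable.
exact: nabla_spinor_diffable.
Qed.

Lemma nabla_pert2 k l : nabla_pert k (nabla_pert l sig) x = nab k (nab l sig) x
  - 2^-1 *: (nend k (form_anticomm l) *m sig x
              + form_anticomm l x *m nab k sig x)
  - 2^-1 *: (form_anticomm k x *m nabla_pert l sig x).
Proof.
rewrite {1}/nabla_pert; congr (_ - _).
have dB := form_anticomm_diffable k l; have ds := smooth_spinor_diffable k.
rewrite nabla_pertE (nablaD a (nabla_spinor_diffable k l) (pert_diffable k l)).
rewrite (nablaZ a (diffable_cst _ _) (mx_diffableM dB ds)) deriv_cst scale0r add0r.
by rewrite (nablaM a dB ds) scaleNr.
Qed.

Lemma nabla_pert_near k f h : (\forall y \near x, f y = h y) ->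
  nabla_pert k f x = nabla_pert k h x.
Proof.
move=> fh; rewrite /nabla_pert (nabla_near a cx k fh).
by rewrite (nbhs_singleton fh).
Qed.

Lemma nabla_pert_comb k (V : M -> 'rV[R]_n) : mx_diffable (pd_at cx k) V ->
  nabla_pert k (fun y => \sum_l (V y 0 l)%:C *: nabla_pert l sig y) x =
  \sum_l ((pd_mx c k V x 0 l)%:C *: nabla_pert l sig x
           + (V x 0 l)%:C *: nabla_pert k (nabla_pert l sig) x).
Proof.
move=> dV.
have dVl l : diffable (cpd_at cx k) (fun y => (V y 0 l)%:C).
  exact/cpd_diffable_real/dV.
have dN l := nabla_pert_diffable k l.
rewrite {1}/nabla_pert nabla_sum => [|l]; last exact: mx_diffableZ.
rewrite mulmx_sumr scaler_sumr -sumrB; apply: eq_bigr => l _.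
rewrite (nablaZ a (dVl l) (dN l)) cpd_real -addrA; congr (_ *: _ + _).
  by rewrite mxE.
by rewrite -scalemxAr scalerA mulrC -scalerA -scalerBr.
Qed.

(** The derivatives [dY] of the coefficients cancel, which is the purpose of subtracting the
    derivative along nabla^L_X Y: the Hessian depends only on the values of X and Y. *)
Lemma hessian_algebra (X Y : 'I_n -> R[i]) (dY : 'I_n -> 'I_n -> R[i])
    (Gm : 'I_n -> 'I_n -> 'I_n -> R[i]) (N1 : 'I_n -> 'cV[R[i]]_N)
    (N2 : 'I_n -> 'I_n -> 'cV[R[i]]_N) :
  \sum_k X k *: (\sum_l (dY k l *: N1 l + Y l *: N2 k l))
  - \sum_m (\sum_k X k * (dY k m + \sum_l Y l * Gm k l m)) *: N1 m =
  \sum_k \sum_l (X k * Y l) *: (N2 k l - \sum_m Gm k l m *: N1 m).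
Proof.
under [X in _ - X]eq_bigr => m _ do rewrite scaler_suml.
rewrite [X in _ - X]exchange_big -sumrB; apply: eq_bigr => k _ /=.
under [X in _ - X]eq_bigr => m _ do rewrite -scalerA scalerDl.
rewrite -scaler_sumr -scalerBr !big_split /= opprD addrACA subrr add0r.
under [RHS]eq_bigr => l _ do rewrite -scalerA.
rewrite -scaler_sumr; congr (_ *: _).
under [X in _ - X]eq_bigr => m _ do rewrite scaler_suml.
rewrite [X in _ - X]exchange_big -sumrB; apply: eq_bigr => l _ /=.
rewrite scalerBr scaler_sumr; congr (_ - _).
by apply: eq_bigr => m _; rewrite scalerA.
Qed.

Lemma hessianE X Y : (\forall y \near x, tensorial_at c Y y) ->
  (forall k, mx_diffable (pd_at cx k) (Y c)) ->
  perturbed_connection Psi X (perturbed_connection Psi Y s) a x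
  - perturbed_connection Psi (levi_civita g X Y) s a x =
  \sum_k \sum_l (X c x 0 k * Y c x 0 l)%:C *:
    (nabla_pert k (nabla_pert l sig) x
     - \sum_m toC (Gam k x) l m *: nabla_pert m sig x).
Proof.
move=> Yt dY.
(* The outer connection acts on a section whose smoothness is not known; at x, in [chart_at x], this
   covers it. *)
have self t : cderiv_chart a c t x by exact: cderiv_chart_at.
rewrite (perturbed_connectionE cx Ux (tensorial_at_self X) (self _)).
rewrite (perturbed_connectionE cx Ux (tensorial_at_self _) (self _)).
have inner : \forall y \near x, perturbed_connection Psi Y s a y =
    \sum_l (Y c y 0 l)%:C *: nabla_pert l sig y.
  apply: filterS (filterI Yt (near_frame oU cx Ux)) => y [Yty [cy Uy]].
  exact: (perturbed_connectionE cy Uy Yty (cderiv_chart_smooth ac hs cy Uy)).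
have step k : nabla_pert k (perturbed_connection Psi Y s a) x =
    \sum_l ((pd_mx c k (Y c) x 0 l)%:C *: nabla_pert l sig x
           + (Y c x 0 l)%:C *: nabla_pert k (nabla_pert l sig) x).
  exact: etrans (nabla_pert_near k inner) (nabla_pert_comb (dY k)).
have LC m : (levi_civita g X Y c x 0 m)%:C = \sum_k (X c x 0 k)%:C *
    ((pd_mx c k (Y c) x 0 m)%:C + \sum_l (Y c x 0 l)%:C * toC (Gam k x) l m).
  have Z u (A : 'rV[R]_n) : (u *: A) 0 m = u * A 0 m by rewrite mxE.
  have S (A B : 'rV[R]_n) : (A + B) 0 m = A 0 m + B 0 m by rewrite mxE.
  have T (A : 'rV[R]_n) (B : 'M[R]_n) : (A *m B) 0 m = \sum_l A 0 l * B l m.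
    by rewrite mxE.
  rewrite (levi_civitaE g X Y cx) summxE rmorph_sum; apply: eq_bigr => k _ /=.
  rewrite Z S T rmorphM rmorphD rmorph_sum; congr (_ * (_ + _)).
  by apply: eq_bigr => l _; rewrite rmorphM [toC _ l m]mxE.
have S1 : \sum_k (X c x 0 k)%:C *: nabla_pert k (perturbed_connection Psi Y s a) x =
    \sum_k (X c x 0 k)%:C *: \sum_l ((pd_mx c k (Y c) x 0 l)%:C *: nabla_pert l sig x
           + (Y c x 0 l)%:C *: nabla_pert k (nabla_pert l sig) x).
  apply: eq_bigr => k _.
  exact: (congr1 (fun v => (X c x 0 k)%:C *: v) (step k)).
have S2 : \sum_m (levi_civita g X Y c x 0 m)%:C *: nabla_pert m sig x =
    \sum_m (\sum_k (X c x 0 k)%:C * ((pd_mx c k (Y c) x 0 m)%:C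
       + \sum_l (Y c x 0 l)%:C * toC (Gam k x) l m)) *: nabla_pert m sig x.
  by apply: eq_bigr => m _; rewrite LC.
apply: etrans (congr2 (fun u v : 'cV[R[i]]_N => u - v) S1 S2) _.
apply: etrans (hessian_algebra _ _ _ _ _ _) _.
apply: eq_bigr => k _; apply: eq_bigr => l _; congr (_ *: _).
by rewrite rmorphM.
Qed.

(** The derivatives of t cancel by the Leibniz rule, so this difference of first-order operators is
    multiplication by a matrix. *)
Lemma end_connectionE X (t : spinor P) :
  (forall k, mx_diffable (cpd_at cx k) (t a)) ->
  end_connection X (form_act Psi) t a x =
  \sum_k (X c x 0 k)%:C *: (nend k F *m t a x).
Proof.
move=> dt; have self t' : cderiv_chart a c t' x by exact: cderiv_chart_at.
rewrite /end_connection form_actE.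
rewrite !(spin_connectionE ac cx Ux (tensorial_at_self X) (self _)).
rewrite mulmx_sumr -sumrB; apply: eq_bigr => k _.
have E1 : nab k (form_act Psi t a) x = nend k F *m t a x + F x *m nab k (t a) x.
  exact: (nablaM a (form_diffable k) (dt k)).
by rewrite E1 scalerDr -scalemxAr addrK.
Qed.

Lemma inv_metric_real : inv_metric (toC (E x)) = toC (invmx (g c x)).
Proof. by rewrite /inv_metric map_trmx -map_mxM (invmx_metric he ac cx Ux). Qed.

(** The Jacobians carried by the coordinate fields of c' undo the transformation of the inverse
    metric, so the trace may be taken in [chart_at x]. *)
Lemma laplacianE c' (Z : 'I_n -> 'I_n -> 'cV[R[i]]_N) : atlas c' -> chart_dom c' x ->
  \sum_i \sum_j (ginv g c' x i j)%:C *: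
    \sum_k \sum_l (coord_field c' i c x 0 k * coord_field c' j c x 0 l)%:C *: Z k l =
  \sum_k \sum_l inv_metric (toC (E x)) k l *: Z k l.
Proof.
move=> ac' c'x; pose J := jac c' c x; pose K := jac c c' x.
have JK : J *m K = 1%:M by exact: jacK.
have KJ : K *m J = 1%:M by exact: jacK.
have uG : g c x \in unitmx by exact: metric_unit.
have ginvE : ginv g c' x = K^T *m invmx (g c x) *m K.
  have GE : \matrix_(i, j) ip g (coord_field c' i) (coord_field c' j) x =
      J *m g c x *m J^T.
    apply/matrixP => i j; rewrite [LHS]mxE /ip /coord_field -row_mul mxE [RHS]mxE.
    by apply: eq_bigr => l _; rewrite !mxE.
  have GK : J *m g c x *m J^T *m (K^T *m invmx (g c x) *m K) = 1%:M.
    rewrite -!mulmxA [J^T *m _]mulmxA -trmx_mul KJ trmx1 mul1mx.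
    by rewrite [g c x *m _]mulmxA mulmxV// mul1mx.
  have [uA _] := mulmx1_unit GK.
  by rewrite /ginv GE -[RHS]mul1mx -(mulVmx uA) -[RHS]mulmxA GK mulmx1.
have := contract_bilinear (toC (ginv g c' x)) (toC J) (toC J) Z.
rewrite inv_metric_real map_trmx -!map_mxM ginvE.
rewrite (_ : J^T *m _ *m J = invmx (g c x)); last first.
  by rewrite !mulmxA -trmx_mul KJ trmx1 mul1mx -mulmxA KJ mulmx1.
move=> <-; apply: eq_bigr => i _; apply: eq_bigr => j _.
rewrite [toC _ i j]mxE; congr (_ *: _).
apply: eq_bigr => k _; apply: eq_bigr => l _; congr (_ *: _).
by rewrite [toC _ i k]mxE [toC _ j l]mxE rmorphM /coord_field !mxE.
Qed.

Lemma scalar_curvature_frame : (scalar_curvature g x)%:C =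
  \sum_p \sum_q curv_comp (toC (E x)) (fun k => toC (w k x))
     (fun k l => toC (pd_mx c k (w l) x)) p q q p.
Proof.
rewrite (curv_comp_trace (frameC_orthonormal ac cx Ux) (dd_frameC_sym ac cx Ux)
  (d_frameC_eq ac cx Ux) (dd_frameC_eq ac cx Ux)).
rewrite (scalar_curvatureE g (erefl (chart_at x))) rmorph_sum; apply: eq_bigr => i _.
rewrite rmorph_sum; apply: eq_bigr => j _.
rewrite rmorph_sum; apply: eq_bigr => k _.
rewrite rmorph_sum; apply: eq_bigr => l _.
rewrite !rmorphM inv_metric_real [toC _ j k]mxE [toC _ i l]mxE; congr (_ * _).
rewrite (_ : coord_curv _ _ i j = toC (coord_curv (fun p => Gam p x)
  (fun p q => pd_mx c p (Gam q) x) i j)) -?map_mxM; first by rewrite [RHS]mxE.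
by rewrite /coord_curv !(map_mxB, map_mxM).
Qed.

Section OrthonormalFrame.
Variables (W : set M) (W_open : open W) (f : 'I_n -> vfield M).
Hypotheses (hf : orthonormal_frame g W f) (Wx : W x).
Let A := toC (frame_mx f c x).

(** Both orthonormal frames give the inverse metric, so sums over f may be replaced by contractions
    in the frame of P. *)
Lemma frame_gram : A^T *m A = inv_metric (toC (E x)).
Proof. by rewrite inv_metric_real (invmx_metric hf ac cx Wx) map_mxM -map_trmx. Qed.

Lemma frame_coef j k : A j k = (f j c x 0 k)%:C.
Proof. by rewrite [LHS]mxE mxE. Qed.

Lemma cliff_diffable j k : mx_diffable (cpd_at cx k) (cliff (f j) s a).
Proof.
have [_ sf] := hf.1 j.
apply: (mx_diffable_near (F := fun y =>
    (\sum_l (f j c y 0 l)%:C *: gam_dn a c l y) *m sig y)).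
  apply: filterS (filterI (near_frame oU cx Ux) (near_frame W_open cx Wx)).
  move=> y [[cy Uy] [_ Wy]].
  by rewrite (cliffE ac cy Uy _ (frame_tensorial hf ac j cy Wy)).
apply: mx_diffableM; last exact: smooth_spinor_diffable.
apply: mx_diffable_sum => l; apply: mx_diffableZ; last exact: gam_dn_diffable.
by apply: cpd_diffable_real; exact: smooth_in_diffable (sf c l ac) cx Wx k.
Qed.

Lemma sum_end_connection :
  \sum_j (end_connection (f j) (form_act Psi) (cliff (f j) s) a x
          - cliff (f j) (end_connection (f j) (form_act Psi) s) a x) =
  \sum_k (nend k F *m gam_up a c k x - gam_up a c k x *m nend k F) *m sig x.
Proof.
pose Z k l := (nend k F *m gam_dn a c l x - gam_dn a c l x *m nend k F) *m sig x.
transitivity (\sum_j \sum_k \sum_l (A j k * A j l) *: Z k l).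
  apply: eq_bigr => j _; have ft := tensorial_at_self (f j).
  rewrite (end_connectionE _ (cliff_diffable j)).
  rewrite (cliffE ac cx Ux _ ft) (cliffE ac cx Ux _ ft).
  rewrite (end_connectionE _ smooth_spinor_diffable).
  apply: etrans (commutator_expand _ _ _ _) _.
  apply: eq_bigr => k _; apply: eq_bigr => l _.
  by rewrite !frame_coef.
rewrite contract_frame frame_gram; apply: eq_bigr => k _.
have raise : gam_up a c k x =
    \sum_l inv_metric (toC (E x)) k l *: gam_dn a c l x.
  exact: (gamma_up_dn rho (frameC_orthonormal ac cx Ux) k).
rewrite raise mulmx_sumr mulmx_suml -sumrB mulmx_suml; apply: eq_bigr => l _.
by rewrite -scalemxAr -scalemxAl -scalerBr -scalemxAl.
Qed.

Lemma sum_cliff_anticomm :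
  \sum_j cliff_anticomm Psi (f j) (cliff_anticomm Psi (f j) s) a x =
  \sum_k \sum_l inv_metric (toC (E x)) k l *:
     (form_anticomm k x *m (form_anticomm l x *m sig x)).
Proof.
rewrite -frame_gram -contract_frame; apply: eq_bigr => j _.
have ft := tensorial_at_self (f j).
apply: etrans (cliff_anticommE _ cx Ux ft) _.
have inner := cliff_anticommE s cx Ux ft.
transitivity (\sum_k (f j c x 0 k)%:C *: (form_anticomm k x *m
    \sum_l (f j c x 0 l)%:C *: (form_anticomm l x *m sig x))).
  apply: eq_bigr => k _.
  exact: (congr1 (fun v => (f j c x 0 k)%:C *: (form_anticomm k x *m v)) inner).
apply: etrans (square_expand _ _ _) _.
apply: eq_bigr => k _; apply: eq_bigr => l _; congr (_ *: _).
exact: (congr2 *%R (esym (frame_coef j k)) (esym (frame_coef j l))).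
Qed.

End OrthonormalFrame.

(** The inner operator is rewritten in a neighbourhood of x, where [s] is smooth, and then
    differentiated by the Leibniz rule; the outer one is expanded at x alone. *)
Lemma perturbed_dirac2 :
  perturbed_dirac Psi (perturbed_dirac Psi s) a x =
  \sum_k gam_up a c k x *m
     (\sum_l ((- \sum_m toC (Gam k x) m l *: gam_up a c m x) *m nab l sig x
              + gam_up a c l x *m nab k (nab l sig) x)
      + (nend k F *m sig x + F x *m nab k sig x))
   + F x *m (\sum_l gam_up a c l x *m nab l sig x + F x *m sig x).
Proof.
have self t : cderiv_chart a c t x by exact: cderiv_chart_at.
apply: etrans (perturbed_diracE cx Ux (self _)) _.
pose T y := \sum_l gam_up a c l y *m nab l sig y + F y *m sig y.
have near_T : \forall y \near x, perturbed_dirac Psi s a y = T y.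
  apply: filterS (near_frame oU cx Ux) => y [cy Uy].
  exact: (perturbed_diracE cy Uy (cderiv_chart_smooth ac hs cy Uy)).
have nabT k : nab k (perturbed_dirac Psi s a) x =
    \sum_l ((- \sum_m toC (Gam k x) m l *: gam_up a c m x) *m nab l sig x
              + gam_up a c l x *m nab k (nab l sig) x)
      + (nend k F *m sig x + F x *m nab k sig x).
  apply: etrans (nabla_near a cx k near_T) _.
  have ds := smooth_spinor_diffable k; have dF := form_diffable k.
  have dg l : mx_diffable (cpd_at cx k) (gam_up a c l) by exact: gam_up_diffable.
  have dn l := nabla_spinor_diffable k l.
  have dgn l := mx_diffableM (dg l) (dn l).
  apply: etrans (nablaD a (mx_diffable_sum dgn) (mx_diffableM dF ds)) _.
  apply: (congr2 (fun u v : 'cV[R[i]]_N => u + v)); last exact: nablaM.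
  apply: etrans (nabla_sum a dgn) _; apply: eq_bigr => l _.
  apply: etrans (nablaM a (dg l) (dn l)) _.
  by rewrite (nabla_gam_up ac cx Ux).
apply: (congr2 (fun u v : 'cV[R[i]]_N => u + v)).
  by apply: eq_bigr => k _; exact: (congr1 (mulmx _) (nabT k)).
exact: (congr1 (mulmx _) (nbhs_singleton near_T)).
Qed.

Lemma perturbed_weitzenbock (W : set M) (W_open : open W) (f : 'I_n -> vfield M)
    (hf : orthonormal_frame g W f) (Wx : W x) c' (ac' : atlas c')
    (c'x : chart_dom c' x) :
  perturbed_dirac Psi (perturbed_dirac Psi s) a x =
    - (\sum_i \sum_j (ginv g c' x i j)%:C *:
         (perturbed_connection Psi (coord_field c' i)
            (perturbed_connection Psi (coord_field c' j) s) a x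
          - perturbed_connection Psi
              (levi_civita g (coord_field c' i) (coord_field c' j)) s a x))
    + (4^-1 * (scalar_curvature g x)%:C) *: s a x
    + form_act Psi (form_act Psi s) a x
    - 2^-1 *: (\sum_j
        (end_connection (f j) (form_act Psi) (cliff (f j) s) a x
         - cliff (f j) (end_connection (f j) (form_act Psi) s) a x))
    + 4^-1 *: (\sum_i cliff_anticomm Psi (f i) (cliff_anticomm Psi (f i) s) a x).
Proof.
pose Z k l := nabla_pert k (nabla_pert l sig) x
     - \sum_m toC (Gam k x) l m *: nabla_pert m sig x.
have lap : \sum_i \sum_j (ginv g c' x i j)%:C *:
         (perturbed_connection Psi (coord_field c' i)
            (perturbed_connection Psi (coord_field c' j) s) a x
          - perturbed_connection Psi
              (levi_civita g (coord_field c' i) (coord_field c' j)) s a x) =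
    \sum_k \sum_l inv_metric (toC (E x)) k l *: Z k l.
  apply: etrans (laplacianE Z ac' c'x).
  apply: eq_bigr => i _; apply: eq_bigr => j _.
  apply: (congr1 (fun v => (ginv g c' x i j)%:C *: v)).
  apply: hessianE => [|k].
    apply: filterS (near_dom2 cx c'x) => y [cy c'y].
    exact: coord_tensorial ac cy ac' c'y.
  exact/mx_diffable_row/jac_diffable_r.
have curv k l : nab k (nab l sig) x - nab l (nab k sig) x =
    spin_mx rho (frame_curv (fun k => toC (w k x))
      (fun k l => toC (pd_mx c k (w l) x)) k l) *m sig x.
  exact: (nabla_comm ac Ux (smooth_spinor_diffable k) (smooth_spinor_diffable l)
    (cpd_spinor_diffable k l) (cpd_spinor_diffable l k) (cpd_spinorC k l)).
have main := weitzenbock (gamma_rel rho) (frameC_orthonormal ac cx Ux) (chrisC_sym ac cx)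
  (d_chrisC_sym ac cx) (dd_frameC_sym ac cx Ux) (connC_skew ac cx Ux)
  (d_connC_skew ac cx Ux)
  (d_frameC_eq ac cx Ux) (dd_frameC_eq ac cx Ux) (fun l => nab l sig x) (F x)
  (fun k => nend k F) curv.
apply: etrans perturbed_dirac2 _; apply: etrans main _.
rewrite lap scalar_curvature_frame (sum_end_connection W_open hf Wx).
rewrite (sum_cliff_anticomm hf Wx).
(* The four other summands now agree. What remains is to recognize [N2'] of [weitzenbock] as the
   second perturbed derivative, by [nabla_pert2] and [nabla_form_anticomm]. *)
do 4 apply: (congr1 (fun v : 'cV[R[i]]_N => v + _)).
apply: (congr1 (fun v : 'cV[R[i]]_N => - v)).
apply: eq_bigr => k _; apply: eq_bigr => l _.
apply: (congr1 (fun v : 'cV[R[i]]_N => inv_metric (toC (E x)) k l *: v)).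
apply: (congr1 (fun v : 'cV[R[i]]_N => v - _)).
by rewrite nabla_pert2 nabla_form_anticomm.
Qed.

End Weitzenbock.

Theorem proposition2p1 (R : realType) (n : nat) (M : manifold R n)
    (M_compact : compact [set: M])
    (g : riemannian_metric M) (o : orientation M)
    (rho : clifford_module R n) (P : spin_structure g o rho)
    (Psi : diff_form M)
    (c : chart R n M) (hc : atlas c)
    (W : set M) (W_open : open W)
    (e : 'I_n -> vfield M) (he : orthonormal_frame g W e)
    (s : spinor P) (hs : smooth_spinor s)
    (a : spin_idx P) (x : M)
    (xa : spin_dom a x) (xc : chart_dom c x) (xW : W x) :
  perturbed_dirac Psi (perturbed_dirac Psi s) a x =
    - (\sum_i \sum_j (ginv g c x i j)%:C *:
         (perturbed_connection Psi (coord_field c i)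
            (perturbed_connection Psi (coord_field c j) s) a x
          - perturbed_connection Psi
              (levi_civita g (coord_field c i) (coord_field c j)) s a x))
    + (4^-1 * (scalar_curvature g x)%:C) *: s a x
    + form_act Psi (form_act Psi s) a x
    - 2^-1 *: (\sum_j
        (end_connection (e j) (form_act Psi) (cliff (e j) s) a x
         - cliff (e j) (end_connection (e j) (form_act Psi) s) a x))
    + 4^-1 *: (\sum_i cliff_anticomm Psi (e i) (cliff_anticomm Psi (e i) s) a x).
Proof. exact: (perturbed_weitzenbock Psi xa hs W_open he xW hc xc). Qed.
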